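(* Let $\rho$ be the solution of the Bloch equations (see context), $\rho_{\rm d}(t,n)=\rho(t,n,n)$, and for $k\ne n$, $\tau\ge0$ let $$\Psi_\varepsilon(\tau,k,n):=2|V(n,k)|^2\,\mathrm{Re}\int_0^{\tau}\exp\big(\Omega^\varepsilon(k,n)s\big)\,\phi(\tau)\,\phi(\tau-s)\,ds,\qquad \Omega^\varepsilon(k,n)=-i\omega(k,n)-i\varepsilon^p\delta(k,n)-\varepsilon^\mu\gamma(k,n).$$ Assume that there are $\eta>0$ and $C_\eta>0$ such that: (a) for all $\alpha\in\mathbb{Z}^r\setminus\{0\}$ and all $(n,k)\in\mathbb{N}^2$ with $\alpha\cdot\omega+\omega(n,k)\ne0$, $$|\alpha\cdot\omega+\omega(n,k)|\ge\frac{C_\eta}{(1+|\alpha|)^{r-1+\eta}(1+n)^{1+\eta}(1+k)^{1+\eta}},$$ and for all $\alpha\in\mathbb{Z}^r\setminus\{0\}$, $|\alpha\cdot\omega|\ge C_\eta(1+|\alpha|)^{-(r-1+\eta)}$; (b) $\sum_{\alpha\in\mathbb{Z}^r}(1+|\alpha|)^{r-1+\eta}|\phi_\alpha|^2<\infty$. Define the averaged transition rate $\langle\Psi_\varepsilon\rangle(k,n):=\lim_{s\to+\infty}\frac1s\int_0^s\Psi_\varepsilon(\tau,k,n)\,d\tau$. Its explicit value is $$\langle\Psi_\varepsilon\rangle(k,n)=2|V(n,k)|^2\sum_{\beta\in\mathbb{Z}^r}\frac{\varepsilon^\mu\gamma(k,n)}{\varepsilon^{2\mu}\gamma(k,n)^2+|\omega(k,n)+\beta\cdot\omega+\varepsilon^p\delta(k,n)|^2}\,|\phi_\beta|^2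 .$$ Define $\rho_{\rm d}^{(1)}$ as the solution of $$\partial_t\rho_{\rm d}^{(1)}=\big(\langle\Psi_\varepsilon\rangle+W\big)_\sharp\,\rho_{\rm d}^{(1)},\qquad\rho_{\rm d}^{(1)}(0,n)=\rho_{\rm d}(0,n).$$ Then for all $T>0$ there exists $C>0$, independent of $\varepsilon$, such that $$\|\rho_{\rm d}-\rho_{\rm d}^{(1)}\|_{L^\infty([0,T],l^2)}\le C\,\varepsilon^{1-2\mu}.$$
   Context: Bloch model. Energy levels are labelled by $\mathbb{N}=\{0,1,2,\dots\}$ (for finitely many levels all indices are restricted accordingly). $\varepsilon\in(0,1]$ is a small parameter; $p>0$ and $0\le\mu<1/2$ are fixed exponents. Constants $C$ do not depend on $\varepsilon$ but may depend on all other data. Data (standing assumptions). Real bounded sequences $(\omega(n))_n$, $(\delta(n))_n$; $\omega(n,m)=\omega(n)-\omega(m)$, $\delta(n,m)=\delta(n)-\delta(m)$, $\omega_\varepsilon(n,m)=\omega(n,m)+\varepsilon^p\delta(n,m)$. Relaxation coefficients $\gamma(n,m)=\gamma(m,n)\ge0$, bounded, with $\gamma(n,n)=0$ and $\inf_{n\ne m}\gamma(n,m)=:\gamma>0$. Pauli coefficients $W(n,m)\ge0$ with $\sup_k\sum_n W(n,k)+\sup_n\sum_k W(n,k)<\infty$ and $W(n,m)=\exp(\omega(m,n)/\Theta)\,W(m,n)$ for a fixed normalized temperature $\Theta>0$. Interaction coefficients $V(n,m)\in\mathbb{C}$ with $V(m,n)=V(n,m)^*$ (complex conjugate) and $\sup_k\sum_n|V(n,k)|<\infty$.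 The wave $\phi:\mathbb{R}\to\mathbb{R}$ is bounded and quasiperiodic: $\phi(t)=\sum_{\alpha\in\mathbb{Z}^r}\phi_\alpha e^{i\alpha\cdot\omega t}$ with frequency vector $\omega=(\omega_1,\dots,\omega_r)\in\mathbb{R}^r$, $\alpha\cdot\omega=\sum_j\alpha_j\omega_j$, $\phi_\alpha^*=\phi_{-\alpha}$, $\sum_\alpha|\phi_\alpha|^2<\infty$. Put $\mathcal{V}(s,n,m)=\phi(s)V(n,m)$. Bloch equations. $\rho(t,n,m)$, $t\ge0$, solves $$\varepsilon^2\partial_t\rho(t,n,m)=-i\omega_\varepsilon(n,m)\rho(t,n,m)+Q_\varepsilon(\rho)(n,m)+i\varepsilon\sum_k\Big[\mathcal{V}\big(\tfrac{t}{\varepsilon^2},n,k\big)\rho(t,k,m)-\mathcal{V}\big(\tfrac{t}{\varepsilon^2},k,m\big)\rho(t,n,k)\Big],$$ where $Q_\varepsilon(\rho)(n,m)=-\varepsilon^\mu\gamma(n,m)\rho(t,n,m)$ if $n\ne m$ and $Q_\varepsilon(\rho)(n,n)=\varepsilon^2\sum_k[W(k,n)\rho(t,k,k)-W(n,k)\rho(t,n,n)]$. The initial datum, independent of $\varepsilon$, satisfies $\rho(0,n,m)=0$ for $n\ne m$, $\rho(0,n,n)\ge0$, $\sum_n\rho(0,n,n)<\infty$. There is a unique solution $\rho\in C^0(\mathbb{R}^+,l^1(\mathbb{N}\times\mathbb{N}))$. Notation. To coefficients $A(n,k)$, $n\ne k$, one associates the matrix (operator) $A_\sharp$ with $A_\sharp(n,k)=A(k,n)$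 if $n\ne k$ and $A_\sharp(n,n)=-\sum_{m\ne n}A(n,m)$; thus $(A_\sharp u)(n)=\sum_{k\ne n}[A(k,n)u(k)-A(n,k)u(n)]$. Here $l^q$ is the usual sequence space over the levels. *)

(* Defs.v *)
From HB Require Import structures.
From mathcomp Require Import all_boot all_order all_algebra.
From mathcomp Require Import finmap.
From mathcomp Require Import all_classical all_reals all_analysis.
From mathcomp Require Import complex.

Set Implicit Arguments.
Unset Strict Implicit.
Unset Printing Implicit Defensive.

Import Order.TTheory GRing.Theory Num.Theory.
Import numFieldNormedType.Exports.

Local Open Scope classical_set_scope.
Local Open Scope ring_scope.

Section complex_calculus.
Context {R : realType}.

Definition cabs (z : R[i]) : R := complex.Re `|z|.

Definition ofR (x : R) : R[i] := (x +i* 0)%C.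

Definition imag : R[i] := (0 +i* 1)%C.

Definition cexp (z : R[i]) : R[i] :=
  ofR (expR (complex.Re z)) *
  (cos (complex.Im z) +i* sin (complex.Im z))%C.

(* Sum over a set of levels, in the order of [nat]; every series of this kind
   below is absolutely convergent. *)
Definition rsum (L : set nat) (f : nat -> R) : R :=
  limn (fun N => \sum_(0 <= k < N | k \in L) f k).

Definition csum (L : set nat) (f : nat -> R[i]) : R[i] :=
  (rsum L (fun k => complex.Re (f k)) +i* rsum L (fun k => complex.Im (f k)))%C.

Definition cintegral (A : set R) (f : R -> R[i]) : R[i] :=
  (\int[@lebesgue_measure R]_(x in A) complex.Re (f x)
   +i* \int[@lebesgue_measure R]_(x in A) complex.Im (f x))%C.

Definition l1norm2 (L : set nat) (u : nat -> nat -> R[i]) : \bar R :=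
  \esum_(a in L `*` L) (cabs (u a.1 a.2))%:E.

Definition l2norm (L : set nat) (u : nat -> R[i]) : \bar R :=
  sqrte (\esum_(n in L) (cabs (u n) ^+ 2)%:E).

(* Used for functions continuous in time with values in l^2 only, for which the
   essential supremum is the supremum. *)
Definition Linfl2norm (L : set nat) (T : R) (u : R -> nat -> R[i]) : \bar R :=
  ereal_sup [set l2norm L (u t) | t in [set t : R | 0 <= t <= T]].

End complex_calculus.

Section multi_indices.
Context {R : realType} {r : nat}.
Implicit Types (a : 'rV[int]_r) (w : 'rV[R]_r).

Definition freq_dot a w : R := \sum_(j < r) (a ord0 j)%:~R * w ord0 j.

(* All norms on R^r being equivalent, the choice of the l^1 norm only affects
   constants. *)
Definition mi_norm a : R := \sum_(j < r) `|(a ord0 j)%:~R|.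

End multi_indices.

Record bloch_data (R : realType) := BlochData {
  levels : set nat ;
  om : nat -> R ;
  dl : nat -> R ;
  gam : nat -> nat -> R ;
  Theta : R ;
  Wp : nat -> nat -> R ;
  Vc : nat -> nat -> R[i] ;
  nfreq : nat ;
  freq : 'rV[R]_nfreq ;
  phi_hat : 'rV[int]_nfreq -> R[i] ;
  phi : R -> R ;
  pexp : R ;
  muexp : R ;
  rho0 : nat -> R  (* initial populations rho(0,n,n) *)
}.

Arguments phi_hat {R} D a : rename.

Section bloch.
Context {R : realType}.
Implicit Types (D : bloch_data R) (e : R) (n m k : nat).

Definition om2 D n m : R := om D n - om D m.
Definition dl2 D n m : R := dl D n - dl D m.
Definition om_eps D e n m : R := om2 D n m + e `^ pexp D * dl2 D n m.

Definition phi_partial D (F : {fset 'rV[int]_(nfreq D)}) (t : R) : R[i] :=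
  \sum_(a <- F) phi_hat D a * cexp (imag * ofR (freq_dot a (freq D) * t)).

(* With square-summable coefficients the Fourier series of phi need not converge
   absolutely, and no order is singled out on Z^r: the series is summed along
   the finite subsets of Z^r, in L^2 on bounded intervals. *)
Definition quasiperiodic D : Prop :=
  forall (a b d : R), 0 < d ->
    exists F0 : {fset 'rV[int]_(nfreq D)}, forall F : {fset 'rV[int]_(nfreq D)},
      (F0 `<=` F)%fset ->
      (\int[@lebesgue_measure R]_(t in `[a, b])
         (cabs (ofR (phi D t) - phi_partial F t) ^+ 2)%:E <= d%:E)%E.

Record standing_assumptions D : Prop := StandingAssumptions {
  (* infinitely many levels, or finitely many *)
  sa_levels : levels D = setT \/ exists N, levels D = `I_N ;
  sa_om_bounded : exists M, forall n, levels D n -> `|om D n| <= M ;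
  sa_dl_bounded : exists M, forall n, levels D n -> `|dl D n| <= M ;
  sa_gam_sym : forall n m, levels D n -> levels D m -> gam D n m = gam D m n ;
  sa_gam_ge0 : forall n m, levels D n -> levels D m -> 0 <= gam D n m ;
  sa_gam_bounded : exists M, forall n m, levels D n -> levels D m ->
    gam D n m <= M ;
  sa_gam_diag : forall n, levels D n -> gam D n n = 0 ;
  sa_gam_inf : exists2 g, 0 < g &
    forall n m, levels D n -> levels D m -> n != m -> g <= gam D n m ;
  sa_Theta_gt0 : 0 < Theta D ;
  sa_W_ge0 : forall n m, levels D n -> levels D m -> 0 <= Wp D n m ;
  sa_W_summable :
    (ereal_sup [set \esum_(n in levels D) (Wp D n k)%:E | k in levels D] +
     ereal_sup [set \esum_(k in levels D) (Wp D n k)%:E | n in levels D]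
     < +oo)%E ;
  sa_W_detailed_balance : forall n m, levels D n -> levels D m ->
    Wp D n m = expR (om2 D m n / Theta D) * Wp D m n ;
  sa_V_herm : forall n m, levels D n -> levels D m -> Vc D m n = conjc (Vc D n m) ;
  sa_V_summable :
    (ereal_sup [set \esum_(n in levels D) (cabs (Vc D n k))%:E | k in levels D]
     < +oo)%E ;
  sa_r_gt0 : (0 < nfreq D)%N ;
  sa_phi_hat_real : forall a, conjc (phi_hat D a) = phi_hat D (- a) ;
  sa_phi_hat_l2 :
    (\esum_(a in [set: 'rV[int]_(nfreq D)]) (cabs (phi_hat D a) ^+ 2)%:E < +oo)%E ;
  sa_phi_bounded : exists M, forall t : R, `|phi D t| <= M ;
  sa_phi_measurable : measurable_fun setT (phi D) ;
  sa_phi_quasiperiodic : quasiperiodic D ;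
  sa_p_gt0 : 0 < pexp D ;
  sa_mu_ge0 : 0 <= muexp D ;
  sa_mu_lt : muexp D < 2^-1 ;
  sa_rho0_ge0 : forall n, levels D n -> 0 <= rho0 D n ;
  sa_rho0_summable : (\esum_(n in levels D) (rho0 D n)%:E < +oo)%E
}.

Definition relaxation D e (u : nat -> nat -> R[i]) n m : R[i] :=
  if n == m then
    ofR (e ^+ 2) *
    csum (levels D) (fun k => ofR (Wp D k n) * u k k - ofR (Wp D n k) * u n n)
  else - ofR (e `^ muexp D * gam D n m) * u n m.

Definition wave_potential D (s : R) n m : R[i] := ofR (phi D s) * Vc D n m.

Definition bloch_rhs D e (t : R) (u : nat -> nat -> R[i]) n m : R[i] :=
  - imag * ofR (om_eps D e n m) * u n m
  + relaxation D e u n m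
  + imag * ofR e * csum (levels D) (fun k =>
      wave_potential D (t / e ^+ 2) n k * u k m
      - wave_potential D (t / e ^+ 2) k m * u n k).

(* As phi is only bounded and measurable, the equation is the time-integrated
   one; when phi is continuous this is the equation with a time derivative. *)
Record bloch_solution D e (rho : R -> nat -> nat -> R[i]) : Prop :=
  BlochSolution {
  bs_l1 : forall t : R, 0 <= t -> (l1norm2 (levels D) (rho t) < +oo)%E ;
  bs_continuous : forall t : R, 0 <= t ->
    l1norm2 (levels D) (fun n m => rho s n m - rho t n m)
      @[s --> within [set s : R | 0 <= s] (nbhs t)] --> 0%E ;
  bs_initial : forall n m, levels D n -> levels D m ->
    rho 0 n m = if n == m then ofR (rho0 D n) else 0 ;
  bs_equation : forall (t : R) n m, 0 <= t -> levels D n -> levels D m ->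
    ofR (e ^+ 2) * (rho t n m - rho 0 n m) =
    cintegral `[0, t] (fun s => bloch_rhs D e s (rho s) n m)
}.

Definition Omega_eps D e k n : R[i] :=
  - imag * ofR (om2 D k n) - imag * ofR (e `^ pexp D * dl2 D k n)
  - ofR (e `^ muexp D * gam D k n).

Definition Psi D e (tau : R) k n : R :=
  2 * cabs (Vc D n k) ^+ 2 *
  complex.Re (cintegral `[0, tau] (fun s =>
    cexp (Omega_eps D e k n * ofR s) * ofR (phi D tau) * ofR (phi D (tau - s)))).

Definition Psi_mean D e k n (s : R) : R :=
  s^-1 * \int[@lebesgue_measure R]_(tau in `[0, s]) Psi D e tau k n.

Definition avg_Psi D e k n : R := lim (Psi_mean D e k n s @[s --> +oo]).

Definition avg_Psi_explicit D e k n : R :=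
  2 * cabs (Vc D n k) ^+ 2 *
  fine (\esum_(b in [set: 'rV[int]_(nfreq D)])
    (e `^ muexp D * gam D k n /
     (e `^ (2 * muexp D) * gam D k n ^+ 2 +
      `|om2 D k n + freq_dot b (freq D) + e `^ pexp D * dl2 D k n| ^+ 2)
     * cabs (phi_hat D b) ^+ 2)%:E).

Definition sharp (L : set nat) (A : nat -> nat -> R) (u : nat -> R) n : R :=
  rsum (L `\ n) (fun k => A k n * u k - A n k * u n).

(* The operator is bounded on l^2, so that the solution in C([0,+oo[, l^2) is
   unique; it also is the one in C([0,+oo[, l^1). *)
Record rate_solution D e (rho1 : R -> nat -> R) : Prop := RateSolution {
  rs_l2 : forall t : R, 0 <= t ->
    (l2norm (levels D) (fun n => ofR (rho1 t n)) < +oo)%E ;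
  rs_continuous : forall t : R, 0 <= t ->
    l2norm (levels D) (fun n => ofR (rho1 s n - rho1 t n))
      @[s --> within [set s : R | 0 <= s] (nbhs t)] --> 0%E ;
  rs_initial : forall n, levels D n -> rho1 0 n = rho0 D n ;
  rs_equation : forall (t : R) n, 0 < t -> levels D n ->
    is_derive t 1 (fun s => rho1 s n)
      (sharp (levels D) (fun k m => avg_Psi D e k m + Wp D k m) (rho1 t) n)
}.

Definition small_divisors D (eta C : R) : Prop :=
  (forall (a : 'rV[int]_(nfreq D)) n k, a != 0 -> levels D n -> levels D k ->
     freq_dot a (freq D) + om2 D n k != 0 ->
     C / ((1 + mi_norm a) `^ ((nfreq D)%:R - 1 + eta) * (1 + n%:R) `^ (1 + eta)
          * (1 + k%:R) `^ (1 + eta))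
     <= `|freq_dot a (freq D) + om2 D n k|) /\
  (forall a : 'rV[int]_(nfreq D), a != 0 ->
     C * (1 + mi_norm a) `^ (- ((nfreq D)%:R - 1 + eta))
     <= `|freq_dot a (freq D)|).

Definition wave_regularity D (eta : R) : Prop :=
  (\esum_(a in [set: 'rV[int]_(nfreq D)])
     ((1 + mi_norm a) `^ ((nfreq D)%:R - 1 + eta) * cabs (phi_hat D a) ^+ 2)%:E
   < +oo)%E.

End bloch.

(* Main.v *)
From mathcomp Require Import all_boot all_order all_algebra.
From mathcomp Require Import finmap.
From mathcomp Require Import all_classical all_reals all_analysis.
From mathcomp Require Import measurable_realfun.
From mathcomp Require Import complex ring lra zify.
Require Import Defs.

Set Implicit Arguments.
Unset Strict Implicit.
Unset Printing Implicit Defensive.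

Import Order.TTheory GRing.Theory Num.Theory.
Import numFieldNormedType.Exports.

Local Open Scope classical_set_scope.
Local Open Scope ring_scope.

(** Write [q] for [eps ^ mu]; since [mu < 1/2], [eps <= q ^ 2].

    _A priori bounds._ The commutator with the Hermitian interaction is
    antisymmetric for the Hilbert-Schmidt product, and relaxation only damps the
    coherences [rho n m], [n != m]: the Hilbert-Schmidt norm of [rho] stays
    bounded uniformly in [eps] ([density_le]). The coherences, damped at rate
    [q / eps ^ 2] and forced at rate [1 / eps], are of order [eps / q]
    ([coherence_le]), so that the populations vary at rate [1 / q]. Let [kappa]
    be the response of a damped oscillator to the wave. Up to a remainder of
    order [(eps / q) ^ 2], the coherence is the jump
    [i eps V(n,m) kappa (rho m m - rho n n)] ([chi_le]). In the equation of the
    populations this jump produces exactly the transition rate [Psi], taken at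
    time [t / eps ^ 2], and the remainder an error of order [eps / q ^ 2].

    _Averaging._ By Fubini, the integral of [Psi] over [[0, S]] is a Laplace
    transform of the correlations of the wave. For a trigonometric sum the
    correlation at lag [s] is a diagonal sum, of length [S - s], plus a form
    with coefficients [min S (2 / |(a - b).omega|)] off the diagonal. That form
    is of order [sqrt S] ([offdiagonal_form_le]): multi-indices with nearly
    equal frequencies are far apart because of the small divisor condition,
    which limits how many of them lie in a slab and allows for a Schur test
    against the weights of the regularity condition. Hence [averaging_le]: the
    integral of [Psi] over [[0, S]] is [S] times its average, up to a multiple
    of [|V| ^ 2 (sqrt S / q + 1 / q ^ 2)]. This gives the value of the average,
    and shows, with [S = t / eps ^ 2], that the primitive of [Psi - <Psi>] in
    slow time is of order [|V| ^ 2 eps / q] ([rate_corrector_le]). A corrector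
    built on this primitive replaces [Psi] by its average in the equation of
    the populations, at the cost of errors of order [eps / q ^ 2].

    _Stability._ The averaged rates are of order [1 / q], but nonnegative and
    symmetric, hence dissipative in [l^2] ([ip_exchange_le]). The difference of
    the populations therefore only grows through the Pauli rates, and the
    errors of order [eps / q ^ 2 = eps ^ (1 - 2 mu)] are simply integrated in
    time ([finite_levels_estimate]).

    _Infinitely many levels._ The above is carried out for finitely many levels,
    with constants that do not depend on their number and with small sources
    allowed in both equations. For fixed [eps], both solutions have tails that
    are small uniformly in time, so that the levels above a large [N] act on the
    others as such a source ([truncated_populations_le]). *)

(** * Bounded measurable functions and indefinite integrals *)

Section bounded_measurable.
Context {R : realType}.
Notation mu := (@lebesgue_measure R).
Implicit Types (a b c t : R) (f g : R -> R).

(** These functions form an algebra, in which every integral below is finite. *)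
Definition bmeas a b f :=
  measurable_fun `[a, b] f /\ exists M, forall x, a <= x <= b -> `|f x| <= M.

Lemma bmeas_integrable a b f : bmeas a b f ->
  mu.-integrable `[a, b] (EFin \o f).
Proof.
move=> [mf [M bf]]; apply: measurable_bounded_integrable => //.
- rewrite /= lebesgue_measure_itv/=; case: ifP => // _.
  by rewrite -EFinD ltry.
- exists M; split; first exact: num_real.
  move=> x Mx y /=; rewrite in_itv/= => yab.
  by apply: (le_trans (bf _ yab)); exact: ltW.
Qed.

Lemma bmeasS a b c d f : a <= c -> d <= b -> bmeas a b f -> bmeas c d f.
Proof.
move=> ac db [mf [M bf]]; split.
  apply: measurable_funS mf; first exact: measurable_itv.
  by move=> x /=; rewrite !in_itv/= => /andP[cx xd]; rewrite (le_trans ac)//= (le_trans xd).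
by exists M => x /andP[cx xd]; apply: bf; rewrite (le_trans ac)//= (le_trans xd).
Qed.

Lemma bmeas_ext a b f g : (forall x, a <= x <= b -> f x = g x) -> bmeas a b f -> bmeas a b g.
Proof.
move=> fg [mf [M bf]]; split.
  by apply: eq_measurable_fun mf => x; rewrite inE/= in_itv/= => /fg.
by exists M => x xab; rewrite -fg//; exact: bf.
Qed.

Lemma bmeas_cst a b (c : R) : bmeas a b (fun=> c).
Proof. by split; [exact: measurable_cst|exists `|c|]. Qed.

Lemma bmeasD a b f g : bmeas a b f -> bmeas a b g -> bmeas a b (fun x => f x + g x).
Proof.
move=> [mf [M bf]] [mg [N bg]]; split; first exact: measurable_funD.
exists (M + N) => x xab; apply: (le_trans (ler_normD _ _)).
by apply: lerD; [exact: bf|exact: bg].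
Qed.

Lemma bmeasM a b f g : bmeas a b f -> bmeas a b g -> bmeas a b (fun x => f x * g x).
Proof.
move=> [mf [M bf]] [mg [N bg]]; split; first exact: measurable_funM.
exists (M * N) => x xab; rewrite normrM.
by apply: ler_pM => //; [exact: bf|exact: bg].
Qed.

Lemma bmeasZ a b (c : R) f : bmeas a b f -> bmeas a b (fun x => c * f x).
Proof. by move=> bf; apply: bmeasM => //; exact: bmeas_cst. Qed.

Lemma bmeasN a b f : bmeas a b f -> bmeas a b (fun x => - f x).
Proof.
move=> /(bmeasZ (-1)); apply: bmeas_ext => x _; exact: mulN1r.
Qed.

Lemma bmeasB a b f g : bmeas a b f -> bmeas a b g -> bmeas a b (fun x => f x - g x).
Proof. by move=> bf bg; apply: bmeasD => //; exact: bmeasN. Qed.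

Lemma bmeas_norm a b f : bmeas a b f -> bmeas a b (fun x => `|f x|).
Proof.
move=> [mf [M bf]]; split; first exact: measurableT_comp.
by exists M => x xab; rewrite normr_id; exact: bf.
Qed.

Lemma bmeas_sum a b (I : Type) (r : seq I) (P : pred I) (f : I -> R -> R) :
  (forall i, P i -> bmeas a b (f i)) -> bmeas a b (fun x => \sum_(i <- r | P i) f i x).
Proof.
move=> bf; elim: r => [|i r IH].
  by apply: bmeas_ext (bmeas_cst a b 0) => x _; rewrite big_nil.
have [Pi|nPi] := boolP (P i).
  by apply: bmeas_ext (bmeasD (bf i Pi) IH) => x _; rewrite big_cons Pi.
by apply: bmeas_ext IH => x _; rewrite big_cons (negbTE nPi).
Qed.

Lemma bmeas_continuous a b f : {within `[a, b], continuous f} -> bmeas a b f.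
Proof.
move=> cf; split.
  by apply: subspace_continuous_measurable_fun => //; exact: measurable_itv.
have := continuous_compact cf (@segment_compact _ a b).
move/compact_bounded => -[M [_ /(_ (M + 1))]].
rewrite ltrDl ltr01 => /(_ isT) h.
by exists (M + 1) => x xab; apply: h; exists x => //=; rewrite in_itv.
Qed.

Lemma integral_itvD a b c f : a <= b <= c -> bmeas a c f ->
  \int[mu]_(x in `[a, c]) f x =
  \int[mu]_(x in `[a, b]) f x + \int[mu]_(x in `[b, c]) f x.
Proof.
move=> /andP[ab bc] bf.
have := @Rintegral_itvB _ f (BLeft a) (BRight c) b (bmeas_integrable bf).
rewrite !bnd_simp => /(_ ab bc).
rewrite Rintegral_itv_obnd_cbnd => [<-|]; first by rewrite addrC subrK.
apply: (integrableS _ _ _ (bmeas_integrable (bmeasS ab (lexx c) bf))) => //.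
exact: subset_itv_oc_cc.
Qed.

Lemma integral_le a b f g : bmeas a b f -> bmeas a b g ->
  (forall x, a <= x <= b -> f x <= g x) ->
  \int[mu]_(x in `[a, b]) f x <= \int[mu]_(x in `[a, b]) g x.
Proof.
by move=> bf bg fg; apply: le_Rintegral => //; exact: bmeas_integrable.
Qed.

Lemma integral_cst a b (c : R) : a <= b ->
  \int[mu]_(x in `[a, b]) c = c * (b - a).
Proof.
move=> ab; rewrite Rintegral_cst; last exact: measurable_itv.
congr (_ * _); rewrite /= lebesgue_measure_itv/= lte_fin.
by move: ab; rewrite le_eqVlt => /orP[/eqP->|->//]; rewrite ltxx subrr.
Qed.

Lemma integral_bound a b f M : a <= b -> bmeas a b f ->
  (forall x, a <= x <= b -> `|f x| <= M) ->
  `|\int[mu]_(x in `[a, b]) f x| <= M * (b - a).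
Proof.
move=> ab bf fM; apply: (le_trans (le_normr_Rintegral _ _)) => //.
  exact: bmeas_integrable.
rewrite -integral_cst//; apply: integral_le => //; first exact: bmeas_norm.
exact: bmeas_cst.
Qed.

Lemma integralZ a b (c : R) f : bmeas a b f ->
  \int[mu]_(x in `[a, b]) (c * f x) = c * \int[mu]_(x in `[a, b]) f x.
Proof. by move=> bf; rewrite RintegralZl//; exact: bmeas_integrable. Qed.

Lemma integralD a b f g : bmeas a b f -> bmeas a b g ->
  \int[mu]_(x in `[a, b]) (f x + g x) =
  \int[mu]_(x in `[a, b]) f x + \int[mu]_(x in `[a, b]) g x.
Proof. by move=> bf bg; rewrite RintegralD//; exact: bmeas_integrable. Qed.

Lemma integralB a b f g : bmeas a b f -> bmeas a b g ->
  \int[mu]_(x in `[a, b]) (f x - g x) =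
  \int[mu]_(x in `[a, b]) f x - \int[mu]_(x in `[a, b]) g x.
Proof. by move=> bf bg; rewrite RintegralB//; exact: bmeas_integrable. Qed.

Lemma integral_sum a b (I : Type) (r : seq I) (P : pred I) (f : I -> R -> R) :
  a <= b -> (forall i, P i -> bmeas a b (f i)) ->
  \int[mu]_(x in `[a, b]) (\sum_(i <- r | P i) f i x) =
  \sum_(i <- r | P i) \int[mu]_(x in `[a, b]) f i x.
Proof.
move=> ab bf; elim: r => [|i r IH].
  rewrite big_nil; under eq_Rintegral do rewrite big_nil.
  by rewrite integral_cst// mul0r.
rewrite big_cons; case: ifPn => Pi.
  under eq_Rintegral do rewrite big_cons Pi.
  rewrite integralD ?IH//; first exact: bf.
  by apply: bmeas_sum.
by under eq_Rintegral do rewrite big_cons (negbTE Pi).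
Qed.

Lemma integral_ext a b f g : (forall x, a <= x <= b -> f x = g x) ->
  \int[mu]_(x in `[a, b]) f x = \int[mu]_(x in `[a, b]) g x.
Proof.
by move=> fg; apply: eq_Rintegral => x; rewrite inE/= in_itv/= => /fg.
Qed.

Lemma integral_point a f : \int[mu]_(x in `[a, a]) f x = 0.
Proof. by rewrite set_itv1 Rintegral_set1. Qed.

End bounded_measurable.

Section primitives.
Context {R : realType}.
Notation mu := (@lebesgue_measure R).
Variable T : R.
Hypothesis T0 : 0 <= T.
Implicit Types (x y : R -> R).

(** As the wave is only bounded and measurable, the unknowns are only Lipschitz in
    time: this is the sense given to their time derivatives throughout. *)
Definition primitive x y :=
  bmeas 0 T y /\ forall t, 0 <= t <= T -> x t = x 0 + \int[mu]_(s in `[0, t]) y s.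

Lemma primitive_incr x y s t : primitive x y -> 0 <= s -> s <= t -> t <= T ->
  x t - x s = \int[mu]_(u in `[s, t]) y u.
Proof.
move=> [by_ xy] s0 st tT.
rewrite xy ?(le_trans s0)// (xy s) ?s0 ?(le_trans st)//.
rewrite (@integral_itvD _ 0 s t) ?s0//; first by ring.
exact: bmeasS by_.
Qed.

Lemma primitive_lip x y M s t : primitive x y ->
  (forall u, 0 <= u <= T -> `|y u| <= M) -> 0 <= s <= T -> 0 <= t <= T ->
  `|x t - x s| <= M * `|t - s|.
Proof.
move=> xy yM.
have H u v : 0 <= u -> u <= v -> v <= T -> `|x v - x u| <= M * `|v - u|.
  move=> u0 uv vT; rewrite (primitive_incr xy)// (@ger0_norm _ (v - u)) ?subr_ge0//.
  apply: integral_bound => //; first by apply: bmeasS xy.1.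
  by move=> w /andP[uw wv]; rewrite yM// (le_trans u0)//= (le_trans wv).
move=> /andP[s0 sT] /andP[t0 tT].
have [st|/ltW ts] := leP s t; first exact: H.
by rewrite distrC (distrC t); exact: H.
Qed.

Lemma primitive_continuous x y : primitive x y -> {within `[0, T], continuous x}.
Proof.
move=> xy; have [_ [M yM]] := xy.1.
apply/subspace_continuousP => s /=; rewrite in_itv/= => sT.
have M0 : 0 <= M by rewrite (le_trans _ (yM 0 _))// lexx.
have M1 : 0 < M + 1 by rewrite ltr_wpDl.
apply/cvgrPdist_le => /= e e0; near=> t.
have tT : 0 <= t <= T.
  suff : t \in `[0, T] by rewrite in_itv.
  by near: t; exact: withinT.
apply: (le_trans (primitive_lip xy yM tT _)); rewrite ?sT//.
have : `|s - t| <= e / (M + 1).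
  near: t; apply: cvg_within.
  exists (e / (M + 1)) => /=; first by rewrite divr_gt0.
  by move=> z /= /ltW.
move=> h; apply: (@le_trans _ _ ((M + 1) * (e / (M + 1)))).
  by apply: ler_pM => //; rewrite lerDl.
by rewrite mulrCA divff ?mulr1// gt_eqF.
Unshelve. all: by end_near. Qed.

Lemma primitive_bmeas x y : primitive x y -> bmeas 0 T x.
Proof. by move/primitive_continuous/bmeas_continuous. Qed.

Lemma primitive_ext x y z : (forall s, 0 <= s <= T -> y s = z s) -> primitive x y -> primitive x z.
Proof.
move=> yz [by_ xy]; split; first exact: bmeas_ext by_.
move=> t /andP[t0 tT]; rewrite xy ?t0//; congr (_ + _); apply: integral_ext.
by move=> s /andP[s0 st]; apply: yz; rewrite s0 (le_trans st).
Qed.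

Lemma primitive_extl x y z : (forall s, 0 <= s <= T -> x s = z s) -> primitive x y -> primitive z y.
Proof.
move=> xz [by_ xy]; split=> // t tT; rewrite -!xz ?lexx//; exact: xy.
Qed.

Lemma primitive_cst (c : R) : primitive (fun=> c) (fun=> 0).
Proof.
split; first exact: bmeas_cst.
by move=> t /andP[t0 _]; rewrite integral_cst// mul0r addr0.
Qed.

Lemma primitiveD x1 y1 x2 y2 : primitive x1 y1 -> primitive x2 y2 ->
  primitive (fun t => x1 t + x2 t) (fun t => y1 t + y2 t).
Proof.
move=> [b1 h1] [b2 h2]; split; first exact: bmeasD.
move=> t /andP[t0 tT]; rewrite h1 ?t0// h2 ?t0// integralD; first by ring.
  exact: bmeasS b1.
exact: bmeasS b2.
Qed.

Lemma primitiveZ (c : R) x y : primitive x y -> primitive (fun t => c * x t) (fun t => c * y t).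
Proof.
move=> [b1 h1]; split; first exact: bmeasZ.
move=> t /andP[t0 tT]; rewrite h1 ?t0// integralZ; first by ring.
exact: bmeasS b1.
Qed.

Lemma primitiveN x y : primitive x y -> primitive (fun t => - x t) (fun t => - y t).
Proof.
move=> /(primitiveZ (-1)) h.
by apply: primitive_ext (primitive_extl _ h) => s _; rewrite mulN1r.
Qed.

Lemma primitiveB x1 y1 x2 y2 : primitive x1 y1 -> primitive x2 y2 ->
  primitive (fun t => x1 t - x2 t) (fun t => y1 t - y2 t).
Proof. by move=> h1 /primitiveN; exact: primitiveD. Qed.

Lemma primitive_sum (I : Type) (r : seq I) (P : pred I) (x y : I -> R -> R) :
  (forall i, P i -> primitive (x i) (y i)) ->
  primitive (fun t => \sum_(i <- r | P i) x i t) (fun t => \sum_(i <- r | P i) y i t).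
Proof.
move=> h; elim: r => [|i r IH].
  have H := primitive_cst 0.
  by apply: primitive_ext (primitive_extl _ H) => s _; rewrite big_nil.
have [Pi|nPi] := boolP (P i).
  have := primitiveD (h i Pi) IH.
  by move=> H; apply: primitive_ext (primitive_extl _ H) => s _; rewrite big_cons Pi.
by apply: primitive_ext (primitive_extl _ IH) => s _; rewrite big_cons (negbTE nPi).
Qed.

End primitives.

Lemma eq_ler {R : numDomainType} (x y : R) : x = y -> x <= y.
Proof. by move=> ->. Qed.

Lemma is_derive_scale {R : realType} (c t : R) : is_derive t 1 (fun s : R => c * s) c.
Proof.
have := @is_deriveZ R R R id c t 1 1 (is_derive_id _ _).
by rewrite /GRing.scale /= mulr1.
Qed.
Lemma is_derive_expRM {R : realType} (c t : R) : is_derive t 1 (fun s : R => expR (c * s)) (c * expR (c * t)).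
Proof.
have := is_derive1_comp (is_derive_expR (c * t)) (is_derive_scale c t).
by move=> h; apply: is_derive_eq h _; rewrite mulrC.
Qed.

Section calculus.
Context {R : realType}.
Notation mu := (@lebesgue_measure R).
Implicit Types (x y : R -> R).

Lemma le_half_powers_eq0 (a c : R) : (forall k, `|a| <= c / 2 ^+ k) -> a = 0.
Proof.
move=> ac; apply/eqP; rewrite -normr_eq0; apply/negP => /negP a0.
have {}a0 : 0 < `|a| by rewrite lt_def a0 /=.
have c0 : 0 <= c / `|a|.
  by have := ac 0; rewrite expr0 divr1 => h; rewrite divr_ge0// (le_trans _ h).
have h := archi_boundP c0; set n := Num.bound _ in h.
have := ac n; rewrite ler_pdivlMr ?exprn_gt0// leNgt => /negP; apply.
rewrite mulrC; move: h; rewrite ltr_pdivrMr// => /lt_le_trans; apply.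
by rewrite ler_wpM2r// -natrX ler_nat ltnW// ltn_expl.
Qed.

(** Splitting an interval at its midpoint halves the constant [C]. *)
Lemma quadratic_increments_cst (T C : R) (F : R -> R) :
  (forall s t, 0 <= s -> s <= t -> t <= T -> `|F t - F s| <= C * (t - s) ^+ 2) ->
  forall t, 0 <= t <= T -> F t = F 0.
Proof.
move=> FC t /andP[t0 tT].
have halves k : forall s t, 0 <= s -> s <= t -> t <= T ->
    `|F t - F s| <= C * (t - s) ^+ 2 / 2 ^+ k.
  elim: k => [|k IH] s u s0 su uT; first by rewrite expr0 divr1; exact: FC.
  pose m := (s + u) / 2.
  have sm : s <= m by rewrite /m; lra.
  have mu' : m <= u by rewrite /m; lra.
  rewrite -(subrK (F m) (F u)) -addrA.
  apply: (le_trans (ler_normD _ _)).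
  have h1 := IH m u (le_trans s0 sm) mu' uT.
  have h2 := IH s m s0 sm (le_trans mu' uT).
  apply: (le_trans (lerD h1 h2)).
  rewrite [2 ^+ k.+1]exprS /m le_eqVlt; apply/orP; left; apply/eqP.
  by field; rewrite expf_neq0// pnatr_eq0.
apply/eqP; rewrite -subr_eq0; apply/eqP.
by apply: (@le_half_powers_eq0 _ (C * (t - 0) ^+ 2)) => k; exact: halves.
Qed.

Section on_interval.
Variable T : R.
Hypothesis T0 : 0 <= T.

(** The product differs from the indefinite integral of [y1 * x2 + x1 * y2] by
    a function with quadratic increments, because [x1] and [x2] are Lipschitz. *)
Lemma primitiveM x1 y1 x2 y2 : primitive T x1 y1 -> primitive T x2 y2 ->
  primitive T (fun t => x1 t * x2 t) (fun t => y1 t * x2 t + x1 t * y2 t).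
Proof.
move=> p1 p2.
have [b1 [M1 h1]] := p1.1; have [b2 [M2 h2]] := p2.1.
have bw : bmeas 0 T (fun t => y1 t * x2 t + x1 t * y2 t).
  by apply: bmeasD; apply: bmeasM; [exact: p1.1|exact: (primitive_bmeas T0 p2)
    |exact: (primitive_bmeas T0 p1)|exact: p2.1].
split => // t tT.
pose F t := x1 t * x2 t - \int[mu]_(s in `[0, t]) (y1 s * x2 s + x1 s * y2 s).
suff : F t = F 0 by rewrite /F integral_point subr0 => <-; rewrite subrK.
apply: (@quadratic_increments_cst T (2 * M1 * M2)) tT => {}t u t0 tu uT.
have bwtu f : bmeas 0 T f -> bmeas t u f by exact: bmeasS.
have M10 : 0 <= M1 by rewrite (le_trans _ (h1 0 _))// lexx.
have M20 : 0 <= M2 by rewrite (le_trans _ (h2 0 _))// lexx.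
have -> : F u - F t =
    \int[mu]_(s in `[t, u]) ((x1 u - x1 s) * y2 s + (x2 t - x2 s) * y1 s).
  rewrite /F (@integral_itvD _ 0 t u) ?t0//; last by exact: bmeasS bw.
  have -> : x1 u * x2 u - (\int[mu]_(x in `[0, t]) (y1 x * x2 x + x1 x * y2 x) +
     \int[mu]_(x in `[t, u]) (y1 x * x2 x + x1 x * y2 x)) -
    (x1 t * x2 t - \int[mu]_(s in `[0, t]) (y1 s * x2 s + x1 s * y2 s)) =
    x1 u * (x2 u - x2 t) + x2 t * (x1 u - x1 t)
    - \int[mu]_(x in `[t, u]) (y1 x * x2 x + x1 x * y2 x) by ring.
  rewrite (primitive_incr p1)// (primitive_incr p2)//.
  rewrite -!integralZ; [|exact/bwtu/p1.1|exact/bwtu/p2.1].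
  rewrite -integralD; [|by apply/bmeasZ/bwtu/p2.1|by apply/bmeasZ/bwtu/p1.1].
  rewrite -integralB; [|by apply: bmeasD; apply/bmeasZ/bwtu; [exact: p2.1|exact: p1.1]|exact: bwtu].
  by apply: integral_ext => s _; ring.
have sq : 2 * M1 * M2 * (u - t) ^+ 2 = (2 * M1 * M2 * (u - t)) * (u - t) by ring.
rewrite sq; apply: integral_bound => //.
  apply: bmeasD; apply: bmeasM; [|exact/bwtu/p2.1| |exact/bwtu/p1.1].
    by apply: bmeasB; [exact: bmeas_cst|exact/bwtu/(primitive_bmeas T0 p1)].
  by apply: bmeasB; [exact: bmeas_cst|exact/bwtu/(primitive_bmeas T0 p2)].
move=> s /andP[ts su].
have sT : 0 <= s <= T by rewrite (le_trans t0)//= (le_trans su).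
apply: (le_trans (ler_normD _ _)); rewrite !normrM.
have e1 : `|x1 u - x1 s| <= M1 * (u - t).
  apply: (le_trans (primitive_lip p1 h1 sT _)).
    by rewrite (le_trans t0).
  by rewrite ler_wpM2l// ger0_norm ?subr_ge0// lerB.
have e2 : `|x2 t - x2 s| <= M2 * (u - t).
  apply: (le_trans (primitive_lip p2 h2 sT _)).
    by rewrite t0 (le_trans tu).
  by rewrite ler_wpM2l// distrC ger0_norm ?subr_ge0// lerB.
have := ler_pM (normr_ge0 _) (normr_ge0 _) e1 (h2 s sT).
have := ler_pM (normr_ge0 _) (normr_ge0 _) e2 (h1 s sT).
move=> a b; apply: (le_trans (lerD b a)).
by apply: eq_ler; ring.
Qed.

(** The fundamental theorem of calculus. The rate equation is differentiated at
    positive times only, whence the continuity up to the end points. *)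
Lemma primitive_derive x y : {within `[0, T], continuous x} -> {within `[0, T], continuous y} ->
  (forall t : R, 0 < t < T -> is_derive t 1 x (y t)) -> primitive T x y.
Proof.
move=> cx cy dx; split; first exact: bmeas_continuous.
move=> t /andP[]; rewrite le_eqVlt => /orP[/eqP<- _|t0 tT].
  by rewrite integral_point addr0.
have sub : `[0, t] `<=` `[0, T].
  by move=> s /=; rewrite !in_itv/= => /andP[-> st]; rewrite (le_trans st).
have cx' : {within `[0, t], continuous x} := continuous_subspaceW sub cx.
have := @continuous_FTC2 _ y x 0 t t0 (continuous_subspaceW sub cy).
have dd s : s \in `]0, t[ -> is_derive s 1 x (y s).
  by rewrite in_itv/= => /andP[s0 st]; apply: dx; rewrite s0 (lt_le_trans st).
rewrite /Rintegral => ->; first by rewrite -EFinB /=; ring.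
- split; first by move=> s /dd [].
  + by have [] := (continuous_within_itvP _ t0).1 cx'.
  + by have [] := (continuous_within_itvP _ t0).1 cx'.
- by move=> s /dd h; rewrite derive1E; apply: derive_val.
Qed.

Lemma primitive_derivable x y : (forall t : R, is_derive t 1 x (y t)) -> continuous y ->
  primitive T x y.
Proof.
move=> dx cy; apply: primitive_derive => //; apply: continuous_subspaceT => // t.
apply: differentiable_continuous; apply/derivable1_diffP.
by have [] := dx t.
Qed.

Lemma primitive_le x y t : 0 <= t <= T -> primitive T x y ->
  (forall s, 0 <= s <= t -> y s <= 0) -> x t <= x 0.
Proof.
move=> /andP[t0 tT] [b ->]; last by rewrite t0.
move=> y0; rewrite gerDl.
have := integral_le (bmeasS (lexx 0) tT b) (bmeas_cst 0 t 0) y0.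
by rewrite integral_cst// mul0r.
Qed.

(** Gronwall: [exp (- a t) (x + b / a)] is nonincreasing. *)
Lemma primitive_gronwall x y a b : a != 0 -> primitive T x y ->
  (forall s, 0 <= s <= T -> y s <= a * x s + b) ->
  forall t, 0 <= t <= T -> x t <= expR (a * t) * (x 0 + b / a) - b / a.
Proof.
move=> a0 p yx t tT.
have pe : primitive T (fun t => expR (- a * t)) (fun t => - a * expR (- a * t)).
  apply: primitive_derivable => [s|]; first exact: is_derive_expRM.
  move=> s; apply: cvgMr; apply: continuous_comp; last exact: continuous_expR.
  exact: mulrl_continuous.
have px := primitiveD p (primitive_cst T (b / a)).
have := primitive_le tT (primitiveM pe px).
have h s : 0 <= s <= t -> - a * expR (- a * s) * (x s + b / a) + expR (- a * s) * (y s + 0) <= 0.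
  move=> /andP[s0 st]; have sT : 0 <= s <= T by rewrite s0 (le_trans st)//; case/andP: tT.
  have -> : - a * expR (- a * s) * (x s + b / a) + expR (- a * s) * (y s + 0) =
     expR (- a * s) * (y s - (a * x s + b)) by field.
  by rewrite mulr_ge0_le0 ?expR_ge0// subr_le0 yx.
move=> /(_ h); rewrite mulr0 expR0 mul1r => {}h.
rewrite lerBrDr -(ler_pM2l (expR_gt0 (- a * t))) mulrA -expRD mulNr addNr expR0 mul1r.
by rewrite -mulNr.
Qed.

End on_interval.
End calculus.

(** * Complex numbers in components *)

Ltac nonneg := repeat first
  [ assumption | exact: ler0n | exact: ler01 | exact: sqr_ge0 | exact: expR_ge0
  | exact: normr_ge0 | exact: sqrtr_ge0 | exact: powR_ge0 | exact: ltW
  | apply: mulr_ge0 | apply: addr_ge0 | rewrite invr_ge0 | apply: exprn_ge0 ].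

Section complex_numbers.
Context {R : realType}.
Implicit Types (z w : R[i]) (x y : R).
Notation Re := complex.Re.
Notation Im := complex.Im.

Lemma ReD z w : Re (z + w) = Re z + Re w. Proof. by case: z; case: w. Qed.
Lemma ImD z w : Im (z + w) = Im z + Im w. Proof. by case: z; case: w. Qed.
Lemma ReN z : Re (- z) = - Re z. Proof. by case: z. Qed.
Lemma ImN z : Im (- z) = - Im z. Proof. by case: z. Qed.
Lemma ReB z w : Re (z - w) = Re z - Re w. Proof. by case: z; case: w. Qed.
Lemma ImB z w : Im (z - w) = Im z - Im w. Proof. by case: z; case: w. Qed.
Lemma ReM z w : Re (z * w) = Re z * Re w - Im z * Im w. Proof. by case: z; case: w. Qed.
Lemma ImM z w : Im (z * w) = Re z * Im w + Im z * Re w. Proof. by case: z; case: w. Qed.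
Lemma Re_conj z : Re (conjc z) = Re z. Proof. by case: z. Qed.
Lemma Im_conj z : Im (conjc z) = - Im z. Proof. by case: z. Qed.
Lemma Re_ofR x : Re (ofR x) = x. Proof. by []. Qed.
Lemma Im_ofR x : Im (ofR x) = 0. Proof. by []. Qed.
Lemma Re_imag : Re (@imag R) = 0. Proof. by []. Qed.
Lemma Im_imag : Im (@imag R) = 1. Proof. by []. Qed.
Lemma Re_sum (I : Type) (r : seq I) (P : pred I) (F : I -> R[i]) :
  Re (\sum_(i <- r | P i) F i) = \sum_(i <- r | P i) Re (F i).
Proof. by elim/big_rec2 : _ => [//|i y z _ <-]; rewrite ReD. Qed.
Lemma Im_sum (I : Type) (r : seq I) (P : pred I) (F : I -> R[i]) :
  Im (\sum_(i <- r | P i) F i) = \sum_(i <- r | P i) Im (F i).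
Proof. by elim/big_rec2 : _ => [//|i y z _ <-]; rewrite ImD. Qed.

Definition cE := (ReD, ReN, ReM, Re_conj, Re_ofR, Re_imag,
  (ImD, ImN, ImM, Im_conj, Im_ofR, Im_imag)).

Lemma complexP z w : Re z = Re w -> Im z = Im w -> z = w.
Proof. by case: z; case: w => /= ? ? ? ? -> ->. Qed.

Lemma ofRD x y : ofR (x + y) = ofR x + ofR y.
Proof. by apply: complexP; rewrite ?cE ?addr0. Qed.
Lemma ofRM x y : ofR (x * y) = ofR x * ofR y.
Proof. by apply: complexP; rewrite ?cE; ring. Qed.
Lemma ofRN x : ofR (- x) = - ofR x.
Proof. by apply: complexP; rewrite ?cE ?oppr0. Qed.
Lemma ofR0 : ofR 0 = 0 :> R[i]. Proof. by []. Qed.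
Lemma ofR1 : ofR 1 = 1 :> R[i]. Proof. by []. Qed.

Definition nsq z : R := Re z ^+ 2 + Im z ^+ 2.
(** The real inner product of the plane, which makes energy estimates real. *)
Definition ip z w : R := Re z * Re w + Im z * Im w.

Lemma cabsE z : cabs z = Num.sqrt (nsq z).
Proof. by rewrite /cabs normc_def. Qed.
Lemma nsq_ge0 z : 0 <= nsq z.
Proof. by rewrite addr_ge0// sqr_ge0. Qed.
Lemma cabs_sqr z : cabs z ^+ 2 = nsq z.
Proof. by rewrite cabsE sqr_sqrtr// nsq_ge0. Qed.
Lemma cabs_ge0 z : 0 <= cabs z.
Proof. by rewrite cabsE sqrtr_ge0. Qed.
Lemma nsqM z w : nsq (z * w) = nsq z * nsq w.
Proof. by rewrite /nsq !cE; ring. Qed.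
Lemma cabsM z w : cabs (z * w) = cabs z * cabs w.
Proof. by rewrite !cabsE nsqM sqrtrM// nsq_ge0. Qed.
Lemma nsqN z : nsq (- z) = nsq z.
Proof. by rewrite /nsq !cE !sqrrN. Qed.
Lemma cabsN z : cabs (- z) = cabs z.
Proof. by rewrite !cabsE nsqN. Qed.
Lemma nsq0 : nsq 0 = 0.
Proof. by rewrite /nsq /= expr0n addr0. Qed.
Lemma cabs0 : cabs (0 : R[i]) = 0.
Proof. by rewrite cabsE nsq0 sqrtr0. Qed.
Lemma nsq_conj z : nsq (conjc z) = nsq z.
Proof. by rewrite /nsq !cE sqrrN. Qed.
Lemma cabs_conj z : cabs (conjc z) = cabs z.
Proof. by rewrite !cabsE nsq_conj. Qed.
Lemma nsq_ofR x : nsq (ofR x) = x ^+ 2.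
Proof. by rewrite /nsq /= expr0n addr0. Qed.
Lemma cabs_ofR x : cabs (ofR x) = `|x|.
Proof. by rewrite cabsE nsq_ofR sqrtr_sqr. Qed.
Lemma nsq_imag : nsq (@imag R) = 1.
Proof. by rewrite /nsq /= expr0n add0r expr1n. Qed.

Lemma nsqD_le z w : nsq (z + w) <= 2 * nsq z + 2 * nsq w.
Proof.
rewrite /nsq !cE; have := sqr_ge0 (Re z - Re w); have := sqr_ge0 (Im z - Im w).
by nra.
Qed.
Lemma nsqB_le z w : nsq (z - w) <= 2 * nsq z + 2 * nsq w.
Proof. by rewrite -(nsqN w) nsqD_le. Qed.

Lemma Re_le_cabs z : `|Re z| <= cabs z.
Proof.
rewrite cabsE -sqrtr_sqr ler_sqrt; last exact: nsq_ge0.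
by rewrite /nsq lerDl sqr_ge0.
Qed.
Lemma Im_le_cabs z : `|Im z| <= cabs z.
Proof.
rewrite cabsE -sqrtr_sqr ler_sqrt; last exact: nsq_ge0.
by rewrite /nsq lerDr sqr_ge0.
Qed.
Lemma cabs_triangle z w : cabs (z + w) <= cabs z + cabs w.
Proof.
have := ler_normD z w; rewrite lecE => /andP[_].
by rewrite ReD.
Qed.
Lemma cabs_sum (I : Type) (r : seq I) (P : pred I) (F : I -> R[i]) :
  cabs (\sum_(i <- r | P i) F i) <= \sum_(i <- r | P i) cabs (F i).
Proof.
elim/big_rec2 : _ => [|i y z _ h]; first by rewrite cabs0.
by apply: (le_trans (cabs_triangle _ _)); rewrite lerD2l.
Qed.
Lemma ipzz z : ip z z = nsq z. Proof. by rewrite /ip /nsq !expr2. Qed.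
Lemma ipDr z w u : ip z (w + u) = ip z w + ip z u.
Proof. by rewrite /ip !cE; ring. Qed.
Lemma ipNr z w : ip z (- w) = - ip z w.
Proof. by rewrite /ip !cE; ring. Qed.
Lemma ipBr z w u : ip z (w - u) = ip z w - ip z u.
Proof. by rewrite ipDr ipNr. Qed.
Lemma ipZr x z w : ip z (ofR x * w) = x * ip z w.
Proof. by rewrite /ip !cE; ring. Qed.
Lemma ip_sumr (I : Type) (r : seq I) (P : pred I) z (F : I -> R[i]) :
  ip z (\sum_(i <- r | P i) F i) = \sum_(i <- r | P i) ip z (F i).
Proof.
apply: (big_morph (ip z)) => [? ?|]; first exact: ipDr.
by rewrite /ip /= !mulr0 addr0.
Qed.
Lemma ip_conj z w : ip z w = Re (conjc z * w).
Proof. by rewrite /ip !cE mulNr opprK. Qed.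
Lemma ip_young z w c : 0 < c -> 2 * ip z w <= c * nsq z + nsq w / c.
Proof.
move=> c0; rewrite -subr_ge0.
have -> : c * nsq z + nsq w / c - 2 * ip z w =
   ((c * Re z - Re w) ^+ 2 + (c * Im z - Im w) ^+ 2) / c.
  by rewrite /ip /nsq; field; rewrite gt_eqF.
by rewrite divr_ge0 ?addr_ge0 ?sqr_ge0// ltW.
Qed.
Lemma ip_le z w : 2 * ip z w <= nsq z + nsq w.
Proof. by have := ip_young z w ltr01; rewrite mul1r divr1. Qed.

(** Cauchy-Schwarz with weights [cabs (a k)]. *)
Lemma nsq_sum_le (I : Type) (r : seq I) (P : pred I) (a b : I -> R[i]) :
  nsq (\sum_(k <- r | P k) a k * b k) <=
  (\sum_(k <- r | P k) cabs (a k)) * \sum_(k <- r | P k) cabs (a k) * nsq (b k).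
Proof.
set A := \sum_(k <- r | P k) cabs (a k); set B := \sum_(k <- r | P k) _ * nsq _.
have A0 : 0 <= A by apply: sumr_ge0 => k _; exact: cabs_ge0.
have B0 : 0 <= B by apply: sumr_ge0 => k _; rewrite mulr_ge0 ?cabs_ge0 ?nsq_ge0.
pose D := \sum_(k <- r | P k) cabs (a k) * cabs (b k).
have D0 : 0 <= D by apply: sumr_ge0 => k _; rewrite mulr_ge0 ?cabs_ge0.
have hD : nsq (\sum_(k <- r | P k) a k * b k) <= D ^+ 2.
  rewrite -cabs_sqr ler_sqr ?nnegrE ?cabs_ge0//.
  by apply: (le_trans (cabs_sum _ _ _)); under eq_bigr do rewrite cabsM.
apply: (le_trans hD).
have key t : 0 <= A * t ^+ 2 - 2 * t * D + B.
  have -> : A * t ^+ 2 - 2 * t * D + B =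
     \sum_(k <- r | P k) cabs (a k) * (t - cabs (b k)) ^+ 2.
    rewrite /A /B /D mulr_suml mulr_sumr -sumrB -big_split /=.
    by apply: eq_bigr => k _; rewrite -cabs_sqr; ring.
  by apply: sumr_ge0 => k _; rewrite mulr_ge0 ?cabs_ge0 ?sqr_ge0.
have [A00|An0] := eqVneq A 0.
  have [->|D1] := eqVneq D 0; first by rewrite expr0n mulr_ge0.
  have := key ((B + 1) / D); rewrite A00 mul0r add0r.
  by have -> : - (2 * ((B + 1) / D) * D) + B = - B - 2; [field|lra].
have A1 : 0 < A by rewrite lt_def An0.
have := key (D / A).
have -> : A * (D / A) ^+ 2 - 2 * (D / A) * D + B = (A * B - D ^+ 2) / A by field.
by rewrite pmulr_lge0 ?invr_gt0// subr_ge0.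
Qed.

End complex_numbers.

(** * Energy estimates *)

Section complex_primitives.
Context {R : realType}.
Notation mu := (@lebesgue_measure R).
Notation Re := complex.Re.
Notation Im := complex.Im.
Variable T : R.
Hypothesis T0 : 0 <= T.
Implicit Types (u v : R -> R[i]).

Definition cprimitive u v :=
  primitive T (fun t => Re (u t)) (fun t => Re (v t)) /\
  primitive T (fun t => Im (u t)) (fun t => Im (v t)).

Lemma cprimitive_ext u v w : (forall s, 0 <= s <= T -> v s = w s) ->
  cprimitive u v -> cprimitive u w.
Proof. by move=> vw [h1 h2]; split; [apply: primitive_ext h1|apply: primitive_ext h2] => s /vw ->. Qed.

Lemma cprimitive_extl u v w : (forall s, 0 <= s <= T -> u s = w s) ->
  cprimitive u v -> cprimitive w v.
Proof.
move=> uw [h1 h2]; split; [apply: primitive_extl h1|apply: primitive_extl h2] => //;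
by move=> s /uw ->.
Qed.

Lemma cprimitive_cst (c : R[i]) : cprimitive (fun=> c) (fun=> 0).
Proof. by split; exact: primitive_cst. Qed.

Lemma cprimitiveD u1 v1 u2 v2 : cprimitive u1 v1 -> cprimitive u2 v2 ->
  cprimitive (fun t => u1 t + u2 t) (fun t => v1 t + v2 t).
Proof.
move=> [a b] [c d]; split.
  by apply: primitive_ext (primitive_extl T0 _ (primitiveD a c)) => s _; rewrite cE.
by apply: primitive_ext (primitive_extl T0 _ (primitiveD b d)) => s _; rewrite cE.
Qed.

Lemma cprimitiveM u1 v1 u2 v2 : cprimitive u1 v1 -> cprimitive u2 v2 ->
  cprimitive (fun t => u1 t * u2 t) (fun t => v1 t * u2 t + u1 t * v2 t).
Proof.
move=> [a b] [c d]; split.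
  have h := primitiveB T0 (primitiveM T0 a c) (primitiveM T0 b d).
  by apply: primitive_ext (primitive_extl T0 _ h) => s _; rewrite !cE; ring.
have h := primitiveD (primitiveM T0 a d) (primitiveM T0 b c).
by apply: primitive_ext (primitive_extl T0 _ h) => s _; rewrite !cE; ring.
Qed.

Lemma cprimitiveZ (c : R[i]) u v : cprimitive u v ->
  cprimitive (fun t => c * u t) (fun t => c * v t).
Proof.
move=> h; apply: cprimitive_ext (cprimitiveM (cprimitive_cst c) h) => s _.
by rewrite mul0r add0r.
Qed.

Lemma cprimitiveN u v : cprimitive u v -> cprimitive (fun t => - u t) (fun t => - v t).
Proof.
move=> /(cprimitiveZ (-1)) h.
by apply: cprimitive_ext (cprimitive_extl _ h) => s _; rewrite mulN1r.
Qed.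

Lemma cprimitiveB u1 v1 u2 v2 : cprimitive u1 v1 -> cprimitive u2 v2 ->
  cprimitive (fun t => u1 t - u2 t) (fun t => v1 t - v2 t).
Proof. by move=> h /cprimitiveN; exact: cprimitiveD. Qed.

Lemma cprimitive_sum (I : Type) (r : seq I) (P : pred I) (u v : I -> R -> R[i]) :
  (forall i, P i -> cprimitive (u i) (v i)) ->
  cprimitive (fun t => \sum_(i <- r | P i) u i t) (fun t => \sum_(i <- r | P i) v i t).
Proof.
move=> h; split.
  have H := primitive_sum T0 r (fun i Pi => (h i Pi).1).
  by apply: primitive_ext (primitive_extl T0 _ H) => s _; rewrite Re_sum.
have H := primitive_sum T0 r (fun i Pi => (h i Pi).2).
by apply: primitive_ext (primitive_extl T0 _ H) => s _; rewrite Im_sum.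
Qed.

Lemma cprimitive_ofR x y : primitive T x y ->
  cprimitive (fun t => ofR (x t)) (fun t => ofR (y t)).
Proof. by move=> h; split => //; exact: primitive_cst. Qed.

Lemma primitive_nsq u v : cprimitive u v ->
  primitive T (fun t => nsq (u t)) (fun t => 2 * ip (u t) (v t)).
Proof.
move=> [a b].
have h := primitiveD (primitiveM T0 a a) (primitiveM T0 b b).
by apply: primitive_ext (primitive_extl T0 _ h) => s _; rewrite /nsq /ip; ring.
Qed.

Section energy.
Context {I : finType} (u v f : I -> R -> R[i]) (B : R).
Hypothesis uv : forall i, cprimitive (u i) (v i).
Hypothesis fB : forall s, 0 <= s <= T -> \sum_i nsq (f i s) <= B.

Let E t := \sum_i nsq (u i t).

Let primitive_E : primitive T E (fun t => 2 * \sum_i ip (u i t) (v i t)).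
Proof.
have h := primitive_sum T0 (index_enum I) (fun i (_ : xpredT i) => primitive_nsq (uv i)).
by apply: primitive_ext h => s _; rewrite mulr_sumr.
Qed.

Let young c s : 0 < c -> 0 <= s <= T ->
  2 * \sum_i ip (u i s) (f i s) <= c * E s + B / c.
Proof.
move=> c0 sT; apply: (@le_trans _ _ (c * E s + (\sum_i nsq (f i s)) / c)).
  by rewrite !mulr_sumr mulr_suml -big_split; apply: ler_sum => i _; exact: ip_young.
by rewrite lerD2l ler_wpM2r ?fB// invr_ge0 ltW.
Qed.

(** Young's inequality [2 <u, f> <= a |u| ^ 2 + |f| ^ 2 / a] uses up half of the
    damping; the other half bounds the energy for all times. *)
Lemma energy_decay (a : R) : 0 < a ->
  (forall s, 0 <= s <= T ->
     \sum_i ip (u i s) (v i s) <= - a * E s + \sum_i ip (u i s) (f i s)) ->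
  forall t, 0 <= t <= T -> E t <= E 0 + B / a ^+ 2.
Proof.
move=> a0 h t tT.
have na0 : - a != 0 by rewrite oppr_eq0 gt_eqF.
have hy s : 0 <= s <= T -> 2 * \sum_i ip (u i s) (v i s) <= - a * E s + B / a.
  move=> sT; have := h s sT; have := young a0 sT; lra.
have := primitive_gronwall T0 na0 primitive_E hy tT.
have -> : B / a / - a = - (B / a ^+ 2) by field; rewrite gt_eqF.
rewrite opprK => /le_trans; apply.
have e1 : expR (- a * t) <= 1.
  by rewrite -expR0 ler_expR mulNr oppr_le0 mulr_ge0 ?(ltW a0)//; case/andP: tT.
have e0 := expR_ge0 (- a * t).
have B0 : 0 <= B / a ^+ 2.
  rewrite divr_ge0 ?sqr_ge0// (le_trans _ (fB tT))// sumr_ge0// => i _; exact: nsq_ge0.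
have E0 : 0 <= E 0 by apply: sumr_ge0 => i _; exact: nsq_ge0.
nra.
Qed.

(** The same without damping, for quantities that evolve on the slow scale. *)
Lemma energy_growth (c : R) : 0 <= c ->
  (forall s, 0 <= s <= T ->
     \sum_i ip (u i s) (v i s) <= c * E s + \sum_i ip (u i s) (f i s)) ->
  forall t, 0 <= t <= T -> E t <= expR ((2 * c + 1) * T) * (E 0 + B).
Proof.
move=> c0 h t tT.
have na0 : 2 * c + 1 != 0 by rewrite gt_eqF// ltr_wpDl ?mulr_ge0.
have hy s : 0 <= s <= T -> 2 * \sum_i ip (u i s) (v i s) <= (2 * c + 1) * E s + B.
  move=> sT; have := h s sT; have := young ltr01 sT; rewrite divr1; lra.
have := primitive_gronwall T0 na0 primitive_E hy tT.
move=> /le_trans; apply.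
have e1 : expR ((2 * c + 1) * t) <= expR ((2 * c + 1) * T).
  by case/andP: tT => _ tT'; rewrite ler_expR ler_wpM2l// addr_ge0 ?mulr_ge0.
have e0 := expR_ge0 ((2 * c + 1) * t).
have B0 : 0 <= B.
  rewrite (le_trans _ (fB tT))// sumr_ge0// => i _; exact: nsq_ge0.
have B1 : 0 <= B / (2 * c + 1) <= B.
  rewrite divr_ge0 ?addr_ge0 ?mulr_ge0//= ler_pdivrMr ?ltr_wpDl ?mulr_ge0//.
  by rewrite ler_peMr// lerDr mulr_ge0.
have E0 : 0 <= E 0 by apply: sumr_ge0 => i _; exact: nsq_ge0.
case/andP: B1 => B1 B2.
apply: (@le_trans _ _ (expR ((2 * c + 1) * t) * (E 0 + B / (2 * c + 1)))).
  by rewrite lerBlDr lerDl.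
by apply: ler_pM => //; [rewrite addr_ge0|rewrite lerD2l].
Qed.

End energy.
End complex_primitives.

(** * Matrices over the levels *)

Section finite_sums.
Context {R : realType} {I : finType}.
Implicit Types (X : I -> I -> R[i]) (x : I -> R[i]).

Definition hs2 X : R := \sum_(p : I * I) nsq (X p.1 p.2).
Definition l2n x : R := \sum_n nsq (x n).
Definition offdiag X n m : R[i] := if n == m then 0 else X n m.

Lemma hs2E X : hs2 X = \sum_n \sum_m nsq (X n m).
Proof. by rewrite pair_bigA. Qed.
Lemma hs2_ge0 X : 0 <= hs2 X.
Proof. by apply: sumr_ge0 => p _; exact: nsq_ge0. Qed.
Lemma ler_term (J : finType) (F : J -> R) j : (forall i, 0 <= F i) -> F j <= \sum_i F i.
Proof. by move=> F0; rewrite (bigD1 j)//= lerDl sumr_ge0. Qed.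
Lemma l2n_diag_le X : l2n (fun n => X n n) <= hs2 X.
Proof.
by rewrite hs2E; apply: ler_sum => n _; apply: (ler_term (F := fun m => nsq (X n m))) => m; exact: nsq_ge0.
Qed.

Lemma hs2D_le X Y : hs2 (fun n m => X n m + Y n m) <= 2 * hs2 X + 2 * hs2 Y.
Proof. by rewrite !mulr_sumr -big_split; apply: ler_sum => p _; exact: nsqD_le. Qed.
Lemma hs2B_le X Y : hs2 (fun n m => X n m - Y n m) <= 2 * hs2 X + 2 * hs2 Y.
Proof. by rewrite !mulr_sumr -big_split; apply: ler_sum => p _; exact: nsqB_le. Qed.
Lemma hs2_offdiag_le X : hs2 (offdiag X) <= hs2 X.
Proof.
apply: ler_sum => p _; rewrite /offdiag; case: ifP => // _.
by rewrite nsq0 nsq_ge0.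
Qed.
Lemma l2nD_le x y : l2n (fun n => x n + y n) <= 2 * l2n x + 2 * l2n y.
Proof. by rewrite !mulr_sumr -big_split; apply: ler_sum => p _; exact: nsqD_le. Qed.
Lemma l2nB_le x y : l2n (fun n => x n - y n) <= 2 * l2n x + 2 * l2n y.
Proof. by rewrite !mulr_sumr -big_split; apply: ler_sum => p _; exact: nsqB_le. Qed.

(** The Schur test: Cauchy-Schwarz with weights [cabs (a n k)], then an exchange of
    the sums. *)
Lemma schur_vec (a : I -> I -> R[i]) (A B : R) x : 0 <= A ->
  (forall n, \sum_k cabs (a n k) <= A) -> (forall k, \sum_n cabs (a n k) <= B) ->
  l2n (fun n => \sum_k a n k * x k) <= A * B * l2n x.
Proof.
move=> A0 hA hB.
apply: (@le_trans _ _ (\sum_n A * \sum_k cabs (a n k) * nsq (x k))).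
  apply: ler_sum => n _; apply: (le_trans (nsq_sum_le _ _ _ _)).
  by rewrite ler_wpM2r// sumr_ge0// => k _; rewrite mulr_ge0 ?cabs_ge0 ?nsq_ge0.
rewrite -mulr_sumr -mulrA ler_wpM2l// exchange_big /= mulr_sumr; apply: ler_sum => k _.
by rewrite -mulr_suml ler_wpM2r// nsq_ge0.
Qed.

Lemma schur_mat (a : I -> I -> R[i]) (A B : R) X : 0 <= A ->
  (forall n, \sum_k cabs (a n k) <= A) -> (forall k, \sum_n cabs (a n k) <= B) ->
  hs2 (fun n m => \sum_k a n k * X k m) <= A * B * hs2 X.
Proof.
move=> A0 hA hB; rewrite !hs2E exchange_big [X in _ <= _ * X]exchange_big mulr_sumr.
by apply: ler_sum => m _; apply: (schur_vec (fun k => X k m)).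
Qed.

End finite_sums.

Section commutator.
Context {R : realType} {I : finType} (V : I -> I -> R[i]) (Vs : R).
Hypothesis Vs0 : 0 <= Vs.
Hypothesis V_herm : forall n m, V m n = conjc (V n m).
Hypothesis V_row : forall n, \sum_k cabs (V n k) <= Vs.
Implicit Types (X : I -> I -> R[i]) (x : I -> R[i]).

Definition comm X n m := \sum_k (V n k * X k m - V k m * X n k).

Lemma V_col k : \sum_n cabs (V n k) <= Vs.
Proof. by under eq_bigr do rewrite V_herm cabs_conj; exact: V_row. Qed.

Lemma comm_le X : hs2 (comm X) <= 4 * Vs ^+ 2 * hs2 X.
Proof.
have -> : hs2 (comm X) = hs2 (fun n m => \sum_k V n k * X k m - \sum_k V k m * X n k).
  by apply: eq_bigr => p _; rewrite /comm sumrB.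
apply: (le_trans (hs2B_le _ _)).
have h1 := schur_mat X Vs0 V_row V_col.
have h2 : hs2 (fun n m => \sum_k V k m * X n k) <= Vs * Vs * hs2 X.
  rewrite hs2E exchange_big /= -hs2E.
  rewrite [leRHS](_ : _ = Vs * Vs * hs2 (fun m n => X n m)); last by rewrite !hs2E exchange_big.
  exact: (schur_mat (a := fun m k => V k m) (fun k n => X n k)) V_col V_row.
nra.
Qed.

Lemma nsqV_row n : \sum_k nsq (V n k) <= Vs ^+ 2.
Proof.
apply: (@le_trans _ _ (\sum_k Vs * cabs (V n k))).
  apply: ler_sum => k _; rewrite -cabs_sqr expr2 ler_wpM2r ?cabs_ge0//.
  by apply: le_trans (V_row n); apply: (ler_term (F := fun k => cabs (V n k))) => i; exact: cabs_ge0.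
by rewrite -mulr_sumr expr2 ler_wpM2l.
Qed.

Lemma nsqV_sym n k : nsq (V n k) = nsq (V k n).
Proof. by rewrite V_herm nsq_conj. Qed.

(** The diagonal of [X] acts through its jumps [X m m - X n n], hence not on the
    diagonal of the commutator. *)
Lemma comm_offdiag X n m :
  comm X n m = V n m * (X m m - X n n) + comm (offdiag X) n m.
Proof.
rewrite /comm !sumrB (bigD1 m)//= [X in _ - X](bigD1 n)//=.
rewrite [X in _ = _ + (X - _)](bigD1 m)//= [X in _ = _ + (_ - X)](bigD1 n)//=.
rewrite /offdiag !eqxx !mulr0 !add0r.
under [X in _ = _ + (X - _)]eq_bigr => k /negbTE -> do [].
under [X in _ = _ + (_ - X)]eq_bigr => k do [rewrite eq_sym => /negbTE ->].
by ring.
Qed.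

(** [tr (X^* V X)] and [tr (X^* X V)] are real when [V] is Hermitian. *)
Lemma ip_comm X : \sum_(p : I * I) ip (X p.1 p.2) (imag * comm X p.1 p.2) = 0.
Proof.
pose S1 := \sum_n \sum_m \sum_k conjc (X n m) * (V n k * X k m).
pose S2 := \sum_n \sum_m \sum_k conjc (X n m) * (V k m * X n k).
have conj_sum (J : finType) (F : J -> R[i]) : conjc (\sum_j F j) = \sum_j conjc (F j).
  by rewrite (big_morph _ (@rmorphD _ _ (@conjc R)) (@rmorph0 _ _ (@conjc R))).
have conjM (z w : R[i]) : conjc (z * w) = conjc z * conjc w by exact: rmorphM.
have conjK (z : R[i]) : conjc (conjc z) = z by exact: conjcK.
have conj3 (F G : I -> I -> I -> R[i]) : (forall n m k, conjc (F n m k) = G n m k) ->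
    conjc (\sum_n \sum_m \sum_k F n m k) = \sum_n \sum_m \sum_k G n m k.
  move=> FG; rewrite conj_sum; apply: eq_bigr => n _; rewrite conj_sum.
  by apply: eq_bigr => m _; rewrite conj_sum; apply: eq_bigr => k _.
have r1 : conjc S1 = S1.
  rewrite /S1 (conj3 _ (fun n m k => conjc (X k m) * (V k n * X n m))); last first.
    by move=> n m k; rewrite !conjM conjK -V_herm; ring.
  rewrite exchange_big [RHS]exchange_big /=; apply: eq_bigr => m _.
  by rewrite exchange_big.
have r2 : conjc S2 = S2.
  rewrite /S2 (conj3 _ (fun n m k => conjc (X n k) * (V m k * X n m))); last first.
    by move=> n m k; rewrite !conjM conjK -V_herm; ring.
  by apply: eq_bigr => n _; rewrite exchange_big.
have im0 (z : R[i]) : conjc z = z -> complex.Im z = 0.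
  by case: z => a b [] /eqP; rewrite -subr_eq0 -opprD oppr_eq0 -mulr2n mulrn_eq0 => /eqP.
transitivity (complex.Re (imag * (S1 - S2))); last by rewrite !cE (im0 _ r1) (im0 _ r2); ring.
rewrite -(pair_bigA _ (fun n m => ip (X n m) (imag * comm X n m))) /=.
rewrite /S1 /S2 -sumrB mulr_sumr Re_sum; apply: eq_bigr => n _.
rewrite -sumrB mulr_sumr Re_sum; apply: eq_bigr => m _.
by rewrite ip_conj /comm -sumrB mulrCA mulr_sumr; congr (complex.Re (_ * _)); apply: eq_bigr => k _; ring.
Qed.
End commutator.

(** * The estimate for finitely many levels *)

(** In this section [q] stands for [eps ^ mu], [f] for the wave in slow time, [nu]
    for the transition frequencies, and [sigma], [sigma1] for the action of the
    levels that have been discarded. The constants [K1] to [K8] depend on the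
    bounds of the first line only, neither on [e] nor on the number of levels. *)
Section finite_levels.
Context {R : realType} {I : finType}.
Notation Re := complex.Re.
Notation Im := complex.Im.
Variables (T M Vs Ws g0 B0 CA CP : R).
Hypotheses (T0 : 0 <= T) (M0 : 0 <= M) (Vs0 : 0 <= Vs) (Ws0 : 0 <= Ws) (g00 : 0 < g0)
  (B00 : 0 <= B0) (CA0 : 0 <= CA) (CP0 : 0 <= CP).

Variables (V : I -> I -> R[i]) (W gam nu : I -> I -> R).
Hypothesis V_herm : forall n m, V m n = conjc (V n m).
Hypothesis V_row : forall n, \sum_k cabs (V n k) <= Vs.
Hypothesis W_ge0 : forall n m, 0 <= W n m.
Hypothesis W_row : forall n, \sum_k W n k <= Ws.
Hypothesis W_col : forall k, \sum_n W n k <= Ws.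
Hypothesis gam_ge : forall n m, n != m -> g0 <= gam n m.

Variables (e q : R).
Hypotheses (e0 : 0 < e) (e1 : e <= 1) (q0 : 0 < q) (q1 : q <= 1) (eq2 : e <= q ^+ 2).

Variable f : R -> R.
Hypothesis f_le : forall s, 0 <= s <= T -> `|f s| <= M.

Definition Lam n m : R[i] := (- imag * ofR (nu n m) - ofR (q * gam n m)) * ofR (e ^- 2).

Definition rate_W (x : I -> R[i]) n : R[i] :=
  \sum_k (ofR (W k n) * x k - ofR (W n k) * x n).

Variables (rho sigma : I -> I -> R -> R[i]).

Definition drho n m s : R[i] :=
  (if n == m then rate_W (fun k => rho k k s) n else Lam n m * rho n m s)
  + imag * ofR (e^-1 * f s) * comm V (fun n m => rho n m s) n m + sigma n m s.

Hypothesis rho_drho : forall n m, cprimitive T (rho n m) (drho n m).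
Hypothesis rho_init : forall n m, n != m -> rho n m 0 = 0.
Hypothesis rho_init_le : l2n (fun n => rho n n 0) <= B0.
Hypothesis sigma_le : forall s, 0 <= s <= T -> hs2 (fun n m => sigma n m s) <= e ^+ 2.

Lemma nsq_imag_ofR (x : R) z : nsq (imag * ofR x * z) = x ^+ 2 * nsq z.
Proof. by rewrite !nsqM nsq_imag mul1r nsq_ofR. Qed.

Lemma ip_Lam n m z : ip z (Lam n m * z) = - (q * gam n m * e ^- 2) * nsq z.
Proof. by rewrite /ip /nsq /Lam !cE; ring. Qed.

Lemma ip_rate_W_le (x : I -> R[i]) : \sum_n ip (x n) (rate_W x n) <= Ws * l2n x.
Proof.
apply: (@le_trans _ _ (\sum_n \sum_k (W k n * nsq (x n) + W k n * nsq (x k)) / 2)).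
  apply: ler_sum => n _; rewrite ip_sumr; apply: ler_sum => k _.
  rewrite ipBr !ipZr ipzz; have := ip_le (x n) (x k); have := W_ge0 k n.
  have := mulr_ge0 (W_ge0 n k) (nsq_ge0 (x n)); nra.
have h1 : \sum_n \sum_k W k n * nsq (x n) <= Ws * l2n x.
  rewrite mulr_sumr; apply: ler_sum => n _; rewrite -mulr_suml.
  by rewrite ler_wpM2r ?nsq_ge0.
have h2 : \sum_n \sum_k W k n * nsq (x k) <= Ws * l2n x.
  rewrite exchange_big mulr_sumr; apply: ler_sum => n _; rewrite -mulr_suml.
  by rewrite ler_wpM2r ?nsq_ge0.
under eq_bigr do rewrite -mulr_suml big_split.
rewrite -mulr_suml big_split /=; lra.
Qed.

Lemma l2n_rate_W_le (x : I -> R[i]) : l2n (rate_W x) <= 4 * Ws ^+ 2 * l2n x.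
Proof.
have -> : l2n (rate_W x) =
    l2n (fun n => \sum_k ofR (W k n) * x k - \sum_k ofR (W n k) * x n).
  by apply: eq_bigr => n _; rewrite /rate_W sumrB.
apply: (le_trans (l2nB_le _ _)).
have h1 : l2n (fun n => \sum_k ofR (W k n) * x k) <= Ws * Ws * l2n x.
  apply: (schur_vec (a := fun n k => ofR (W k n))) => // [n|k].
    by under eq_bigr do rewrite cabs_ofR ger0_norm//.
  by under eq_bigr do rewrite cabs_ofR ger0_norm//.
have h2 : l2n (fun n => \sum_k ofR (W n k) * x n) <= Ws * Ws * l2n x.
  rewrite mulr_sumr; apply: ler_sum => n _; rewrite -mulr_suml nsqM ler_wpM2r ?nsq_ge0//.
  rewrite -cabs_sqr expr2; apply: ler_pM; rewrite ?cabs_ge0//.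
    by apply: (le_trans (cabs_sum _ _ _)); under eq_bigr do rewrite cabs_ofR ger0_norm//.
  by apply: (le_trans (cabs_sum _ _ _)); under eq_bigr do rewrite cabs_ofR ger0_norm//.
nra.
Qed.

(** Since the commutator term is antisymmetric and relaxation dissipative, only
    the Pauli term can make the Hilbert-Schmidt norm grow, uniformly in [e]. *)
Definition K1 := expR ((2 * Ws + 1) * T) * (B0 + 1).

Let R2 s := hs2 (fun n m => rho n m s).

Lemma density_le t : 0 <= t <= T -> R2 t <= K1.
Proof.
move=> tT.
have := @energy_growth R T T0 (I * I)%type (fun p => rho p.1 p.2) (fun p => drho p.1 p.2)
  (fun p => sigma p.1 p.2) (e ^+ 2) (fun p => rho_drho p.1 p.2) sigma_le Ws Ws0.
move=> /(_ _ _ tT) h; apply: (le_trans (h _)) => [s sT|].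
  have := ip_comm V_herm (fun n m => rho n m s) => hc.
  have -> : \sum_(p : I * I) ip (rho p.1 p.2 s) (drho p.1 p.2 s) =
     \sum_(p : I * I) ip (rho p.1 p.2 s)
       (if p.1 == p.2 then rate_W (fun k => rho k k s) p.1 else Lam p.1 p.2 * rho p.1 p.2 s)
     + \sum_(p : I * I) ip (rho p.1 p.2 s) (sigma p.1 p.2 s).
    have := congr1 (fun x => e^-1 * f s * x) hc; rewrite mulr0 mulr_sumr => {}hc.
    rewrite -[RHS]addr0 -[X in _ = _ + X]hc -!big_split /=.
    apply: eq_bigr => p _; rewrite /drho !ipDr -ipZr; rewrite addrAC; congr (_ + _ + ip _ _).
    by rewrite mulrA (mulrC imag).
  rewrite lerD2r -(pair_bigA _ (fun n m => ip (rho n m s)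
       (if n == m then rate_W (fun k => rho k k s) n else Lam n m * rho n m s))) /=.
  apply: (@le_trans _ _ (\sum_n ip (rho n n s) (rate_W (fun k => rho k k s) n))).
    apply: ler_sum => n _; rewrite (bigD1 n)//= eqxx gerDl sumr_le0// => m mn.
    rewrite eq_sym (negbTE mn) ip_Lam mulr_le0_ge0 ?nsq_ge0// oppr_le0.
    rewrite mulr_ge0 ?invr_ge0 ?sqr_ge0// mulr_ge0 ?(ltW q0)// (le_trans (ltW g00))//.
    by rewrite gam_ge// eq_sym.
  apply: (le_trans (ip_rate_W_le _)); rewrite ler_wpM2l//.
  exact: (l2n_diag_le (fun n m => rho n m s)).
rewrite ler_wpM2l ?expR_ge0// lerD//.
  rewrite -[leLHS]/(hs2 (fun n m => rho n m 0)) hs2E; apply: le_trans rho_init_le.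
  apply: ler_sum => n _; rewrite (bigD1 n)//= gerDl sumr_le0// => m mn.
  by rewrite rho_init ?nsq0// eq_sym.
by rewrite expr_le1// ltW.
Qed.

Lemma K1_ge0 : 0 <= K1.
Proof. by rewrite mulr_ge0 ?expR_ge0 ?addr_ge0. Qed.

Let cR2 s := hs2 (offdiag (fun n m => rho n m s)).
Let comms s := comm V (fun n m => rho n m s).

Lemma f2_le s : 0 <= s <= T -> (e^-1 * f s) ^+ 2 <= M ^+ 2 / e ^+ 2.
Proof.
move=> sT; rewrite exprMn exprVn mulrC ler_wpM2r ?invr_ge0 ?sqr_ge0//.
by rewrite -[f s ^+ 2]real_normK ?num_real// ler_pXn2r ?nnegrE// f_le.
Qed.

Lemma hs2_comm_src_le X s : 0 <= s <= T ->
  hs2 (fun n m => imag * ofR (e^-1 * f s) * comm V X n m) <= M ^+ 2 / e ^+ 2 * (4 * Vs ^+ 2 * hs2 X).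
Proof.
move=> sT; rewrite {1}/hs2; under eq_bigr do rewrite nsq_imag_ofR.
rewrite -mulr_sumr; apply: ler_pM; rewrite ?sqr_ge0 ?hs2_ge0 ?f2_le//.
exact: comm_le.
Qed.

(** A damping of rate [q / e ^ 2] against a source of size [1 / e] leaves coherences
    of order [e / q]. *)
Definition K2 := (8 * M ^+ 2 * Vs ^+ 2 * K1 + 2) / g0 ^+ 2.

Lemma decay_gt0 : 0 < g0 * q * e ^- 2.
Proof. by rewrite mulr_gt0 ?invr_gt0 ?exprn_gt0// mulr_gt0. Qed.

Lemma e2_le1 : e ^+ 2 <= 1. Proof. by rewrite expr_le1// ltW. Qed.

Lemma ip_Lam_le n m z : n != m -> ip z (Lam n m * z) <= - (g0 * q * e ^- 2) * nsq z.
Proof.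
move=> nm; rewrite ip_Lam ler_wpM2r ?nsq_ge0// lerN2 ler_wpM2r ?invr_ge0 ?sqr_ge0//.
by rewrite [leRHS]mulrC ler_wpM2r ?(ltW q0)// gam_ge.
Qed.

Lemma coherence_le t : 0 <= t <= T -> cR2 t <= K2 * (e ^+ 2 / q ^+ 2).
Proof.
move=> tT.
pose F n m s := imag * ofR (e^-1 * f s) * comms s n m + sigma n m s.
have := @energy_decay R T T0 (I * I)%type
  (fun p s => offdiag (fun n m => rho n m s) p.1 p.2)
  (fun p s => offdiag (fun n m => drho n m s) p.1 p.2)
  (fun p s => offdiag (fun n m => F n m s) p.1 p.2) ((8 * M ^+ 2 * Vs ^+ 2 * K1 + 2) / e ^+ 2).
move=> /(_ _ _ _ decay_gt0 _ _ tT) h; apply: (le_trans (h _ _ _)) => {h}.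
- move=> p; rewrite /offdiag; case: (p.1 == p.2) => //; exact: cprimitive_cst.
- move=> s sT; apply: (le_trans (hs2_offdiag_le _)); apply: (le_trans (hs2D_le _ _)).
  have h1 := hs2_comm_src_le (fun n m => rho n m s) sT.
  have h2 := sigma_le sT; have h3 := density_le sT; have h4 := e2_le1.
  have e20 : 0 < e ^+ 2 by rewrite exprn_gt0.
  have h5 : M ^+ 2 / e ^+ 2 * (4 * Vs ^+ 2 * R2 s) <= M ^+ 2 / e ^+ 2 * (4 * Vs ^+ 2 * K1).
    by apply: ler_wpM2l; [nonneg|apply: ler_wpM2l => //; nonneg].
  have h6 : 1 <= (e ^+ 2)^-1 by rewrite invf_ge1.
  have -> : (8 * M ^+ 2 * Vs ^+ 2 * K1 + 2) / e ^+ 2 =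
     2 * (M ^+ 2 / e ^+ 2 * (4 * Vs ^+ 2 * K1)) + 2 * (e ^+ 2)^-1 by field; rewrite gt_eqF.
  rewrite /R2 /comms in h1 h5 *; lra.
- move=> s sT; rewrite mulr_sumr -big_split; apply: ler_sum => p _ /=.
  rewrite /offdiag; case: ifPn => [_|pp]; first by rewrite nsq0 mulr0 add0r ipzz nsq0.
  by rewrite /drho (negbTE pp) -addrA ipDr lerD2r ip_Lam_le.
- rewrite big1 => [|p _]; last by rewrite /offdiag; case: ifPn => [|/rho_init ->]; rewrite nsq0.
  rewrite add0r; apply: eq_ler; rewrite /K2; field.
  by rewrite !gt_eqF.
Qed.

Lemma K2_ge0 : 0 <= K2.
Proof. by have k1 := K1_ge0; rewrite /K2; nonneg. Qed.

(** The populations are driven at rate [1 / e] by coherences of order [e / q]. *)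
Definition K3 := 16 * Ws ^+ 2 * K1 + 16 * M ^+ 2 * Vs ^+ 2 * K2 + 2.

Lemma drho_diagE n s :
  drho n n s = rate_W (fun k => rho k k s) n
   + imag * ofR (e^-1 * f s) * comm V (offdiag (fun n m => rho n m s)) n n + sigma n n s.
Proof. by rewrite /drho eqxx comm_offdiag subrr mulr0 add0r. Qed.

Lemma invq_ge1 : 1 <= (q ^+ 2)^-1.
Proof. by rewrite invf_ge1 ?exprn_gt0// expr_le1// ltW. Qed.

Lemma drho_diag_le s : 0 <= s <= T -> l2n (fun n => drho n n s) <= K3 / q ^+ 2.
Proof.
move=> sT.
rewrite /l2n; under eq_bigr do rewrite drho_diagE.
apply: (le_trans (l2nD_le _ _)).
have h1 := l2nD_le (rate_W (fun k => rho k k s))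
  (fun n => imag * ofR (e^-1 * f s) * comm V (offdiag (fun n m => rho n m s)) n n).
have h2 := l2n_rate_W_le (fun k => rho k k s).
have h3 := le_trans (l2n_diag_le _) (hs2_comm_src_le (offdiag (fun n m => rho n m s)) sT).
have h4 := le_trans (l2n_diag_le _) (density_le sT).
have h5 := le_trans (l2n_diag_le _) (sigma_le sT).
have h6 := coherence_le sT; have h7 := e2_le1; have h8 := invq_ge1.
have h9 : 4 * Ws ^+ 2 * l2n (fun k => rho k k s) <= 4 * Ws ^+ 2 * K1 * (q ^+ 2)^-1.
  apply: (@le_trans _ _ (4 * Ws ^+ 2 * K1)); first by rewrite ler_wpM2l ?mulr_ge0 ?sqr_ge0.
  by have k1 := K1_ge0; rewrite ler_peMr//; nonneg.
have h10 : M ^+ 2 / e ^+ 2 * (4 * Vs ^+ 2 * cR2 s) <= 4 * M ^+ 2 * Vs ^+ 2 * K2 * (q ^+ 2)^-1.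
  have -> : 4 * M ^+ 2 * Vs ^+ 2 * K2 * (q ^+ 2)^-1 =
     M ^+ 2 / e ^+ 2 * (4 * Vs ^+ 2 * (K2 * (e ^+ 2 / q ^+ 2))) by field; rewrite !gt_eqF.
  by apply: ler_wpM2l; [nonneg|apply: ler_wpM2l => //; nonneg].
rewrite /K3 /cR2 in h3 h10 *; lra.
Qed.

Variable kappa : I -> I -> R -> R[i].
Hypothesis kappa_prim : forall n m, n != m ->
  cprimitive T (kappa n m) (fun s => Lam n m * kappa n m s + ofR (e ^- 2 * f s)).
Hypothesis kappa0 : forall n m, kappa n m 0 = 0.
Hypothesis kappa_herm : forall n m s, n != m -> 0 <= s <= T -> kappa m n s = conjc (kappa n m s).

Lemma kappa_le n m s : n != m -> 0 <= s <= T -> nsq (kappa n m s) <= M ^+ 2 / (g0 ^+ 2 * q ^+ 2).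
Proof.
move=> nm sT.
have := @energy_decay R T T0 'I_1 (fun=> kappa n m)
  (fun=> fun s => Lam n m * kappa n m s + ofR (e ^- 2 * f s))
  (fun=> fun s => ofR (e ^- 2 * f s)) (M ^+ 2 / e ^+ 4).
move=> /(_ _ _ _ decay_gt0 _ _ sT); rewrite !big_ord1 => h; apply: (le_trans (h _ _ _)) => {h}.
- by move=> _; exact: kappa_prim.
- move=> u uT; rewrite big_ord1 nsq_ofR exprMn exprVn -exprM mulrC ler_wpM2r//.
    by rewrite invr_ge0 exprn_ge0// ltW.
  by rewrite -[f u ^+ 2]real_normK ?num_real// ler_pXn2r ?nnegrE// f_le.
- by move=> u uT; rewrite !big_ord1 ipDr lerD2r ip_Lam_le.
- rewrite kappa0 nsq0 add0r; apply: eq_ler; field.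
  by rewrite !gt_eqF.
Qed.

(** The coherence that the wave would create if the populations were frozen; [chi] is
    what it leaves. *)
Definition jump n m s := imag * ofR e * V n m * (kappa n m s * (rho m m s - rho n n s)).
Definition chi n m s := offdiag (fun n m => rho n m s - jump n m s) n m.

Let Z n m s := imag * ofR e * (V n m * (kappa n m s * (drho m m s - drho n n s))).
Let F n m s := imag * ofR (e^-1 * f s) * comm V (offdiag (fun n m => rho n m s)) n m
   + sigma n m s - Z n m s.

(** The forcing of [kappa] cancels the commutator with the populations. What is left
    is the commutator with the coherences, and the variation of the populations. *)
Lemma chi_prim n m : n != m ->
  cprimitive T (fun s => chi n m s) (fun s => Lam n m * chi n m s + F n m s).
Proof.
move=> nm.
have h := cprimitiveB T0 (rho_drho n m) (cprimitiveZ T0 (imag * ofR e * V n m)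
  (cprimitiveM T0 (kappa_prim nm) (cprimitiveB T0 (rho_drho m m) (rho_drho n n)))).
apply: cprimitive_ext (cprimitive_extl T0 _ h) => s _; last first.
  by rewrite /chi /offdiag (negbTE nm).
rewrite /chi /offdiag (negbTE nm) /F /Z /jump {1}/drho (negbTE nm) comm_offdiag.
have -> : e^-1 * f s = e * (e ^- 2 * f s) by field; rewrite gt_eqF.
rewrite ofRM; ring.
Qed.

Definition K4 := 16 * M ^+ 2 * Vs ^+ 2 * K2 + 4 + 8 * M ^+ 2 * Vs ^+ 2 * K3 / g0 ^+ 2.

Lemma K3_ge0 : 0 <= K3.
Proof. by have k1 := K1_ge0; have k2 := K2_ge0; rewrite /K3; nonneg. Qed.

Lemma sum_nsqV_diff_le (x : I -> R[i]) :
  \sum_(p : I * I) nsq (V p.1 p.2) * nsq (x p.2 - x p.1) <= 4 * Vs ^+ 2 * l2n x.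
Proof.
rewrite -(pair_bigA _ (fun n m => nsq (V n m) * nsq (x m - x n))) /=.
apply: (@le_trans _ _ (\sum_n \sum_m (nsq (V n m) * (2 * nsq (x m)) + nsq (V n m) * (2 * nsq (x n))))).
  apply: ler_sum => n _; apply: ler_sum => m _; rewrite -mulrDr ler_wpM2l ?nsq_ge0//.
  exact: nsqB_le.
under eq_bigr do rewrite big_split.
have nV := nsqV_row Vs0 V_row.
rewrite big_split /= exchange_big /=.
have -> : 4 * Vs ^+ 2 * l2n x = Vs ^+ 2 * (2 * l2n x) + Vs ^+ 2 * (2 * l2n x) by ring.
apply: lerD; rewrite /l2n !mulr_sumr; apply: ler_sum => n _; rewrite -mulr_suml ler_wpM2r ?mulr_ge0 ?nsq_ge0//.
by under eq_bigr do rewrite (nsqV_sym V_herm).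
Qed.

Lemma F_le s : 0 <= s <= T -> hs2 (offdiag (fun n m => F n m s)) <= K4 / q ^+ 2.
Proof.
move=> sT.
pose A := fun n m => imag * ofR (e^-1 * f s) * comm V (offdiag (fun n m => rho n m s)) n m.
have h0 : hs2 (offdiag (fun n m => F n m s)) <=
    2 * hs2 (fun n m => A n m + sigma n m s) + 2 * hs2 (offdiag (fun n m => Z n m s)).
  apply: (le_trans _ (hs2B_le _ _)) => /=; apply: ler_sum => p _.
  by rewrite /offdiag; case: ifP => _ //; rewrite nsq0 nsq_ge0.
have h1 := hs2D_le A (fun n m => sigma n m s).
have h2 := hs2_comm_src_le (offdiag (fun n m => rho n m s)) sT.
have h3 := coherence_le sT; have h4 := sigma_le sT; have h5 := e2_le1; have h6 := invq_ge1.
have h7 : M ^+ 2 / e ^+ 2 * (4 * Vs ^+ 2 * cR2 s) <= 4 * M ^+ 2 * Vs ^+ 2 * K2 * (q ^+ 2)^-1.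
  have -> : 4 * M ^+ 2 * Vs ^+ 2 * K2 * (q ^+ 2)^-1 =
     M ^+ 2 / e ^+ 2 * (4 * Vs ^+ 2 * (K2 * (e ^+ 2 / q ^+ 2))) by field; rewrite !gt_eqF.
  by apply: ler_wpM2l; [nonneg|apply: ler_wpM2l => //; nonneg].
have h8 : hs2 (offdiag (fun n m => Z n m s)) <=
    e ^+ 2 * (M ^+ 2 / (g0 ^+ 2 * q ^+ 2)) * (4 * Vs ^+ 2 * (K3 / q ^+ 2)).
  apply: (@le_trans _ _ (e ^+ 2 * (M ^+ 2 / (g0 ^+ 2 * q ^+ 2)) *
      \sum_(p : I * I) nsq (V p.1 p.2) * nsq (drho p.2 p.2 s - drho p.1 p.1 s))).
    rewrite mulr_sumr; apply: ler_sum => p _; rewrite /offdiag.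
    case: ifPn => [_|pp].
      by rewrite nsq0; nonneg; exact: nsq_ge0.
    rewrite /Z nsq_imag_ofR -mulrA ler_wpM2l ?sqr_ge0// nsqM mulrCA ler_wpM2l ?nsq_ge0//.
    by rewrite nsqM ler_wpM2r ?nsq_ge0// kappa_le.
  apply: ler_wpM2l; first by nonneg.
  apply: (le_trans (sum_nsqV_diff_le (fun n => drho n n s))).
  by rewrite ler_wpM2l ?mulr_ge0 ?sqr_ge0// drho_diag_le.
have h9 : e ^+ 2 * (M ^+ 2 / (g0 ^+ 2 * q ^+ 2)) * (4 * Vs ^+ 2 * (K3 / q ^+ 2)) <=
    4 * M ^+ 2 * Vs ^+ 2 * K3 / g0 ^+ 2 * (q ^+ 2)^-1.
  have -> : e ^+ 2 * (M ^+ 2 / (g0 ^+ 2 * q ^+ 2)) * (4 * Vs ^+ 2 * (K3 / q ^+ 2)) =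
    4 * M ^+ 2 * Vs ^+ 2 * K3 / g0 ^+ 2 * (q ^+ 2)^-1 * (e ^+ 2 / q ^+ 2) by field; rewrite !gt_eqF.
  have k3 := K3_ge0; rewrite ler_piMr//; first by nonneg.
  rewrite ler_pdivrMr ?exprn_gt0// mul1r; have := eq2; have := e0; have := e1; nra.
rewrite /K4 /cR2 in h2 h7 *; rewrite -/A in h2; lra.
Qed.

(** The source [F] being of order [1 / q], this gains a factor [e / q] over the bound
    on the coherences. *)
Definition K5 := K4 / g0 ^+ 2.

Lemma chi_le t : 0 <= t <= T -> hs2 (fun n m => chi n m t) <= K5 * (e ^+ 4 / q ^+ 4).
Proof.
move=> tT.
have := @energy_decay R T T0 (I * I)%type (fun p s => chi p.1 p.2 s)
  (fun p s => offdiag (fun n m => Lam n m * chi n m s + F n m s) p.1 p.2)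
  (fun p s => offdiag (fun n m => F n m s) p.1 p.2) (K4 / q ^+ 2).
move=> /(_ _ _ _ decay_gt0 _ _ tT) h; apply: (le_trans (h _ _ _)) => {h}.
- move=> p; have := @chi_prim p.1 p.2; rewrite /chi /offdiag.
  by case: (p.1 == p.2) => [_|/(_ isT)//]; exact: cprimitive_cst.
- by move=> s sT; exact: F_le.
- move=> s sT; rewrite mulr_sumr -big_split; apply: ler_sum => p _ /=.
  rewrite /offdiag; case: ifPn => [pp|pp].
    by rewrite /chi /offdiag pp nsq0 mulr0 add0r ipzz nsq0.
  by rewrite ipDr lerD2r ip_Lam_le.
- rewrite big1 => [|p _]; last first.
    rewrite /chi /offdiag; case: ifPn => [|pp]; first by rewrite nsq0.
    by rewrite /jump rho_init// kappa0 mul0r mulr0 subrr nsq0.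
  rewrite add0r; apply: eq_ler; rewrite /K5; field.
  by rewrite !gt_eqF.
Qed.

Definition exchange (c : I -> I -> R) (x : I -> R[i]) n : R[i] :=
  \sum_(k | k != n) ofR (c n k) * (x k - x n).

(** The rows of [nsq (V n k)] are summable, so that the Schur test applies. *)
Lemma exchange_le c C x : 0 <= C ->
  (forall n k, k != n -> `|c n k| <= C * nsq (V n k)) ->
  l2n (exchange c x) <= 4 * C ^+ 2 * Vs ^+ 4 * l2n x.
Proof.
move=> C0 cC.
apply: (@le_trans _ _ (\sum_n C * Vs ^+ 2 * \sum_k C * (nsq (V n k) * nsq (x k - x n)))).
  apply: ler_sum => n _; apply: (le_trans (nsq_sum_le _ _ _ _)); apply: ler_pM.
  - by apply: sumr_ge0 => k _; exact: cabs_ge0.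
  - by apply: sumr_ge0 => k _; rewrite mulr_ge0 ?cabs_ge0 ?nsq_ge0.
  - apply: (@le_trans _ _ (C * \sum_k nsq (V n k))).
      rewrite mulr_sumr [leRHS](bigID (fun k => k != n)) /= -[leLHS]addr0.
      apply: lerD; first by apply: ler_sum => k kn; rewrite cabs_ofR cC.
      by apply: sumr_ge0 => k _; rewrite mulr_ge0// nsq_ge0.
    by rewrite ler_wpM2l// (nsqV_row Vs0 V_row).
  - rewrite [leRHS](bigID (fun k => k != n)) /= -[leLHS]addr0; apply: lerD.
      by apply: ler_sum => k kn; rewrite mulrA ler_wpM2r ?nsq_ge0// cabs_ofR cC.
    by apply: sumr_ge0 => k _; rewrite !mulr_ge0// nsq_ge0.
rewrite -mulr_sumr; under eq_bigr do rewrite -mulr_sumr.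
rewrite -mulr_sumr (pair_bigA _ (fun n k => nsq (V n k) * nsq (x k - x n))) /=.
have -> : 4 * C ^+ 2 * Vs ^+ 4 * l2n x = C * Vs ^+ 2 * (C * (4 * Vs ^+ 2 * l2n x)) by ring.
apply: ler_wpM2l; first by nonneg.
by apply: ler_wpM2l => //; exact: sum_nsqV_diff_le.
Qed.

Lemma exchangeB c x y n : exchange c (fun k => x k - y k) n = exchange c x n - exchange c y n.
Proof. by rewrite /exchange -sumrB; apply: eq_bigr => k _; ring. Qed.

Lemma rate_WB x y n : rate_W (fun k => x k - y k) n = rate_W x n - rate_W y n.
Proof. by rewrite /rate_W -sumrB; apply: eq_bigr => k _; ring. Qed.

(** Symmetric nonnegative rates are dissipative in [l^2], whatever their size. *)
Lemma ip_exchange_le c x : (forall n k, c n k = c k n) -> (forall n k, k != n -> 0 <= c n k) ->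
  \sum_n ip (x n) (exchange c x n) <= 0.
Proof.
move=> csym c0.
apply: (@le_trans _ _ (\sum_n \sum_(k | k != n) (c n k * nsq (x k) - c n k * nsq (x n)) / 2)).
  apply: ler_sum => n _; rewrite ip_sumr; apply: ler_sum => k kn.
  rewrite ipZr ipBr ipzz; have := ip_le (x n) (x k); have := c0 n k kn; nra.
under eq_bigr do rewrite -mulr_suml sumrB.
rewrite -mulr_suml sumrB [X in X - _](exchange_big_dep xpredT)//=.
suff -> : \sum_j \sum_(i | j != i) c i j * nsq (x j) = \sum_i \sum_(k | k != i) c i k * nsq (x i).
  by rewrite subrr mul0r.
apply: eq_bigr => n _; apply: eq_big => k; first by rewrite eq_sym.
by move=> _; rewrite csym.
Qed.

Variables (A : I -> I -> R) (P : I -> I -> R -> R) (rho1 sigma1 : I -> R -> R).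
Hypothesis A_sym : forall n k, A n k = A k n.
Hypothesis A_ge0 : forall n k, k != n -> 0 <= A n k.
Hypothesis A_le : forall n k, k != n -> A n k <= CA / q * nsq (V n k).

Definition Psi_fin n k s := 2 * nsq (V n k) * f s * Re (kappa n k s).

Hypothesis P_prim : forall n k, k != n ->
  primitive T (P n k) (fun s => Psi_fin n k s - A n k).
Hypothesis P0 : forall n k, k != n -> P n k 0 = 0.
Hypothesis P_le : forall n k s, k != n -> 0 <= s <= T ->
  `|P n k s| <= CP * (e / q) * nsq (V n k).

Definition drho1 n s :=
  \sum_(k | k != n) ((A k n + W k n) * rho1 k s - (A n k + W n k) * rho1 n s) + sigma1 n s.
Hypothesis rho1_prim : forall n, primitive T (rho1 n) (drho1 n).
Hypothesis rho1_init : forall n, rho n n 0 = ofR (rho1 n 0).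
Hypothesis sigma1_le : forall s, 0 <= s <= T -> \sum_n sigma1 n s ^+ 2 <= e ^+ 2.

(** The time derivative of [G] contains the oscillating part of the rate, so that
    only the averaged rates [A] are left in the equation of [u]. *)
Let G n s := exchange (fun n k => P n k s) (fun k => rho k k s) n.
Let u n s := rho n n s - ofR (rho1 n s) - G n s.
Let S n s :=
  rate_W (fun k => G k s) n + exchange A (fun k => G k s) n
  + imag * ofR (e^-1 * f s) * comm V (fun n m => chi n m s) n n
  + sigma n n s - ofR (sigma1 n s)
  - exchange (fun n k => P n k s) (fun k => drho k k s) n.

Lemma drho1E n s : ofR (drho1 n s) =
  rate_W (fun k => ofR (rho1 k s)) n + exchange A (fun k => ofR (rho1 k s)) n + ofR (sigma1 n s).
Proof.
rewrite /drho1 ofRD; congr (_ + _).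
rewrite /rate_W [X in _ = X + _](bigD1 n)//= subrr add0r /exchange -big_split /=.
have -> : forall F : I -> R, ofR (\sum_(k | k != n) F k) = \sum_(k | k != n) ofR (F k).
  by move=> x; elim/big_rec2 : _ => [//|k y z _ <-]; rewrite ofRD.
apply: eq_bigr => k _; rewrite (A_sym k n) ofRD ofRN !ofRM !ofRD; ring.
Qed.

(** Feeding the leading part of the coherences back into the populations
    produces the rate [Psi_fin]. *)
Lemma drho_diag_rate n s : 0 <= s <= T ->
  drho n n s = rate_W (fun k => rho k k s) n
    + exchange (fun n k => Psi_fin n k s) (fun k => rho k k s) n
    + imag * ofR (e^-1 * f s) * comm V (fun n m => chi n m s) n n + sigma n n s.
Proof.
move=> sT; rewrite drho_diagE; congr (_ + _); rewrite -addrA; congr (_ + _).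
rewrite /comm /exchange !mulr_sumr [LHS](bigD1 n)//= [X in _ = _ + X](bigD1 n)//=.
rewrite /chi /offdiag eqxx !mulr0 subrr mulr0 !add0r -big_split /=.
apply: eq_bigr => k kn; rewrite (negbTE kn) (eq_sym n) (negbTE kn).
rewrite /jump (V_herm n k) (kappa_herm _ sT); last by rewrite eq_sym.
set v := V n k; set c := kappa n k s; set x := rho k k s; set y := rho n n s.
have i2 : imag * imag = - 1 :> R[i] by apply: complexP; rewrite ?cE /=; ring.
have -> : ofR (Psi_fin n k s) = v * conjc v * (ofR (e^-1 * f s) * ofR e) * (c + conjc c).
  have -> : v * conjc v = ofR (nsq v) by apply: complexP; rewrite /nsq ?cE; ring.
  have -> : c + conjc c = ofR (2 * Re c) by apply: complexP; rewrite ?cE; ring.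
  by rewrite -!ofRM /Psi_fin; congr ofR; field; rewrite gt_eqF.
apply/eqP; rewrite -subr_eq0; apply/eqP.
set w := ofR (e^-1 * f s); set E := ofR e; set a := rho k n s; set b := rho n k s.
have -> : imag * w * (v * a - conjc v * b) - (v * conjc v * (w * E) * (c + conjc c) * (x - y) +
    imag * w * (v * (a - imag * E * conjc v * (conjc c * (y - x))) -
                conjc v * (b - imag * E * v * (c * (x - y))))) =
  - (1 + imag * imag) * (v * conjc v * (w * E) * (c + conjc c) * (x - y)) by ring.
by rewrite i2 subrr oppr0 mul0r.
Qed.

Lemma u_prim n : cprimitive T (u n)
  (fun s => rate_W (fun k => u k s) n + exchange A (fun k => u k s) n + S n s).
Proof.
have hG : cprimitive T (G n) (fun s => exchange (fun n k => Psi_fin n k s) (fun k => rho k k s) n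
   - exchange A (fun k => rho k k s) n
   + exchange (fun n k => P n k s) (fun k => drho k k s) n).
  have h := cprimitive_sum T0 (index_enum I) (fun k (kn : k != n) =>
    cprimitiveM T0 (cprimitive_ofR (P_prim kn)) (cprimitiveB T0 (rho_drho k k) (rho_drho n n))).
  apply: cprimitive_ext h => s _; rewrite /exchange -sumrB -big_split /=.
  by apply: eq_bigr => k kn; rewrite ofRD ofRN; ring.
have h := cprimitiveB T0 (cprimitiveB T0 (rho_drho n n) (cprimitive_ofR (rho1_prim n))) hG.
apply: cprimitive_ext h => s sT.
rewrite drho_diag_rate// drho1E /u /S.
rewrite !rate_WB !exchangeB -/(G n s).
by ring.
Qed.

Definition K6 := 4 * CP ^+ 2 * Vs ^+ 4 * K1.
Definition K7 := 128 * Ws ^+ 2 * K6 + 128 * CA ^+ 2 * Vs ^+ 4 * K6 + 64 * M ^+ 2 * Vs ^+ 2 * K5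
  + 12 + 8 * CP ^+ 2 * Vs ^+ 4 * K3.
Definition K8 := 2 * expR ((2 * Ws + 1) * T) * K7 + 2 * K6.

Lemma K4_ge0 : 0 <= K4.
Proof. by have k3 := K3_ge0; have k2 := K2_ge0; rewrite /K4; nonneg. Qed.
Lemma K5_ge0 : 0 <= K5.
Proof. by have k4 := K4_ge0; rewrite /K5; nonneg. Qed.
Lemma K6_ge0 : 0 <= K6.
Proof. by have k1 := K1_ge0; rewrite /K6; nonneg. Qed.

Lemma G_le s : 0 <= s <= T -> l2n (fun n => G n s) <= K6 * (e ^+ 2 / q ^+ 2).
Proof.
move=> sT.
have C0 : 0 <= CP * (e / q) by have := ltW e0; have := ltW q0 => *; nonneg.
apply: (le_trans (exchange_le (fun k => rho k k s) C0 (fun n k kn => P_le kn sT))).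
have -> : K6 * (e ^+ 2 / q ^+ 2) = 4 * (CP * (e / q)) ^+ 2 * Vs ^+ 4 * K1.
  by rewrite /K6; field; rewrite gt_eqF.
apply: ler_wpM2l; first by nonneg.
exact: le_trans (l2n_diag_le (fun n m => rho n m s)) (density_le sT).
Qed.

Lemma q4_le : [/\ e ^+ 2 <= e ^+ 2 / q ^+ 4 & e ^+ 2 / q ^+ 2 <= e ^+ 2 / q ^+ 4].
Proof.
have q40 : 0 < q ^+ 4 by rewrite exprn_gt0.
have q20 : 0 < q ^+ 2 by rewrite exprn_gt0.
have q21 : q ^+ 2 <= 1 by rewrite expr_le1// ltW.
have -> : e ^+ 2 / q ^+ 4 = e ^+ 2 / q ^+ 2 * (q ^+ 2)^-1 by field; rewrite gt_eqF.
have h : e ^+ 2 / q ^+ 2 <= e ^+ 2 / q ^+ 2 * (q ^+ 2)^-1.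
  by rewrite ler_peMr ?invq_ge1// divr_ge0 ?sqr_ge0.
split => //; apply: le_trans h.
by rewrite ler_peMr ?invq_ge1// sqr_ge0.
Qed.

Lemma S_le s : 0 <= s <= T -> l2n (fun n => S n s) <= K7 * (e ^+ 2 / q ^+ 4).
Proof.
move=> sT; have [p1 p2] := q4_le.
have g := G_le sT.
have k1 := K1_ge0; have k3 := K3_ge0; have k5 := K5_ge0; have k6 := K6_ge0.
have h1 : l2n (rate_W (fun k => G k s)) <= 4 * Ws ^+ 2 * K6 * (e ^+ 2 / q ^+ 4).
  apply: (le_trans (l2n_rate_W_le _)); rewrite -[leRHS]mulrA; apply: ler_wpM2l; first by nonneg.
  by apply: (le_trans g); apply: ler_wpM2l.
have h2 : l2n (exchange A (fun k => G k s)) <= 4 * CA ^+ 2 * Vs ^+ 4 * K6 * (e ^+ 2 / q ^+ 4).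
  have C0 : 0 <= CA / q by have := ltW q0 => *; nonneg.
  apply: (le_trans (exchange_le _ C0 _)) => [n k kn|].
    by rewrite ger0_norm ?A_ge0// A_le.
  have -> : 4 * CA ^+ 2 * Vs ^+ 4 * K6 * (e ^+ 2 / q ^+ 4) =
     4 * (CA / q) ^+ 2 * Vs ^+ 4 * (K6 * (e ^+ 2 / q ^+ 2)) by field; rewrite gt_eqF.
  by apply: ler_wpM2l => //; nonneg.
have h3 : l2n (fun n => imag * ofR (e^-1 * f s) * comm V (fun n m => chi n m s) n n) <=
    4 * M ^+ 2 * Vs ^+ 2 * K5 * (e ^+ 2 / q ^+ 4).
  apply: (le_trans (l2n_diag_le (fun n m => imag * ofR (e^-1 * f s) * comm V (fun n m => chi n m s) n m))).
  apply: (le_trans (hs2_comm_src_le _ sT)).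
  have -> : 4 * M ^+ 2 * Vs ^+ 2 * K5 * (e ^+ 2 / q ^+ 4) =
     M ^+ 2 / e ^+ 2 * (4 * Vs ^+ 2 * (K5 * (e ^+ 4 / q ^+ 4))) by field; rewrite !gt_eqF.
  by apply: ler_wpM2l; [nonneg|apply: ler_wpM2l; [nonneg|exact: chi_le]].
have h4 : l2n (fun n => sigma n n s) <= e ^+ 2 / q ^+ 4.
  apply: le_trans p1; apply: le_trans (sigma_le sT).
  exact: (l2n_diag_le (fun n m => sigma n m s)).
have h5 : l2n (fun n => ofR (sigma1 n s)) <= e ^+ 2 / q ^+ 4.
  apply: le_trans p1; apply: le_trans (sigma1_le sT).
  by rewrite /l2n; under eq_bigr do rewrite nsq_ofR.
have h6 : l2n (exchange (fun n k => P n k s) (fun k => drho k k s)) <=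
    4 * CP ^+ 2 * Vs ^+ 4 * K3 * (e ^+ 2 / q ^+ 4).
  have C0 : 0 <= CP * (e / q) by have := ltW e0; have := ltW q0 => *; nonneg.
  apply: (le_trans (exchange_le _ C0 (fun n k kn => P_le kn sT))).
  have -> : 4 * CP ^+ 2 * Vs ^+ 4 * K3 * (e ^+ 2 / q ^+ 4) =
    4 * (CP * (e / q)) ^+ 2 * Vs ^+ 4 * (K3 / q ^+ 2) by field; rewrite gt_eqF.
  by apply: ler_wpM2l; [nonneg|exact: drho_diag_le].
rewrite /S.
pose a1 n := rate_W (fun k => G k s) n.
pose a2 n := exchange A (fun k => G k s) n.
pose a3 n := imag * ofR (e^-1 * f s) * comm V (fun n m => chi n m s) n n.
pose a6 n := exchange (fun n k => P n k s) (fun k => drho k k s) n.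
have := l2nB_le (fun n => a1 n + a2 n + a3 n + sigma n n s - ofR (sigma1 n s)) a6.
have := l2nB_le (fun n => a1 n + a2 n + a3 n + sigma n n s) (fun n => ofR (sigma1 n s)).
have := l2nD_le (fun n => a1 n + a2 n + a3 n) (fun n => sigma n n s).
have := l2nD_le (fun n => a1 n + a2 n) a3.
have := l2nD_le a1 a2.
rewrite /a1 /a2 /a3 /a6 /K7; lra.
Qed.

(** [u] vanishes initially and has a source of order [e / q ^ 2], to which the
    averaged rates add nothing; [G] is smaller still. *)
Theorem finite_levels_estimate t : 0 <= t <= T ->
  l2n (fun n => rho n n t - ofR (rho1 n t)) <= K8 * (e / q ^+ 2) ^+ 2.
Proof.
move=> tT; have [p1 p2] := q4_le; have k6 := K6_ge0.
have hu : l2n (fun n => u n t) <= expR ((2 * Ws + 1) * T) * (K7 * (e ^+ 2 / q ^+ 4)).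
  have := @energy_growth R T T0 I u _ S (K7 * (e ^+ 2 / q ^+ 4)) u_prim S_le Ws Ws0.
  move=> /(_ _ _ tT) h; apply: (le_trans (h _)) => [s sT|].
    under eq_bigr do rewrite ipDr; rewrite big_split lerD2r /=.
    under eq_bigr do rewrite ipDr; rewrite big_split /=.
    have := ip_rate_W_le (fun k => u k s); have := ip_exchange_le (fun k => u k s) A_sym A_ge0.
    rewrite /l2n; lra.
  rewrite big1 ?add0r// => n _; rewrite /u rho1_init subrr sub0r nsqN /G /exchange big1 ?nsq0// => k kn.
  by rewrite P0// mul0r.
have := l2nD_le (fun n => u n t) (fun n => G n t).
have -> : l2n (fun n => u n t + G n t) = l2n (fun n => rho n n t - ofR (rho1 n t)).
  by apply: eq_bigr => n _; rewrite /u subrK.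
move=> /le_trans; apply.
have -> : K8 * (e / q ^+ 2) ^+ 2 = 2 * (expR ((2 * Ws + 1) * T) * (K7 * (e ^+ 2 / q ^+ 4)))
   + 2 * (K6 * (e ^+ 2 / q ^+ 4)) by rewrite /K8; field; rewrite gt_eqF.
apply: lerD; first by rewrite ler_wpM2l.
rewrite ler_wpM2l//; apply: (le_trans (G_le tT)); exact: ler_wpM2l.
Qed.

End finite_levels.

(** * Changes of variables *)

Section change_of_variables.
Context {R : realType}.
Notation mu := (@lebesgue_measure R).
Implicit Types (f : R -> R).

Section general.
Variables (h : measurableTypeR R -> measurableTypeR R) (c : R).
Hypotheses (mh : measurable_fun setT h) (c0 : 0 <= c).
Hypothesis hc : forall x y : R, mu `]x, y] = (c%:E * mu (h @^-1` `]x, y]))%E.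

Let cn : {nonneg R} := NngNum c0.

Let image_measure : {measure set (measurableTypeR R) -> \bar R}.
Proof. by refine (measure_function_pushforward__canonical__measure_function_Measure mu mh). Defined.

Let measure_eq (A : set R) : measurable A -> mu A = mscale cn image_measure A.
Proof. by apply: lebesgue_measure_unique => _ [[a b] _ <-] /=; exact: hc. Qed.

Let ge0_subst (a b a' b' : R) (f : R -> R) : measurable_fun setT f ->
  h @^-1` `[a, b] = [set` `[a', b']] -> (forall x, a <= x <= b -> 0 <= f x) ->
  \int[mu]_(x in `[a, b]) f x = c * \int[mu]_(x in `[a', b']) f (h x).
Proof.
move=> mf hab f0; rewrite /Rintegral.
rewrite (eq_measure_integral (mscale cn image_measure)) => [|A mA _]; last exact: measure_eq.
have mD : measurable (`[a, b] : set (measurableTypeR R)) by exact: measurable_itv.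
have mfE : measurable_fun (`[a, b] : set (measurableTypeR R)) (fun x => (f x)%:E).
  by apply/measurable_EFinP; exact: measurable_funS mf.
rewrite ge0_integral_mscale//.
rewrite ge0_integral_pushforward//; last by move=> x; rewrite inE/= in_itv/= lee_fin => /f0.
rewrite hab.
have fineZ (y : \bar R) : fine (c%:E * y)%E = c * fine y.
  case: y => [r| |] //=; rewrite mulr0.
    by rewrite mulry; case: (sgrP c) => _; rewrite ?mul0e ?mul1e ?mulN1e.
  by rewrite mulrNy; case: (sgrP c) => _; rewrite ?mul0e ?mul1e ?mulN1e.
exact: fineZ.
Qed.

(** Measures that agree on intervals agree on Borel sets; a bounded function is made
    nonnegative by the addition of a constant. *)
Lemma integral_subst (a b a' b' : R) (f : R -> R) : measurable_fun setT f ->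
  h @^-1` `[a, b] = [set` `[a', b']] -> a <= b -> bmeas a b f ->
  \int[mu]_(x in `[a, b]) f x = c * \int[mu]_(x in `[a', b']) f (h x).
Proof.
move=> mf hab ab bf; have [_ [M fM]] := bf.
have h' x : a' <= x <= b' -> a <= h x <= b.
  by move=> xb; have : (h @^-1` `[a, b]) x by rewrite hab/= in_itv.
have bh : bmeas a' b' (fun x => f (h x)).
  split; last by exists M => x /h'; exact: fM.
  apply: (@measurable_funS _ _ _ _ setT) => //.
  exact: (measurableT_comp mf mh).
have e1 : \int[mu]_(x in `[a, b]) (f x + M) = c * \int[mu]_(x in `[a', b']) (f (h x) + M).
  apply: (@ge0_subst _ _ _ _ (fun x => f x + M)) => //.
    by apply: measurable_funD => //; exact: measurable_cst.
  by move=> x /fM; rewrite ler_norml -lerBlDr sub0r => /andP[].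
have e2 : \int[mu]_(x in `[a, b]) M = c * \int[mu]_(x in `[a', b']) M.
  apply: (@ge0_subst _ _ _ _ (fun=> M)) => //.
  by move=> x /fM; exact: le_trans.
have bM := bmeas_cst; move: e1.
rewrite integralD// integralD// mulrDr e2; exact: addIr.
Qed.
End general.

Lemma integral_affine (a b x y : R) f : 0 < a -> x <= y -> measurable_fun setT f -> bmeas x y f ->
  \int[mu]_(t in `[x, y]) f t = a * \int[mu]_(t in `[(x - b) / a, (y - b) / a]) f (a * t + b).
Proof.
move=> a0 xy mf bf.
have pre u v (bu bv : bool) :
    (fun t : R => a * t + b) @^-1` [set` Interval (BSide bu u) (BSide bv v)] =
    [set` Interval (BSide bu ((u - b) / a)) (BSide bv ((v - b) / a))].
  apply/seteqP; split=> t /=; rewrite !itv_boundlr; case: bu; case: bv;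
  by rewrite !bnd_simp ?ler_pdivrMr ?ltr_pdivrMr ?ler_pdivlMr ?ltr_pdivlMr//
    ?lerBlDr ?ltrBlDr ?lerBrDr ?ltrBrDr (mulrC a).
apply: (@integral_subst (fun t => a * t + b) a) => //.
- by apply: measurable_funD => //; exact: measurable_funM.
- exact: ltW.
- move=> u v; rewrite pre /= !lebesgue_measure_itv /= !lte_fin ltr_pM2r ?invr_gt0// ltrD2r.
  case: ifP => uv; last by rewrite mule0.
  by rewrite -!EFinD -EFinM; congr (_%:E); field; rewrite gt_eqF.
Qed.

Lemma integral_opp (x y : R) f : x <= y -> measurable_fun setT f -> bmeas x y f ->
  \int[mu]_(t in `[x, y]) f t = \int[mu]_(t in `[- y, - x]) f (- t).
Proof.
move=> xy mf bf; rewrite -[RHS]mul1r.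
apply: (@integral_subst (fun t => - t) 1) => //.
- by apply: (@measurable_funN _ _ _ setT id); exact: measurable_id.
- move=> u v; rewrite mul1e opp_preimage_itvbndbnd /= !lebesgue_measure_itv /= !lte_fin ltrN2.
  by case: ifP => // _; rewrite -!EFinD; congr (_%:E); ring.
- by rewrite opp_preimage_itvbndbnd.
Qed.

(** Convolution integrals may be written in either variable. *)
Lemma integral_reflect (x : R) f : 0 <= x -> measurable_fun setT f -> bmeas 0 x f ->
  \int[mu]_(t in `[0, x]) f (x - t) = \int[mu]_(t in `[0, x]) f t.
Proof.
move=> x0 mf bf; rewrite [RHS](integral_opp x0 mf bf) oppr0.
rewrite (@integral_affine 1 (- x) (- x) 0) ?oppr_le0//; last 2 first.
- exact: measurableT_comp.
- have [_ [M fM]] := bf; split.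
    by apply: (@measurable_funS _ _ _ _ setT) => //; exact: measurableT_comp.
  by exists M => t /andP[t1 t2]; apply: fM; rewrite oppr_ge0 t2 lerNl.
rewrite mul1r !divr1 subrr sub0r opprK; apply: integral_ext => t _.
by rewrite mul1r opprB; congr f; ring.
Qed.

Lemma integral_translate (s x y : R) f : x <= y -> measurable_fun setT f -> bmeas (x - s) (y - s) f ->
  \int[mu]_(t in `[x, y]) f (t - s) = \int[mu]_(t in `[x - s, y - s]) f t.
Proof.
move=> xy mf bf; rewrite [RHS](@integral_affine 1 (- s)) ?lerD2r//.
by rewrite mul1r !divr1 !opprK !subrK; apply: integral_ext => t _; rewrite mul1r.
Qed.

Lemma integral_scale (a x : R) f : 0 < a -> 0 <= x -> measurable_fun setT f -> bmeas 0 (x / a) f ->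
  \int[mu]_(t in `[0, x]) f (t / a) = a * \int[mu]_(t in `[0, x / a]) f t.
Proof.
move=> a0 x0 mf bf; rewrite (@integral_affine a^-1 0 0 (x / a)) ?invr_gt0// ?divr_ge0//; last exact: ltW.
rewrite !subr0 invrK mul0r divfK ?gt_eqF// mulrA divff ?gt_eqF// mul1r.
by apply: integral_ext => t _; rewrite addr0 mulrC.
Qed.

End change_of_variables.

(** * Sums over lattice points *)

Section lattice_tools.
Context {R : realType}.

(** The family is injective, hence part of a box, on which the sum of products is a
    product of sums. *)
Lemma prod_sum_le (r : nat) (g : int -> R) (Z : R) (T : eqType) (F : seq T) (J : T -> 'I_r -> int) :
  (forall z, 0 <= g z) ->
  (forall B : nat, \sum_(k < (2 * B).+1) g (k%:Z - B%:Z) <= Z) ->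
  uniq F -> {in F &, forall b c, J b =1 J c -> b = c} ->
  \sum_(b <- F) \prod_i g (J b i) <= Z ^+ r.
Proof.
move=> g0 gZ uF injJ.
pose B := \max_(b <- F) \max_i `|J b i|%N.
have JB b i : b \in F -> (`|J b i| <= B)%N.
  move=> bF; apply: (@leq_trans (\max_i `|J b i|%N)); first exact: (leq_bigmax i).
  by rewrite /B (big_rem b)//= leq_maxl.
pose h b := [ffun i => inord (absz (J b i + B%:Z)) : 'I_(2 * B).+1].
have hE b i : b \in F -> ((h b i : nat)%:Z - B%:Z)%R = J b i.
  move=> bF; have := JB b i bF; rewrite ffunE => le.
  have [n nE] : exists n : nat, (J b i + B%:Z)%R = n%:Z.
    by exists (absz (J b i + B%:Z)); lia.
  by rewrite nE inordK /=; lia.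
pose G (x : {ffun 'I_r -> 'I_(2 * B).+1}) := \prod_i g ((x i : nat)%:Z - B%:Z).
have G0 x : 0 <= G x by apply: prodr_ge0.
have -> : \sum_(b <- F) \prod_i g (J b i) = \sum_(x <- map h F) G x.
  rewrite big_map; apply: eq_big_seq => b bF; apply: eq_bigr => i _.
  by rewrite hE.
have uh : uniq (map h F).
  rewrite map_inj_in_uniq// => b c bF cF hbc; apply: injJ => // i.
  by rewrite -(hE b)// -(hE c)// hbc.
rewrite (big_uniq _ uh) /=.
apply: (@le_trans _ _ (\sum_x G x)).
  rewrite [leRHS](bigID (mem (map h F))) /= lerDl sumr_ge0//.
rewrite -(bigA_distr_bigA (fun (i : 'I_r) (k : 'I_(2 * B).+1) => g ((k : nat)%:Z - B%:Z))) /=.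
apply: (@le_trans _ _ (\prod_(i < r) Z)); last by rewrite prodr_const card_ord.
by apply: ler_prod => i _; rewrite gZ andbT sumr_ge0.
Qed.

Lemma powR_exprnC (x : R) n p : 0 <= x -> (x ^+ n) `^ p = (x `^ p) ^+ n.
Proof.
move=> x0; rewrite -(powR_mulrn n x0) -(powR_mulrn n (powR_ge0 x p)) -!powRrM.
by rewrite mulrC.
Qed.

Lemma geometric_le (x : R) n : 1 < x -> \sum_(j < n.+1) x ^+ j <= x / (x - 1) * x ^+ n.
Proof.
move=> x1; have x10 : 0 < x - 1 by rewrite subr_gt0.
have : (x - 1) * \sum_(j < n.+1) x ^+ j = x ^+ n.+1 - 1 by rewrite -subrX1.
move=> h; rewrite mulrAC -exprS ler_pdivlMr// mulrC h.
by rewrite gerBl.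
Qed.

(** Cauchy condensation. *)
Lemma sum_powR_dyadic (kap : R) n : 1 < kap ->
  \sum_(0 <= m < 2 ^ n) m.+1%:R `^ (- kap) <= 1 + \sum_(j < n) (2 `^ (1 - kap)) ^+ j :> R.
Proof.
move=> k1; elim: n => [|n IH].
  by rewrite expn0 big_nat1 big_ord0 addr0 powR1.
rewrite (big_cat_nat (n := 2 ^ n)) ?leq_exp2l//= big_ord_recr addrA /=; apply: lerD => //.
apply: (@le_trans _ _ (\sum_(2 ^ n <= m < 2 ^ n.+1) (2 ^+ n) `^ (- kap))).
  rewrite big_nat_cond [leRHS]big_nat_cond; apply: ler_sum => m /andP[/andP[nm _] _].
  rewrite !powRN lef_pV2 ?posrE ?powR_gt0 ?exprn_gt0//.
  rewrite ge0_ler_powR ?nnegrE ?(le_trans _ (ltW k1))// -natrX ler_nat ltnW//.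
have -> : 2 `^ (1 - kap) = 2 * 2 `^ (- kap) :> R.
  by rewrite powRD ?powRr1// (_ : (2 : R) != 0) ?implybT// pnatr_eq0.
rewrite sumr_const_nat expnS mul2n -addnn addnK exprMn -[leLHS]mulr_natl.
by rewrite natrX powR_exprnC.
Qed.

Lemma int_sum_le (kap : R) : 1 < kap -> exists2 Z : R, 0 <= Z &
  forall B : nat, \sum_(k < (2 * B).+1) (1 + `|(k%:Z - B%:Z)%:~R|) `^ (- kap) <= Z.
Proof.
move=> k1; pose x : R := 2 `^ (1 - kap).
have x1 : x < 1.
  rewrite /x /powR pnatr_eq0 /= expR_lt1 nmulr_rlt0 ?subr_lt0//.
  by rewrite ln_gt0// ltr1n.
have x0 : 0 <= x by exact: powR_ge0.
exists (2 * (1 + (1 - x)^-1)).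
  by rewrite mulr_ge0// addr_ge0// invr_ge0 subr_ge0 ltW.
move=> B; apply: (@le_trans _ _ (2 * \sum_(0 <= m < B.+1) m.+1%:R `^ (- kap))).
  elim: B => [|B IH].
    by rewrite muln0 big_ord1 big_nat1 subrr normr0 addr0 powR1 mulr1 ler1n.
  rewrite big_nat_recr //= mulrDr mulnS add2n big_ord_recl big_ord_recr /=.
  have -> : (1 + `|(Posz 0 - B.+1%:Z)%:~R : R|) = B.+2%:R.
    by rewrite sub0r rmorphN /= normrN -[B.+2]add1n natrD ger0_norm.
  have -> : (1 + `|((bump 0 (2 * B).+1)%:Z - B.+1%:Z)%:~R : R|) = B.+2%:R.
    have -> : ((bump 0 (2 * B).+1)%:Z - B.+1%:Z)%R = B.+1%:Z by rewrite /bump /=; lia.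
    by rewrite -[B.+2]add1n natrD ger0_norm.
  have -> : \sum_(i < (2 * B).+1) (1 + `|((bump 0 i)%:Z - B.+1%:Z)%:~R|) `^ (- kap) =
      \sum_(k < (2 * B).+1) (1 + `|(k%:Z - B%:Z)%:~R|) `^ (- kap) :> R.
    apply: eq_bigr => i _; congr ((1 + `|_%:~R|) `^ _); rewrite /bump /=; lia.
  by move: IH; lra.
rewrite ler_wpM2l//; apply: (@le_trans _ _ (\sum_(0 <= m < 2 ^ B.+1) m.+1%:R `^ (- kap))).
  rewrite [leRHS](big_cat_nat (n := B.+1)) ?(ltnW (ltn_expl _ _))//= lerDl.
  by apply: sumr_ge0 => m _; exact: powR_ge0.
apply: (le_trans (sum_powR_dyadic _ k1)); rewrite lerD2l -/x.
have x1' : 0 < 1 - x by rewrite subr_gt0.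
have : (x - 1) * \sum_(j < B.+1) x ^+ j = x ^+ B.+1 - 1 by rewrite -subrX1.
move=> h; rewrite -[leRHS]mul1r ler_pdivlMr//.
have := exprn_ge0 B.+1 x0; lra.
Qed.

Lemma floor_cell (m x : R) : 0 < m -> `|(Num.floor (x / m))%:~R| <= 1 + `|x| / m.
Proof.
move=> m0; have := floor_itv (x / m) => /andP[h1 h2].
have -> : `|x| / m = `|x / m| by rewrite normrM (gtr0_norm (x := m^-1)) ?invr_gt0.
move: h2; rewrite intrD => h2.
have := lexx `|x / m|; rewrite !ler_norml; lra.
Qed.

Lemma floor_eq_dist (m x y : R) : 0 < m -> Num.floor (x / m) = Num.floor (y / m) -> `|x - y| < m.
Proof.
move=> m0 h; have := floor_itv (x / m); have := floor_itv (y / m).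
rewrite -h intrD !ler_pdivlMr// !ltr_pdivrMr// => /andP[a b] /andP[c d].
by rewrite ltr_norml; apply/andP; split; nra.
Qed.

Lemma intr_norm_lt1 (z : int) : `|z%:~R : R| < 1 -> z = 0.
Proof. by rewrite -intr_norm ltrz1; lia. Qed.

Lemma powR_interpolate (x y p : R) : 0 < x -> x <= y -> p <= 1 -> x <= y `^ (1 - p) * x `^ p.
Proof.
move=> x0 xy p1; apply: (@le_trans _ _ (x `^ (1 - p) * x `^ p)).
  by rewrite -powRD ?subrK ?powRr1 ?(ltW x0)// (gt_eqF x0) implybT.
rewrite ler_wpM2r ?powR_ge0//; apply: ge0_ler_powR => //.
- by rewrite subr_ge0.
- by rewrite nnegrE ltW.
- by rewrite nnegrE (le_trans (ltW x0)).
Qed.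

Lemma card_neq (r : nat) (i0 : 'I_r) : #|(fun i : 'I_r => i != i0)| = r.-1.
Proof.
have h : (#|pred1 i0| + #|[predC (pred1 i0)]|)%N = r by rewrite cardC card_ord.
have -> : #|(fun i : 'I_r => i != i0)| = #|[predC (pred1 i0)]| by apply: eq_card.
by move: h; rewrite card1; lia.
Qed.

End lattice_tools.

(** * Small divisors *)

(** The aim is a Schur test for the kernel [min S (2 / |lam b - lam a|)]. The
    indices [b] with [lam b] in a slab around [lam a] of width [h] are separated by
    a distance of order [h ^ (- 1 / s)], by the small divisor condition. As such a
    slab is thin in the direction of the coordinate [i0], its points are counted by
    their other coordinates: [r - 1] of them, which is why the exponent [s] may be
    as low as [r - 1 + eta]. *)
Section small_denominators.
Context {R : realType} (r : nat) (w : 'rV[R]_r) (eta Cd : R).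
Hypotheses (r0 : (0 < r)%N) (eta0 : 0 < eta) (Cd0 : 0 < Cd).
Let s : R := r%:R - 1 + eta.
Notation lam := (fun a => freq_dot a w).
Notation nrm := (@mi_norm R r).
Notation A := (fun a => 1 + nrm a).
Hypothesis small : forall a : 'rV[int]_r, a != 0 -> Cd * (A a) `^ (- s) <= `|lam a|.
Implicit Types (a b c : 'rV[int]_r) (F : seq 'rV[int]_r).

Let i0 := Ordinal r0.
Let w1 : R := \sum_j `|w ord0 j|.
(** [kap > 1] makes sums over the integers converge; it is so close to 1 that
    [kap * (r - 1)] stays below [q], and [q] is below [s]. *)
Let kap : R := 1 + eta / (4 * r%:R).
Let q : R := r%:R - 1 + eta / 2.

Let r1 : 1 <= r%:R :> R. Proof. by rewrite ler1n. Qed.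
Let s0 : 0 < s. Proof. by rewrite /s ltr_wpDl// subr_ge0. Qed.
Let q0 : 0 < q. Proof. by rewrite /q ltr_wpDl ?subr_ge0// divr_gt0. Qed.
Let kap1 : 1 < kap. Proof. by rewrite /kap ltrDl divr_gt0// mulr_gt0// ltr0n. Qed.
Let kapq : kap * (r%:R - 1) + (kap - 1) = q - eta / 4.
Proof. by rewrite /kap /q; field; rewrite pnatr_eq0 -lt0n. Qed.
Let qs : q + eta / 2 = s. Proof. by rewrite /q /s; field. Qed.

Lemma mi_norm_ge0 a : 0 <= nrm a. Proof. exact: sumr_ge0. Qed.
Let A1 a : 1 <= A a. Proof. by rewrite lerDl mi_norm_ge0. Qed.
Let A0 a : 0 < A a. Proof. exact: lt_le_trans ltr01 (A1 a). Qed.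

Lemma coord_le_mi_norm a i : `|(a ord0 i)%:~R| <= nrm a.
Proof. by rewrite /mi_norm (bigD1 i)//= lerDl sumr_ge0. Qed.

Lemma mi_normB_le a b : nrm (a - b) <= nrm a + nrm b.
Proof.
rewrite /mi_norm -big_split; apply: ler_sum => i _.
by rewrite !mxE rmorphB /= ler_normB.
Qed.

Lemma freq_dotB a b : lam (a - b) = lam a - lam b.
Proof.
rewrite /freq_dot -sumrB; apply: eq_bigr => i _.
by rewrite !mxE rmorphB /= mulrBl.
Qed.

Lemma freq_dot_le a : `|lam a| <= w1 * nrm a.
Proof.
apply: (le_trans (ler_norm_sum _ _ _)); rewrite mulr_sumr; apply: ler_sum => i _.
rewrite normrM mulrC ler_wpM2r// /w1 (bigD1 i)//= lerDl sumr_ge0//.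
Qed.

Let w1_ge0 : 0 <= w1. Proof. exact: sumr_ge0. Qed.

Let wi0 : 0 < `|w ord0 i0|.
Proof.
pose d : 'rV[int]_r := delta_mx ord0 i0.
have d0 : d != 0.
  by apply/negP => /eqP/matrixP/(_ ord0 i0); rewrite !mxE !eqxx.
have := small d0; rewrite /freq_dot (bigD1 i0)//= big1 => [|j ji]; last first.
  by rewrite !mxE eqxx (negbTE ji) mul0r.
rewrite !mxE !eqxx mul1r addr0; apply: lt_le_trans.
by rewrite mulr_gt0// powR_gt0.
Qed.

Let gk (z : int) : R := (1 + `|z%:~R|) `^ (- kap).
Let gk_ge0 z : 0 <= gk z. Proof. exact: powR_ge0. Qed.

Lemma weight_le_prod (y : R) (J : 'I_r -> int) : 1 <= y ->
  (forall i, i != i0 -> 1 + `|(J i)%:~R| <= y) ->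
  y `^ (- (kap * (r%:R - 1))) <= \prod_(i | i != i0) gk (J i).
Proof.
move=> y1 hJ; have y0 : 0 < y by exact: lt_le_trans y1.
have -> : y `^ (- (kap * (r%:R - 1))) = \prod_(i | i != i0) y `^ (- kap).
  rewrite prodr_const.
  rewrite card_neq.
  rewrite -powR_mulrn ?powR_ge0// -powRrM mulNr; congr (_ `^ (- (_ * _))).
  by rewrite -{1}(prednK r0) -natr1 addrK.
apply: ler_prod => i ii; rewrite powR_ge0 /= /gk !powRN.
have J0 : 0 < 1 + `|(J i)%:~R| :> R by rewrite ltr_pwDl.
rewrite lef_pV2 ?posrE ?powR_gt0//.
apply: ge0_ler_powR; rewrite ?nnegrE ?(ltW y0) ?hJ ?(ltW J0)//.
exact: le_trans (ltW kap1).
Qed.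

(** [c1] is what [far_apart] requires, and [h0] makes all cells of size at least 1. *)
Let c2 : R := r%:R + (2 + w1) / `|w ord0 i0|.
Let c1 : R := (Cd / 3) `^ s^-1 / (1 + c2).
Let h0 : R := Num.min 1 (c1 `^ s).

Let c20 : 0 <= c2. Proof. by rewrite /c2 addr_ge0// divr_ge0// addr_ge0. Qed.
Let c10 : 0 < c1.
Proof. by rewrite /c1 divr_gt0 ?powR_gt0 ?divr_gt0// ltr_wpDr. Qed.
Let h00 : 0 < h0. Proof. by rewrite /h0 lt_min ltr01 powR_gt0. Qed.
Let h01 : h0 <= 1. Proof. by rewrite /h0 ge_min lexx. Qed.

(** The cell size attached to a slab of half-width [h]. *)
Let cell h : R := c1 * h `^ (- s^-1).

Let cell_ge0 h : 0 <= cell h. Proof. by rewrite mulr_ge0 ?powR_ge0 ?(ltW c10). Qed.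

Let cell_powR h p : 0 < h -> cell h `^ p = c1 `^ p * h `^ (- (p / s)).
Proof.
move=> hp; rewrite /cell powRM ?powR_ge0 ?(ltW c10)// -powRrM; congr (_ * _ `^ _).
by rewrite mulNr mulrC.
Qed.

Let cell_ge1 h : 0 < h <= h0 -> 1 <= cell h.
Proof.
move=> /andP[hp hh]; rewrite /cell powRN ler_pdivlMr ?powR_gt0// mul1r.
have -> : c1 = (c1 `^ s) `^ s^-1 by rewrite -powRrM mulfV ?gt_eqF// powRr1// ltW.
apply: ge0_ler_powR; rewrite ?nnegrE ?invr_ge0 ?powR_ge0 ?(ltW hp) ?(ltW s0)//.
by apply: (le_trans hh); rewrite /h0 ge_min lexx orbT.
Qed.

(** Two distinct multi-indices with nearly equal frequencies are far apart: this
    is where the Diophantine condition enters. *)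
Let far_apart h d : 0 < h <= h0 -> d != 0 -> `|lam d| <= 2 * h -> (1 + c2) * cell h < A d.
Proof.
move=> hh d0 hd; have /andP[hp _] := hh.
rewrite ltNge; apply/negP => Ad.
have h1 := le_trans (small d0) hd.
have c3 : 0 < 1 + c2 by rewrite ltr_wpDr.
have : A d `^ s <= Cd / 3 / h.
  apply: (@le_trans _ _ (((1 + c2) * cell h) `^ s)).
    apply: ge0_ler_powR => //; rewrite ?nnegrE ?(ltW s0) ?(ltW (A0 d))//.
    by rewrite mulr_ge0 ?cell_ge0 ?(ltW c3).
  rewrite powRM ?(ltW c3)//.
  rewrite cell_powR// mulrA -powRM ?(ltW c3) ?(ltW c10)// divff ?gt_eqF// powR_inv1 ?(ltW hp)//.
  have -> : (1 + c2) * c1 = (Cd / 3) `^ s^-1 by rewrite /c1 mulrC divfK// gt_eqF.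
  by rewrite -powRrM mulVf ?gt_eqF// powRr1// divr_ge0// ltW.
move: h1; rewrite powRN ler_pdivrMr ?powR_gt0// => h1 h2.
have : Cd <= 2 * h * (Cd / 3 / h) by apply: (le_trans h1); rewrite ler_wpM2l// mulr_ge0// ltW.
have -> : 2 * h * (Cd / 3 / h) = 2 / 3 * Cd by field; rewrite gt_eqF.
by move: Cd0; lra.
Qed.

(** The cell that contains [b], the coordinate [i0] being dropped. *)
Let J h b (i : 'I_r) : int := if i == i0 then 0 else Num.floor ((b ord0 i)%:~R / cell h).

(** Two points of the slab in the same cell are close in all coordinates but [i0],
    hence in [i0] also, as their frequencies are close: [far_apart] excludes it. *)
Let J_inj h a b c : 0 < h <= h0 -> `|lam b - lam a| <= h -> `|lam c - lam a| <= h ->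
  J h b =1 J h c -> b = c.
Proof.
move=> hh hb hc hJ; apply/eqP; rewrite -subr_eq0; apply/negPn/negP => bc0.
have m1 := cell_ge1 hh; have m0 := lt_le_trans ltr01 m1.
have /andP[hp hh0] := hh.
have hbc : `|lam (b - c)| <= 2 * h.
  rewrite freq_dotB; have -> : lam b - lam c = (lam b - lam a) - (lam c - lam a) by ring.
  by apply: (le_trans (ler_normB _ _)); lra.
have := far_apart hh bc0 hbc; rewrite ltNge => /negP; apply.
have hi i : i != i0 -> `|((b - c) ord0 i)%:~R| <= cell h :> R.
  move=> ii; rewrite !mxE rmorphB /=; apply/ltW/floor_eq_dist => //.
  by have := hJ i; rewrite /J (negbTE ii).
have hi0 : `|((b - c) ord0 i0)%:~R| <= (2 + w1) / `|w ord0 i0| * cell h :> R.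
  rewrite mulrAC ler_pdivlMr// -normrM.
  have -> : ((b - c) ord0 i0)%:~R * w ord0 i0 = lam (b - c)
       - \sum_(j | j != i0) ((b - c) ord0 j)%:~R * w ord0 j.
    by rewrite /freq_dot [in RHS](bigD1 i0)//= addrK.
  apply: (le_trans (ler_normB _ _)); rewrite mulrDl; apply: lerD.
    by apply: (le_trans hbc); rewrite ler_wpM2l//; apply: le_trans m1; exact: le_trans h01.
  apply: (le_trans (ler_norm_sum _ _ _)).
  apply: (@le_trans _ _ (\sum_(j | j != i0) cell h * `|w ord0 j|)).
    by apply: ler_sum => j ji; rewrite normrM ler_wpM2r// hi.
  rewrite -mulr_sumr mulrC ler_wpM2r ?(ltW m0)// /w1 [leRHS](bigD1 i0)//= lerDr//.
have : nrm (b - c) <= c2 * cell h.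
  rewrite /mi_norm (bigD1 i0)//= /c2 mulrDl addrC; apply: lerD => //.
  apply: (@le_trans _ _ (\sum_(j < r) cell h)).
    rewrite [leRHS](bigD1 i0)//= -[leLHS]add0r; apply: lerD; first exact: ltW.
    by apply: ler_sum => i /hi.
  by rewrite sumr_const card_ord -[leLHS]mulr_natl.
move=> h3; have -> : (1 + c2) * cell h = cell h + c2 * cell h by ring.
exact: lerD.
Qed.

Let Zex := int_sum_le kap1.
Let Z : R := projT1 (cid2 Zex).
Let Z_ge0 : 0 <= Z. Proof. by rewrite /Z; case: (cid2 Zex). Qed.
Let Z_le (B : nat) : \sum_(k < (2 * B).+1) gk (k%:Z - B%:Z) <= Z.
Proof. by rewrite /Z; case: (cid2 Zex). Qed.

Let slab (h : R) a b : bool := `|lam b - lam a| <= h.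

(** There is at most one point per cell. *)
Let slab_sum_le F h a : uniq F -> 0 < h <= h0 ->
  \sum_(b <- F | slab h a b) (2 + nrm b / cell h) `^ (- (kap * (r%:R - 1))) <= Z ^+ r.
Proof.
move=> uF hh; have m1 := cell_ge1 hh; have m0 := lt_le_trans ltr01 m1.
rewrite -big_filter; set F' := [seq b <- F | slab h a b].
apply: le_trans (prod_sum_le gk_ge0 Z_le (filter_uniq _ uF : uniq F') (J := J h) _); last first.
  by move=> b c; rewrite !mem_filter => /andP[hb _] /andP[hc _]; exact: (J_inj hh hb hc).
apply: ler_sum => b _; rewrite [leRHS](bigD1 i0)//= {1}/J eqxx /gk normr0 addr0 powR1 mul1r.
apply: weight_le_prod.
  by rewrite (@le_trans _ _ 2)// ?ler1n// lerDl divr_ge0 ?mi_norm_ge0// ltW.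
move=> i ii; rewrite /J (negbTE ii) (_ : 2 = 1 + 1)// -addrA lerD2l.
apply: (le_trans (floor_cell _ m0)); rewrite lerD2l ler_wpM2r ?invr_ge0 ?(ltW m0)//.
exact: coord_le_mi_norm.
Qed.

Let slab_dist h a b : 0 < h <= h0 -> b != a -> slab h a b -> cell h <= A a + A b.
Proof.
move=> hh ba hb; have m1 := cell_ge1 hh; have m0 := lt_le_trans ltr01 m1.
have ba0 : b - a != 0 by rewrite subr_eq0.
have /andP[hp _] := hh.
have hd : `|lam (b - a)| <= 2 * h by rewrite freq_dotB; apply: (le_trans hb); lra.
have := far_apart hh ba0 hd; have := mi_normB_le b a.
have : cell h <= (1 + c2) * cell h by rewrite mulrDl mul1r lerDl mulr_ge0 ?cell_ge0.
by lra.
Qed.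

Let base_ge1 h b : 0 < h <= h0 -> 1 <= 2 + nrm b / cell h.
Proof.
move=> /cell_ge1 m1; rewrite (@le_trans _ _ 2)// ?ler1n// lerDl divr_ge0 ?mi_norm_ge0 ?cell_ge0//.
Qed.

Let kq1 : kap * (r%:R - 1) <= q.
Proof. have := kapq; have := kap1; have := eta0; lra. Qed.

(** Slab sum over indices not smaller than [a]: all of them are at least of the
    order of the cell size. *)
Let slab_upper_le F h a : uniq F -> 0 < h <= h0 ->
  \sum_(b <- F | [&& b != a, nrm a <= nrm b & slab h a b]) (A b) `^ (- q)
  <= 5 `^ q * c1 `^ (- q) * Z ^+ r * h `^ (q / s).
Proof.
move=> uF hh; have m1 := cell_ge1 hh; have m0 := lt_le_trans ltr01 m1.
have /andP[hp _] := hh.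
apply: (@le_trans _ _ (5 `^ q * cell h `^ (- q) *
    \sum_(b <- F | slab h a b) (2 + nrm b / cell h) `^ (- (kap * (r%:R - 1))))); last first.
  rewrite cell_powR// mulNr opprK [leRHS]mulrAC -!mulrA; do 3!(rewrite ler_wpM2l ?powR_ge0//).
  exact: slab_sum_le.
rewrite mulr_sumr big_mkcond [leRHS]big_mkcond; apply: ler_sum => b _.
case: ifPn => [/and3P[ba ab hb]|_]; last by case: ifP => // _; rewrite !mulr_ge0 ?powR_ge0.
rewrite hb; have d := slab_dist hh ba hb.
have y1 := base_ge1 b hh; set y := 2 + nrm b / cell h in y1 *.
have hy : y <= 5 * (cell h)^-1 * A b.
  rewrite /y mulrAC ler_pdivlMr// mulrDl divfK ?gt_eqF//; have := A1 b; lra.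
have y0 := lt_le_trans ltr01 y1.
have : y `^ q <= (5 * (cell h)^-1 * A b) `^ q.
  apply: ge0_ler_powR => //; rewrite ?nnegrE ?(ltW q0) ?(ltW y0)//.
  by rewrite !mulr_ge0 ?invr_ge0 ?(ltW m0) ?(ltW (A0 b)).
rewrite powRM ?mulr_ge0 ?invr_ge0 ?(ltW m0) ?(ltW (A0 b))// powRM ?invr_ge0 ?(ltW m0)//.
have -> : (cell h)^-1 `^ q = cell h `^ (- q).
  by rewrite -powR_inv1 ?(ltW m0)// -powRrM mulN1r.
move=> hyq; apply: (@le_trans _ _ (5 `^ q * cell h `^ (- q) * y `^ (- q))).
  by rewrite (powRN (A b)) (powRN y) ler_pdivlMr ?powR_gt0// ler_pdivrMl ?powR_gt0// mulrC.
rewrite ler_wpM2l ?mulr_ge0 ?powR_ge0//; apply: ler_powR => //.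
by rewrite lerN2.
Qed.

(** Here the indices may be small, but there are few of them. *)
Let slab_lower_le F h a : uniq F -> 0 < h <= h0 ->
  \sum_(b <- F | [&& b != a, nrm b <= nrm a & slab h a b]) (A b) `^ (- s)
  <= 2 `^ s * Z ^+ r.
Proof.
move=> uF hh; have m1 := cell_ge1 hh; have m0 := lt_le_trans ltr01 m1.
apply: (@le_trans _ _ (2 `^ s *
    \sum_(b <- F | slab h a b) (2 + nrm b / cell h) `^ (- (kap * (r%:R - 1))))); last first.
  by rewrite ler_wpM2l ?powR_ge0// slab_sum_le.
rewrite mulr_sumr big_mkcond [leRHS]big_mkcond; apply: ler_sum => b _.
case: ifPn => [/and3P[ba ab hb]|_]; last by case: ifP => // _; rewrite !mulr_ge0 ?powR_ge0.
rewrite hb; have y1 := base_ge1 b hh; set y := 2 + nrm b / cell h in y1 *.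
have y0 := lt_le_trans ltr01 y1.
have hy : y <= 2 * A b.
  rewrite /y mulrDr mulr1 lerD2l; apply: (@le_trans _ _ (nrm b)).
    by rewrite ler_pdivrMr// ler_peMr// mi_norm_ge0.
  by rewrite ler_peMl ?mi_norm_ge0// ler1n.
have hys : y `^ s <= 2 `^ s * A b `^ s.
  rewrite -powRM ?(ltW (A0 b))//; apply: ge0_ler_powR => //; rewrite ?nnegrE ?(ltW s0) ?(ltW y0)//.
  by rewrite mulr_ge0 ?(ltW (A0 b)).
apply: (@le_trans _ _ (2 `^ s * y `^ (- s))).
  by rewrite !powRN ler_pdivlMr ?powR_gt0// ler_pdivrMl ?powR_gt0// mulrC.
rewrite ler_wpM2l ?powR_ge0//; apply: ler_powR => //.
by rewrite lerN2; have := kq1; have := qs; have := eta0; lra.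
Qed.

Let ker (S : R) a b : R := Num.min S (2 / `|lam b - lam a|).

Let lam_gt0 a b : b != a -> 0 < `|lam b - lam a|.
Proof.
rewrite -subr_eq0 => /small; rewrite freq_dotB; apply: lt_le_trans.
by rewrite mulr_gt0// powR_gt0.
Qed.

Let ker_sym S a b : ker S a b = ker S b a. Proof. by rewrite /ker distrC. Qed.

Let ker_ge0 (S : R) a b : 0 <= S -> 0 <= ker S a b.
Proof. by move=> S0; rewrite /ker le_min S0 divr_ge0. Qed.

(** The kernel is dominated by indicators of slabs of widths [h0 / 2 ^ j], weighted
    by the inverse widths. *)
Let layer n a b : R := \sum_(j < n.+1) 4 / h0 * 2 ^+ j * (slab (h0 / 2 ^+ j) a b)%:R.

Let frac_le (c l : R) : 0 < c -> h0 / c < l -> 2 / l <= 4 / h0 * (c / 2).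
Proof.
move=> c0 lo; have l0 : 0 < l by apply: lt_trans lo; rewrite divr_gt0.
have -> : 4 / h0 * (c / 2) = 2 * c / h0 by field; rewrite gt_eqF.
rewrite ler_pdivrMr// mulrAC ler_pdivlMr//; move: lo; rewrite ltr_pdivrMr//; lra.
Qed.

Let layer_term_ge0 j a b : 0 <= 4 / h0 * 2 ^+ j * (slab (h0 / 2 ^+ j) a b)%:R :> R.
Proof. by rewrite !mulr_ge0 ?invr_ge0 ?(ltW h00) ?exprn_ge0. Qed.

Let layer_inv n a b : h0 / 2 ^+ n.+1 < `|lam b - lam a| <= h0 -> 2 / `|lam b - lam a| <= layer n a b.
Proof.
move=> /andP[]; elim: n => [|n IH] lo hi.
  rewrite /layer big_ord1 expr0 mulr1 divr1 /slab hi mulr1.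
  by apply: (le_trans (frac_le _ lo)); rewrite ?expr1// divff ?mulr1// pnatr_eq0.
rewrite /layer big_ord_recr /=.
have [small_|large] := leP `|lam b - lam a| (h0 / 2 ^+ n.+1).
  apply: (@le_trans _ _ (4 / h0 * 2 ^+ n.+1)); last first.
    by rewrite /slab small_ mulr1 lerDr; apply: sumr_ge0 => j _; exact: layer_term_ge0.
  apply: (le_trans (frac_le _ lo)); first by rewrite exprn_gt0.
  by rewrite [2 ^+ n.+2]exprS [2 * _]mulrC mulfK// pnatr_eq0.
by apply: (le_trans (IH large hi)); rewrite lerDl layer_term_ge0.
Qed.

Let layer_ge n (S : R) a b : b != a -> `|lam b - lam a| <= h0 -> S <= 2 ^+ n -> ker S a b <= layer n a b.
Proof.
move=> ba hi Sn; have [sm|la] := leP `|lam b - lam a| (h0 / 2 ^+ n).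
  apply: (@le_trans _ _ S); first by rewrite /ker ge_min lexx.
  rewrite /layer big_ord_recr /= {2}/slab sm mulr1; apply: (le_trans Sn).
  apply: (@le_trans _ _ (4 / h0 * 2 ^+ n)).
    by rewrite ler_peMl ?exprn_ge0// ler_pdivlMr// mul1r (le_trans h01)// ler1n.
  by rewrite lerDr; apply: sumr_ge0 => j _; exact: layer_term_ge0.
apply: (@le_trans _ _ (2 / `|lam b - lam a|)); first by rewrite /ker ge_min lexx orbT.
case: n la Sn => [|n] la _; first by move: la; rewrite expr0 divr1 ltNge hi.
apply: (@le_trans _ _ (layer n a b)); first by apply: layer_inv; rewrite la.
by rewrite {2}/layer big_ord_recr /= lerDl layer_term_ge0.
Qed.

Let dyadic_exists (S : R) : 1 <= S -> exists n : nat, S <= 2 ^+ n <= 2 * S.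
Proof.
move=> S1.
have ex : exists n : nat, S <= 2 ^+ n.
  exists (Num.bound S); apply: (le_trans (ltW (archi_boundP (le_trans ler01 S1)))).
  by rewrite -natrX ler_nat ltnW// ltn_expl.
case: (ex_minnP ex) => n Sn nmin; exists n; rewrite Sn /=.
case: n Sn nmin => [|n] Sn nmin; first by rewrite expr0; lra.
rewrite exprS ler_wpM2l//; apply/ltW; rewrite ltNge; apply/negP => h.
by have := nmin n h; rewrite ltnn.
Qed.

Let half_slab j : 0 < h0 / 2 ^+ j <= h0.
Proof.
rewrite divr_gt0 ?exprn_gt0//= ler_pdivrMr ?exprn_gt0// ler_peMr ?(ltW h00)//.
by rewrite exprn_ege1// ler1n.
Qed.

Let dyadic_sum_le (p S : R) n : 0 < p -> 1 <= S -> 2 ^+ n <= 2 * S ->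
  \sum_(j < n.+1) (2 ^+ j) `^ p <= 2 `^ p / (2 `^ p - 1) * 2 `^ p * S `^ p.
Proof.
move=> p0 S1 nS.
have x1 : 1 < 2 `^ p by rewrite /powR pnatr_eq0 /= expR_gt1 mulr_gt0// ln_gt0// ltr1n.
under eq_bigr do rewrite powR_exprnC//.
apply: (le_trans (geometric_le n x1)).
rewrite -[leRHS]mulrA; apply: ler_wpM2l.
  by rewrite divr_ge0 ?powR_ge0// subr_ge0 ltW.
rewrite -powR_exprnC// -powRM// ?(le_trans ler01)//.
apply: ge0_ler_powR => //; rewrite ?nnegrE ?exprn_ge0// ?(ltW p0)// mulr_ge0// (le_trans ler01)//.
Qed.

Let dyadic_const_ge0 (p : R) : 0 < p -> 0 <= 2 `^ p / (2 `^ p - 1) * 2 `^ p :> R.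
Proof.
move=> p0.
have x1 : 0 <= 2 `^ p - 1 :> R.
  by rewrite subr_ge0 /powR pnatr_eq0 /= ltW// expR_gt1 mulr_gt0// ln_gt0// ltr1n.
nonneg.
Qed.

Let qs1 : 0 < 1 - q / s.
Proof. by rewrite subr_gt0 ltr_pdivrMr// mul1r -qs ltrDl divr_gt0. Qed.
Let qs_gt0 : 0 < q / s. Proof. by rewrite divr_gt0. Qed.

(** Inside the widest slab the kernel is dominated by the dyadic layers. *)
Let near_layers (Q : pred 'rV[int]_r) F (S t : R) a n : S <= 2 ^+ n ->
  \sum_(b <- F | [&& b != a, Q b & slab h0 a b]) ker S a b * (A b) `^ t <=
  \sum_(j < n.+1) 4 / h0 * 2 ^+ j *
     \sum_(b <- F | [&& b != a, Q b & slab (h0 / 2 ^+ j) a b]) (A b) `^ t.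
Proof.
move=> Sn; apply: (@le_trans _ _ (\sum_(b <- F | [&& b != a, Q b & slab h0 a b])
    layer n a b * (A b) `^ t)).
  apply: ler_sum => b /and3P[ba _ hb]; rewrite ler_wpM2r ?powR_ge0//; exact: layer_ge.
rewrite /layer; under eq_bigr do rewrite mulr_suml.
rewrite exchange_big /=; apply: ler_sum => j _.
rewrite mulr_sumr big_mkcond [leRHS]big_mkcond; apply: ler_sum => b _ /=.
have [ba|] := boolP (b != a) => //=; have [ab|] := boolP (Q b) => //=.
have [hj|nhj] := boolP (slab (h0 / 2 ^+ j) a b); last first.
  by rewrite mulr0 mul0r; case: ifP.
have -> : slab h0 a b by apply: (le_trans hj); case/andP: (half_slab j).
by rewrite mulr1.
Qed.

(** By [slab_upper_le] the layers contribute a geometric progression of ratio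
    [2 ^ (1 - q / s)]. *)
Let near_upper : exists2 C : R, 0 <= C & forall F (S : R) a, uniq F -> 1 <= S ->
  \sum_(b <- F | [&& b != a, nrm a <= nrm b & slab h0 a b]) ker S a b * (A b) `^ (- q)
  <= C * S `^ (1 - q / s).
Proof.
pose K := 5 `^ q * c1 `^ (- q) * Z ^+ r.
have K0 : 0 <= K by rewrite !mulr_ge0 ?powR_ge0 ?exprn_ge0.
pose p := 1 - q / s.
pose D := 2 `^ p / (2 `^ p - 1) * 2 `^ p : R.
exists (4 / h0 * K * h0 `^ (q / s) * D).
  by have D0 : 0 <= D := dyadic_const_ge0 qs1; nonneg.
move=> F S a uF S1; have [n /andP[Sn nS]] := dyadic_exists S1.
apply: (le_trans (near_layers (fun b => nrm a <= nrm b) F (- q) a Sn)).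
apply: (@le_trans _ _ (\sum_(j < n.+1) 4 / h0 * K * h0 `^ (q / s) * (2 ^+ j) `^ p)).
  apply: ler_sum => j _; have := slab_upper_le a uF (half_slab j); rewrite -/K => h.
  have hh : 0 <= 4 / h0 * 2 ^+ j by nonneg.
  apply: (le_trans (ler_wpM2l hh h)).
  rewrite powRM ?(ltW h00) ?invr_ge0 ?exprn_ge0//.
  have -> : (2 ^+ j : R)^-1 `^ (q / s) = ((2 ^+ j) `^ (q / s))^-1.
    by rewrite -powR_inv1 ?exprn_ge0// -powRrM mulN1r powRN.
  have -> : (2 ^+ j) `^ p = 2 ^+ j / (2 ^+ j) `^ (q / s) :> R.
    by rewrite /p powRB ?powRr1 ?exprn_ge0// expf_neq0 ?implybT// pnatr_eq0.
  by apply: eq_ler; ring.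
rewrite -mulr_sumr -[leRHS]mulrA; apply: ler_wpM2l.
  by nonneg.
exact: dyadic_sum_le.
Qed.

(** A layer contributes only if it contains an index below [a], which bounds [2 ^ j]
    by a multiple of [A a ^ s]; part of [2 ^ j] is traded for a power of [A a]. *)
Let near_lower : exists2 C : R, 0 <= C & forall F (S : R) a, uniq F -> 1 <= S ->
  \sum_(b <- F | [&& b != a, nrm b <= nrm a & slab h0 a b]) ker S a b * (A b) `^ (- s)
  <= C * S `^ (q / s) * (A a) `^ (s - q).
Proof.
pose K := 2 `^ s * Z ^+ r : R.
have K0 : 0 <= K by rewrite !mulr_ge0 ?powR_ge0 ?exprn_ge0.
pose p := q / s.
pose D := 2 `^ p / (2 `^ p - 1) * 2 `^ p : R.
pose E := (h0 * (2 / c1) `^ s) `^ (1 - p).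
have E0 : 0 <= E by exact: powR_ge0.
have D0 : 0 <= D := dyadic_const_ge0 qs_gt0.
exists (4 / h0 * K * E * D); first by nonneg.
move=> F S a uF S1; have [n /andP[Sn nS]] := dyadic_exists S1.
apply: (le_trans (near_layers (fun b => nrm b <= nrm a) F (- s) a Sn)).
apply: (@le_trans _ _ (\sum_(j < n.+1) 4 / h0 * K * E * (A a) `^ (s - q) * (2 ^+ j) `^ p)).
  apply: ler_sum => j _.
  have hh : 0 <= 4 / h0 * 2 ^+ j by nonneg.
  have [hn|/hasPn none] := boolP (has (fun b => [&& b != a, nrm b <= nrm a & slab (h0 / 2 ^+ j) a b]) F);
    last first.
    rewrite big1_seq ?mulr0 => [|b /andP[hb bF]]; last by have := none b bF; rewrite hb.
    by nonneg.
  have /hasP[b bF /and3P[ba bna hb]] := hn.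
  have d := slab_dist (half_slab j) ba hb.
  apply: (le_trans (ler_wpM2l hh (slab_lower_le a uF (half_slab j)))); rewrite -/K.
  have d2 : cell (h0 / 2 ^+ j) <= 2 * A a by move: d bna; lra.
  have d3 : 2 ^+ j <= h0 * (2 / c1) `^ s * (A a) `^ s.
    have : cell (h0 / 2 ^+ j) `^ s <= (2 * A a) `^ s.
      by apply: ge0_ler_powR => //; rewrite ?nnegrE ?(ltW s0) ?cell_ge0// mulr_ge0// ltW// A0.
    have /andP[hp _] := half_slab j.
    rewrite cell_powR// divff ?gt_eqF// powR_inv1 ?(ltW hp)// powRM ?(ltW (A0 a))//.
    rewrite invf_div => h.
    have c1s : 0 < c1 `^ s by rewrite powR_gt0.
    have -> : (2 / c1) `^ s = 2 `^ s / c1 `^ s.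
      by rewrite powRM ?invr_ge0 ?(ltW c10)// -powR_inv1 ?(ltW c10)// -powRrM mulN1r powRN.
    rewrite mulrA mulrAC ler_pdivlMr//.
    move: h; rewrite mulrA ler_pdivrMr// mulrC => h; apply: (le_trans h).
    by apply: eq_ler; ring.
  have d4 : 2 ^+ j <= E * (A a) `^ (s - q) * (2 ^+ j) `^ p.
    have -> : (A a) `^ (s - q) = ((A a) `^ s) `^ (1 - p).
      by rewrite -powRrM; congr (_ `^ _); rewrite /p; field; rewrite gt_eqF.
    rewrite /E -powRM ?powR_ge0 ?mulr_ge0 ?(ltW h00) ?powR_ge0//.
    by apply: powR_interpolate => //; move: qs1; rewrite -/p; lra.
  have -> : 4 / h0 * 2 ^+ j * K = 4 / h0 * K * 2 ^+ j by ring.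
  have -> : 4 / h0 * K * E * A a `^ (s - q) * (2 ^+ j) `^ p =
    4 / h0 * K * (E * A a `^ (s - q) * (2 ^+ j) `^ p) by ring.
  by rewrite ler_wpM2l//; nonneg.
rewrite -mulr_sumr.
have -> : 4 / h0 * K * E * D * S `^ (q / s) * A a `^ (s - q) =
  4 / h0 * K * E * A a `^ (s - q) * (D * S `^ (q / s)) by ring.
apply: ler_wpM2l; first by nonneg.
exact: dyadic_sum_le.
Qed.

Let c4 : R := 2 / h0 + `|w ord0 i0|^-1.
Let c4_ge0 : 0 <= c4. Proof. by rewrite /c4; nonneg. Qed.

(** Away from the slabs the integer part of the frequency gap replaces the
    coordinate [i0], and provides decay in the gap. *)
Let Jfar a b (i : 'I_r) : int :=
  if i == i0 then Num.floor ((lam b - lam a) / `|w ord0 i0|) else b ord0 i.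

Let Jfar_inj a b c : Jfar a b =1 Jfar a c -> b = c.
Proof.
move=> hJ.
have hi i : i != i0 -> b ord0 i = c ord0 i by move=> ii; have := hJ i; rewrite /Jfar (negbTE ii).
have d : lam b - lam c = (b ord0 i0 - c ord0 i0)%:~R * w ord0 i0.
  rewrite /freq_dot (bigD1 i0)//= [X in _ - X](bigD1 i0)//= rmorphB /=.
  rewrite (eq_bigr (fun j => (c ord0 j)%:~R * w ord0 j)); last by move=> j /hi ->.
  by ring.
have := hJ i0; rewrite /Jfar eqxx => /(floor_eq_dist wi0).
have -> : lam b - lam a - (lam c - lam a) = lam b - lam c by ring.
rewrite d normrM gtr_pMl// => lt1.
have e0 : b ord0 i0 = c ord0 i0.
  by apply/eqP; rewrite -subr_eq0; apply/eqP/(@intr_norm_lt1 R).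
apply/matrixP => x i; rewrite (ord1 x).
by have [->|/hi] := eqVneq i i0.
Qed.

Let far_sum_le F a : uniq F ->
  \sum_(b <- F | ~~ slab h0 a b)
    (A b) `^ (- (kap * (r%:R - 1))) * `|lam b - lam a| `^ (- kap) <= c4 `^ kap * Z ^+ r.
Proof.
move=> uF; apply: (@le_trans _ _ (c4 `^ kap * \sum_(b <- F) \prod_i gk (Jfar a b i))); last first.
  rewrite ler_wpM2l ?powR_ge0//; apply: (prod_sum_le gk_ge0 Z_le uF) => b c _ _.
  exact: Jfar_inj.
rewrite mulr_sumr big_mkcond; apply: ler_sum => b _.
case: ifPn => [|_]; last by rewrite mulr_ge0 ?powR_ge0 ?prodr_ge0.
rewrite /slab -ltNge => far.
have l0 : 0 < `|lam b - lam a| by apply: lt_trans far.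
rewrite (bigD1 i0)//= mulrCA mulrC mulrA; apply: ler_pM; rewrite ?powR_ge0//.
  rewrite {1}/Jfar eqxx /gk.
  set z : R := `|_%:~R|.
  have hz : 1 + z <= c4 * `|lam b - lam a|.
    have := floor_cell (lam b - lam a) wi0; rewrite -/z => h.
    rewrite /c4 mulrDl (mulrC `|_|^-1); have : 2 <= 2 / h0 * `|lam b - lam a|.
      by rewrite mulrAC ler_pdivlMr//; move: far; lra.
    by lra.
  have z0 : 0 < 1 + z by rewrite ltr_pwDl// /z.
  rewrite !powRN [leRHS]mulrC -[leLHS]mul1r ler_pdivrMr ?powR_gt0// mulrAC ler_pdivlMr ?powR_gt0// mul1r.
  rewrite -powRM ?(ltW l0)//; apply: ge0_ler_powR => //; rewrite ?nnegrE ?(ltW z0)//.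
    exact: le_trans (ltW kap1).
  by rewrite mulr_ge0.
apply: weight_le_prod => // i ii; rewrite /Jfar (negbTE ii) lerD2l.
exact: coord_le_mi_norm.
Qed.

Let ker_far S a b (y : R) : b != a -> `|lam b - lam a| <= y ->
  ker S a b <= 2 * y `^ (kap - 1) * `|lam b - lam a| `^ (- kap).
Proof.
move=> ba ly; have l0 := lam_gt0 ba.
apply: (@le_trans _ _ (2 / `|lam b - lam a|)); first by rewrite /ker ge_min lexx orbT.
rewrite -mulrA ler_wpM2l//.
have -> : `|lam b - lam a|^-1 = `|lam b - lam a| `^ (kap - 1) * `|lam b - lam a| `^ (- kap).
  rewrite -powRD ?(gt_eqF l0) ?implybT//.
  have -> : kap - 1 + - kap = -1 by ring.
  by rewrite powR_inv1// ltW.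
rewrite ler_wpM2r ?powR_ge0//; apply: ge0_ler_powR => //; rewrite ?nnegrE ?(ltW l0)//.
  by rewrite subr_ge0 ltW.
exact: le_trans ly.
Qed.

Let lam_dist_le a b : `|lam b - lam a| <= w1 * (A b + A a).
Proof.
rewrite -freq_dotB; apply: (le_trans (freq_dot_le _)); rewrite ler_wpM2l//.
have := mi_normB_le b a; lra.
Qed.

Let kernel_upper : exists2 C : R, 0 <= C & forall F (S : R) a, uniq F -> 1 <= S ->
  \sum_(b <- F | (b != a) && (nrm a <= nrm b)) ker S a b * (A b) `^ (- q)
  <= C * S `^ (1 - q / s).
Proof.
have [C1 C10 hC1] := near_upper.
pose C2 := 2 * (2 * w1) `^ (kap - 1) * (c4 `^ kap * Z ^+ r).
have C20 : 0 <= C2 by rewrite /C2; nonneg.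
exists (C1 + C2) => [|F S a uF S1]; first exact: addr_ge0.
rewrite (bigID (slab h0 a)) /= mulrDl; apply: lerD.
  by apply: le_trans (hC1 F S a uF S1); under eq_bigl do rewrite -andbA.
apply: (@le_trans _ _ C2); last first.
  by rewrite ler_peMr// -[leLHS](powRr0 S) ler_powR// ltW.
rewrite /C2; apply: (@le_trans _ _ (2 * (2 * w1) `^ (kap - 1) *
   \sum_(b <- F | ~~ slab h0 a b)
    (A b) `^ (- (kap * (r%:R - 1))) * `|lam b - lam a| `^ (- kap))); last first.
  by rewrite ler_wpM2l ?far_sum_le//; nonneg.
rewrite mulr_sumr big_mkcond [leRHS]big_mkcond; apply: ler_sum => b _.
case: ifPn => [/andP[/andP[ba ab] ->]|_]; last first.
  by case: ifP => // _; nonneg.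
have hl : `|lam b - lam a| <= 2 * w1 * A b.
  apply: (le_trans (lam_dist_le a b)); rewrite [2 * _]mulrC -mulrA ler_wpM2l//; move: ab; lra.
have w20 : 0 <= 2 * w1 by nonneg.
have := ker_far S ba hl; rewrite powRM ?w20 ?(ltW (A0 b))// => h.
apply: (le_trans (ler_wpM2r (powR_ge0 _ _) h)).
have e : (A b) `^ (kap - 1) * (A b) `^ (- q) <= (A b) `^ (- (kap * (r%:R - 1))).
  rewrite -powRD ?(gt_eqF (A0 b)) ?implybT//; apply: ler_powR => //.
  have := kapq; have := eta0; lra.
have -> : 2 * ((2 * w1) `^ (kap - 1) * (A b) `^ (kap - 1)) * `|lam b - lam a| `^ (- kap) * (A b) `^ (- q)
  = 2 * (2 * w1) `^ (kap - 1) * ((A b) `^ (kap - 1) * (A b) `^ (- q) * `|lam b - lam a| `^ (- kap)) by ring.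
apply: ler_wpM2l; first by nonneg.
by rewrite ler_wpM2r ?powR_ge0.
Qed.

Let kernel_lower : exists2 C : R, 0 <= C & forall F (S : R) a, uniq F -> 1 <= S ->
  \sum_(b <- F | (b != a) && (nrm b <= nrm a)) ker S a b * (A b) `^ (- s)
  <= C * S `^ (q / s) * (A a) `^ (s - q).
Proof.
have [C1 C10 hC1] := near_lower.
pose C2 := 2 * (2 * w1) `^ (kap - 1) * (c4 `^ kap * Z ^+ r).
have C20 : 0 <= C2 by rewrite /C2; nonneg.
exists (C1 + C2) => [|F S a uF S1]; first exact: addr_ge0.
have -> : (C1 + C2) * S `^ (q / s) * (A a) `^ (s - q) =
  C1 * S `^ (q / s) * (A a) `^ (s - q) + C2 * S `^ (q / s) * (A a) `^ (s - q) by ring.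
rewrite (bigID (slab h0 a)) /=; apply: lerD.
  by apply: le_trans (hC1 F S a uF S1); under eq_bigl do rewrite -andbA.
apply: (@le_trans _ _ (C2 * (A a) `^ (s - q))); last first.
  by rewrite ler_wpM2r ?powR_ge0// ler_peMr// -[leLHS](powRr0 S) ler_powR// ltW.
apply: (@le_trans _ _ (C2 * (A a) `^ (kap - 1))); last first.
  rewrite ler_wpM2l//; apply: ler_powR => //.
  have := kapq; have := kq1; have := qs; have := eta0.
  rewrite /kap; move: r1 => h1 h2 h3 h4 h5.
  have : eta / (4 * r%:R) <= eta / 4.
    by rewrite ler_wpM2l ?(ltW eta0)// lef_pV2 ?posrE ?mulr_gt0 ?ltr0n// ler_peMr.
  by lra.
rewrite /C2; apply: (@le_trans _ _ (2 * (2 * w1) `^ (kap - 1) * (A a) `^ (kap - 1) *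
   \sum_(b <- F | ~~ slab h0 a b)
    (A b) `^ (- (kap * (r%:R - 1))) * `|lam b - lam a| `^ (- kap))); last first.
  rewrite [leRHS]mulrAC; apply: ler_wpM2l; [by nonneg|exact: far_sum_le].
rewrite mulr_sumr big_mkcond [leRHS]big_mkcond; apply: ler_sum => b _.
case: ifPn => [/andP[/andP[ba ab] ->]|_]; last first.
  by case: ifP => // _; nonneg.
have hl : `|lam b - lam a| <= 2 * w1 * A a.
  apply: (le_trans (lam_dist_le a b)); rewrite [2 * _]mulrC -mulrA ler_wpM2l//; move: ab; lra.
have w20 : 0 <= 2 * w1 by nonneg.
have := ker_far S ba hl; rewrite powRM ?w20 ?(ltW (A0 a))// => h.
apply: (le_trans (ler_wpM2r (powR_ge0 _ _) h)).
have e : (A b) `^ (- s) <= (A b) `^ (- (kap * (r%:R - 1))).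
  by apply: ler_powR => //; have := kq1; have := qs; have := eta0; lra.
have -> : 2 * ((2 * w1) `^ (kap - 1) * (A a) `^ (kap - 1)) * `|lam b - lam a| `^ (- kap) * (A b) `^ (- s)
  = 2 * (2 * w1) `^ (kap - 1) * (A a) `^ (kap - 1) * ((A b) `^ (- s) * `|lam b - lam a| `^ (- kap)) by ring.
apply: ler_wpM2l; first by nonneg.
by rewrite ler_wpM2r ?powR_ge0.
Qed.

(** The weights [A a `^ - q] and [S `^ (1/2 - q/s) * A b `^ - s] are those for
    which both Schur sums have the same order [sqrt S]. *)
Theorem offdiagonal_form_le : exists2 C : R, 0 <= C &
  forall F (p : 'rV[int]_r -> R) (S : R), uniq F -> (forall a, 0 <= p a) -> 1 <= S ->
  \sum_(a <- F) \sum_(b <- F | b != a) p a * p b * Num.min S (2 / `|freq_dot b w - freq_dot a w|)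
  <= C * Num.sqrt S * \sum_(a <- F) (1 + mi_norm a) `^ (r%:R - 1 + eta) * p a ^+ 2.
Proof.
have [C1 C10 hC1] := kernel_upper; have [C2 C20 hC2] := kernel_lower.
exists (C1 + C2) => [|F p S uF p0 S1]; first exact: addr_ge0.
have S0 := lt_le_trans ltr01 S1.
pose X := \sum_(a <- F) (A a) `^ s * p a ^+ 2.
pose H := \sum_(a <- F) \sum_(b <- F | (b != a) && (nrm b <= nrm a)) p a * p b * ker S a b.
have hH : H <= (C1 + C2) / 2 * Num.sqrt S * X.
  pose Q a := (A a) `^ (- q); pose P b := S `^ (2^-1 - q / s) * (A b) `^ (- s).
  have Q0 a : 0 < Q a by rewrite powR_gt0.
  have P0 b : 0 < P b by rewrite mulr_gt0 ?powR_gt0.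
  have young a b : p a * p b * ker S a b <=
     2^-1 * (p a ^+ 2 / Q a * (ker S a b * P b)) + 2^-1 * (p b ^+ 2 / P b * (ker S a b * Q a)).
    rewrite -subr_ge0.
    have -> : 2^-1 * (p a ^+ 2 / Q a * (ker S a b * P b)) + 2^-1 * (p b ^+ 2 / P b * (ker S a b * Q a)) -
      p a * p b * ker S a b = ker S a b / (2 * Q a * P b) * (p a * P b - p b * Q a) ^+ 2.
      by field; rewrite !gt_eqF.
    have QP0 : 0 < 2 * Q a * P b by rewrite mulr_gt0// mulr_gt0.
    by rewrite mulr_ge0 ?sqr_ge0// divr_ge0 ?(ltW QP0)// ker_ge0 ?(ltW S0).
  apply: (@le_trans _ _ (\sum_(a <- F) \sum_(b <- F | (b != a) && (nrm b <= nrm a))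
     (2^-1 * (p a ^+ 2 / Q a * (ker S a b * P b)) + 2^-1 * (p b ^+ 2 / P b * (ker S a b * Q a))))).
    by apply: ler_sum => a _; apply: ler_sum => b _.
  under eq_bigr do rewrite big_split /=.
  rewrite big_split /= addrC.
  have -> : (C1 + C2) / 2 * Num.sqrt S * X =
     2^-1 * (C1 * Num.sqrt S * X) + 2^-1 * (C2 * Num.sqrt S * X) by field.
  have sqrtE : Num.sqrt S = S `^ 2^-1 by rewrite powR12_sqrt// ltW.
  apply: lerD.
    rewrite (exchange_big_dep xpredT)//= /X !mulr_sumr; apply: ler_sum => b _.
    rewrite -mulr_sumr ler_wpM2l// -mulr_sumr.
    apply: (@le_trans _ _ (p b ^+ 2 / P b * (C1 * S `^ (1 - q / s)))).
      rewrite ler_wpM2l ?divr_ge0 ?sqr_ge0 ?(ltW (P0 b))//.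
      apply: le_trans (hC1 F S b uF S1).
      under eq_bigl do rewrite eq_sym.
      by under eq_bigr do rewrite ker_sym.
    have -> : S `^ (1 - q / s) = S `^ 2^-1 * S `^ (2^-1 - q / s).
      rewrite -powRD ?(gt_eqF S0) ?implybT//; congr (_ `^ _).
      by have : (2^-1 + 2^-1 : R) = 1 by [rewrite -mulr2n -[_ *+ 2]mulr_natl divff// pnatr_eq0]; lra.
    rewrite sqrtE /P powRN; apply: eq_ler; field.
    by rewrite !gt_eqF ?powR_gt0.
  rewrite /X !mulr_sumr; apply: ler_sum => a _.
  rewrite -mulr_sumr ler_wpM2l// -mulr_sumr.
  have -> : \sum_(b <- F | (b != a) && (nrm b <= nrm a)) ker S a b * P b =
     S `^ (2^-1 - q / s) * \sum_(b <- F | (b != a) && (nrm b <= nrm a)) ker S a b * (A b) `^ (- s).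
    by rewrite mulr_sumr; apply: eq_bigr => b _; rewrite /P mulrCA.
  apply: (@le_trans _ _ (p a ^+ 2 / Q a * (S `^ (2^-1 - q / s) * (C2 * S `^ (q / s) * (A a) `^ (s - q))))).
    rewrite ler_wpM2l ?divr_ge0 ?sqr_ge0 ?(ltW (Q0 a))// ler_wpM2l ?powR_ge0//.
    exact: hC2.
  have e1 : Num.sqrt S = S `^ (2^-1 - q / s) * S `^ (q / s).
    by rewrite sqrtE -powRD ?(gt_eqF S0) ?implybT// subrK.
  have e2 : (A a) `^ s = (A a) `^ (s - q) * (A a) `^ q.
    by rewrite -powRD ?(gt_eqF (A0 a)) ?implybT// subrK.
  rewrite e1 e2 /Q powRN; apply: eq_ler; field.
  by rewrite !gt_eqF ?powR_gt0.
apply: (@le_trans _ _ (H + H)); last first.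
  by rewrite -/X; move: hH; lra.
have HE : H = \sum_(a <- F) \sum_(b <- F | (b != a) && (nrm a <= nrm b)) p a * p b * ker S a b.
  rewrite /H (exchange_big_dep xpredT)//=; apply: eq_bigr => a _.
  by apply: eq_big => [b|b _]; rewrite ?(eq_sym a)// ker_sym (mulrC (p b)).
rewrite {2}HE /H -big_split /=; apply: ler_sum => a _.
rewrite [X in _ <= X + _]big_mkcond [X in _ <= _ + X]big_mkcond [leLHS]big_mkcond -big_split /=.
apply: ler_sum => b _; case: (b != a) => /=; last by rewrite addr0.
have k0 : 0 <= p a * p b * ker S a b by rewrite !mulr_ge0 ?ker_ge0// ltW.
have [ba|/ltW ->] := leP (nrm b) (nrm a); first by case: ifP => _; rewrite -/(ker S a b); lra.
by rewrite add0r.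
Qed.

End small_denominators.

(** * Double and trigonometric integrals *)

Section fubini.
Context {R : realType}.
Notation mu := (@lebesgue_measure R).
Notation RR := (measurableTypeR R).

(** Fubini for the function extended by zero outside the triangle. *)
Lemma fubini_triangle (S M : R) (h : RR * RR -> RR) :
  measurable_fun setT h -> (forall x, `|h x| <= M) ->
  \int[mu]_(x in `[0, S]) \int[mu]_(y in `[0, x]) h (x, y) =
  \int[mu]_(y in `[0, S]) \int[mu]_(x in `[y, S]) h (x, y) /\
  bmeas 0 S (fun y => \int[mu]_(x in `[y, S]) h (x, y)).
Proof.
move=> mh hM.
pose A : set (RR * RR) := [set p | (0 <= p.2) && (p.2 <= p.1) && (p.1 <= S)].
have mA : measurable A.
  have m1 : measurable_fun setT (fun p : RR * RR => (0 <= p.2) && (p.2 <= p.1) && (p.1 <= S)).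
    apply: measurable_and; first apply: measurable_and.
    - by apply: measurable_fun_ler => //; exact: measurable_snd.
    - by apply: measurable_fun_ler; [exact: measurable_snd|exact: measurable_fst].
    - by apply: measurable_fun_ler => //; exact: measurable_fst.
  have := m1 measurableT [set true] I; rewrite setTI.
  by congr (measurable _); apply/seteqP; split => p /=.
pose F : RR * RR -> \bar R := EFin \o (h \_ A).
have AS : A `<=` `[0, S] `*` `[0, S].
  move=> p /= /andP[/andP[p2 p12] p1S]; rewrite !in_itv /= p2 p1S (le_trans p2 p12).
  by rewrite (le_trans p12).
have finA : ((mu \x mu) A < +oo)%E.
  apply: (@le_lt_trans _ _ ((mu \x mu)%E (`[0, S]%classic `*` `[0, S]%classic))).
    by apply: le_measure; rewrite ?inE//; exact: measurableX.
  rewrite product_measure1E//= lebesgue_measure_itv /=.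
  by case: ifP => _; rewrite ?mul0e// -EFinD -EFinM ltry.
have iF : (mu \x mu)%E.-integrable setT F.
  rewrite /F -restrict_EFin -(@integrable_mkcond _ _ _ (mu \x mu)%E A)//.
  apply: measurable_bounded_integrable => //; first exact: measurable_funTS.
  exists M; split; first exact: num_real.
  by move=> x Mx p _ /=; apply: (le_trans (hM p)); exact: ltW.
have hx x : bmeas 0 x (fun y => h (x, y)).
  split; last by exists M => y _; exact: hM.
  apply: (@measurable_funS _ _ _ _ setT) => //.
  exact: (measurableT_comp mh (pair1_measurable x)).
have hy y : bmeas y S (fun x => h (x, y)).
  split; last by exists M => x _; exact: hM.
  apply: (@measurable_funS _ _ _ _ setT) => //.
  exact: (measurableT_comp mh (pair2_measurable y)).
have e1 : \int[mu]_(x in `[0, S]) \int[mu]_(y in `[0, x]) h (x, y) =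
    fine (\int[mu]_x \int[mu]_y F (x, y))%E.
  congr fine; rewrite integral_mkcond; apply: eq_integral => x _.
  rewrite patchE; case: ifPn => xS.
    rewrite /Rintegral fineK; last exact: (integrable_fin_num _ (bmeas_integrable (hx x))).
    rewrite integral_mkcond; apply: eq_integral => y _.
    rewrite /F /= !patchE; move: xS; rewrite !inE/= in_itv/= => /andP[x0 xS].
    have -> : (y \in `[0, x]%classic) = ((x, y) \in A).
      apply/idP/idP; rewrite !inE /A /= in_itv /=.
        by move=> /andP[-> ->]; rewrite xS.
      by move=> /andP[/andP[-> ->]].
    by case: ifP.
  rewrite integral0_eq// => y _; rewrite /F /= patchE; case: ifPn => //.
  rewrite inE /A /= => /andP[/andP[y0 yx] xS']; case/negP: xS.
  by rewrite inE/= in_itv/= xS' (le_trans y0 yx).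
have section_y y : y \in `[0, S]%classic ->
    (\int[mu]_(x in `[y, S]) h (x, y))%:E = (\int[mu]_x F (x, y))%E.
  move=> yS; rewrite /Rintegral fineK; last exact: (integrable_fin_num _ (bmeas_integrable (hy y))).
  rewrite integral_mkcond; apply: eq_integral => x _.
  rewrite /F /= !patchE; move: yS; rewrite !inE/= in_itv/= => /andP[y0 yS].
  have -> : (x \in `[y, S]%classic) = ((x, y) \in A).
    apply/idP/idP; rewrite !inE /A /= in_itv /=.
      by move=> /andP[-> ->]; rewrite y0.
    by move=> /andP[/andP[_ ->] ->].
  by case: ifP.
have e2 : \int[mu]_(y in `[0, S]) \int[mu]_(x in `[y, S]) h (x, y) =
    fine (\int[mu]_y \int[mu]_x F (x, y))%E.
  congr fine; rewrite integral_mkcond; apply: eq_integral => y _.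
  rewrite patchE; case: ifPn => yS; first exact: section_y.
  rewrite integral0_eq// => x _; rewrite /F /= patchE; case: ifPn => //.
  rewrite inE /A /= => /andP[/andP[y0 yx] xS']; case/negP: yS.
  by rewrite inE/= in_itv/= y0 (le_trans yx xS').
split; first by rewrite e1 e2 (Fubini iF).
split; last first.
  exists (M * S) => y /andP[y0 yS]; apply: (@le_trans _ _ (M * (S - y))).
    by apply: integral_bound => //; exact: hy.
  rewrite ler_wpM2l ?gerBl//; exact: le_trans (hM (0, 0)).
apply: (eq_measurable_fun (fun y => fine (\int[mu]_x F (x, y))%E)) => [y yS|].
  by rewrite -section_y.
apply: measurable_funTS; apply: measurableT_comp => //.
exact: (measurable_fubini_G iF).
Qed.
End fubini.

Section trigonometric.
Context {R : realType}.
Notation mu := (@lebesgue_measure R).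
Notation Re := complex.Re.
Notation Im := complex.Im.

Definition cis (x : R) : R[i] := (cos x +i* sin x)%C.

Lemma Re_cis x : Re (cis x) = cos x. Proof. by []. Qed.
Lemma Im_cis x : Im (cis x) = sin x. Proof. by []. Qed.
Lemma nsq_cis x : nsq (cis x) = 1. Proof. by rewrite /nsq Re_cis Im_cis cos2Dsin2. Qed.
Lemma cabs_cis x : cabs (cis x) = 1. Proof. by rewrite cabsE nsq_cis sqrtr1. Qed.
Lemma cisD x y : cis (x + y) = cis x * cis y.
Proof. by apply: complexP; rewrite !cE ?Re_cis ?Im_cis ?cosD ?sinD//; ring. Qed.
Lemma cisN x : cis (- x) = conjc (cis x).
Proof. by apply: complexP; rewrite !cE ?Re_cis ?Im_cis ?cosN ?sinN. Qed.
Lemma cis0 : cis 0 = 1.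
Proof. by apply: complexP; rewrite ?Re_cis ?Im_cis ?cos0 ?sin0. Qed.

Lemma cexp_imag x : cexp (imag * ofR x) = cis x.
Proof.
have hr : Re (imag * ofR x) = 0 by rewrite !cE; ring.
have hi : Im (imag * ofR x) = x by rewrite !cE; ring.
by rewrite /cexp hr hi expR0 ofR1 mul1r.
Qed.

Lemma is_derive_cosM (l t : R) : is_derive t 1 (fun s : R => cos (l * s)) (- (l * sin (l * t))).
Proof.
have := is_derive1_comp (is_derive_cos (l * t)) (is_derive_scale l t).
by move=> h; apply: is_derive_eq h _; ring.
Qed.

Lemma is_derive_sinM (l t : R) : is_derive t 1 (fun s : R => sin (l * s)) (l * cos (l * t)).
Proof.
have := is_derive1_comp (is_derive_sin (l * t)) (is_derive_scale l t).
by move=> h; apply: is_derive_eq h _; ring.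
Qed.

Lemma is_derive_ext (f g : R -> R) (t d d' : R) :
  is_derive t 1 f d -> f =1 g -> d = d' -> is_derive t 1 g d'.
Proof. by move=> h /funext <- <-. Qed.

Lemma continuous_derive (f f' : R -> R) : (forall t : R, is_derive t 1 f (f' t)) -> continuous f.
Proof.
move=> h t; apply: differentiable_continuous; apply/derivable1_diffP.
by have [] := h t.
Qed.

Lemma continuous_sum (I : Type) (F : seq I) (f : I -> R -> R) :
  (forall i, continuous (f i)) -> continuous (fun t => \sum_(i <- F) f i t).
Proof.
move=> cf; elim: F => [|i F IH].
  have -> : (fun t => \sum_(i <- [::]) f i t) = fun=> 0 by apply/funext => t; rewrite big_nil.
  by move=> t; exact: cvg_cst.
have -> : (fun t => \sum_(j <- i :: F) f j t) = fun t => f i t + \sum_(j <- F) f j t.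
  by apply/funext => t; rewrite big_cons.
by move=> t; apply: cvgD; [exact: cf|exact: IH].
Qed.

Lemma continuous_cosM (l : R) : continuous (fun t : R => cos (l * t)).
Proof. exact: continuous_derive (is_derive_cosM l). Qed.
Lemma continuous_sinM (l : R) : continuous (fun t : R => sin (l * t)).
Proof. exact: continuous_derive (is_derive_sinM l). Qed.
Lemma continuous_expRM (l : R) : continuous (fun t : R => expR (l * t)).
Proof. exact: continuous_derive (is_derive_expRM l). Qed.

Lemma continuous_bmeas a b (f : R -> R) : continuous f -> bmeas a b f.
Proof. by move=> cf; apply: bmeas_continuous; exact: continuous_subspaceT. Qed.

Lemma continuous_Re_cis (z : R[i]) (l : R) : continuous (fun t : R => Re (z * cis (l * t))).
Proof.
have -> : (fun t : R => Re (z * cis (l * t))) =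
    (fun t => Re z * cos (l * t) - Im z * sin (l * t)).
  by apply/funext => t; rewrite ReM Re_cis Im_cis.
move=> t; apply: cvgB; apply: cvgM; try exact: cvg_cst.
  exact: continuous_cosM.
exact: continuous_sinM.
Qed.

Lemma integral_Re_cis_le (z : R[i]) (l s S : R) : 0 <= s <= S -> l != 0 ->
  `|\int[mu]_(t in `[s, S]) Re (z * cis (l * t))| <= cabs z * Num.min S (2 / `|l|).
Proof.
move=> /andP[s0 sS] l0.
have zc t : `|Re (z * cis (l * t))| <= cabs z.
  by apply: (le_trans (Re_le_cabs _)); rewrite cabsM cabs_cis mulr1.
have zs t : `|Im (z * cis (l * t))| <= cabs z.
  by apply: (le_trans (Im_le_cabs _)); rewrite cabsM cabs_cis mulr1.
have h1 : `|\int[mu]_(t in `[s, S]) Re (z * cis (l * t))| <= cabs z * S.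
  apply: (@le_trans _ _ (cabs z * (S - s))).
    by apply: integral_bound => //; apply: continuous_bmeas; exact: continuous_Re_cis.
  by rewrite ler_wpM2l ?cabs_ge0// gerBl.
have h2 : `|\int[mu]_(t in `[s, S]) Re (z * cis (l * t))| <= cabs z * (2 / `|l|).
  have dX (t : R) : is_derive t 1 (fun t => l^-1 * Im (z * cis (l * t))) (Re (z * cis (l * t))).
    have := is_deriveZ l^-1 (is_deriveD (is_deriveZ (Re z) (is_derive_sinM l t))
      (is_deriveZ (Im z) (is_derive_cosM l t))).
    move=> h; apply: (is_derive_ext h) => [u|].
      by rewrite !cE ?Re_cis ?Im_cis.
    by rewrite !cE ?Re_cis ?Im_cis /GRing.scale /=; field.

  have p := primitive_derivable S dX (@continuous_Re_cis z l).
  rewrite -(primitive_incr p s0 sS (lexx S)) -mulrBr normrM normfV.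
  rewrite mulrA mulrC ler_wpM2r ?invr_ge0//.
  apply: (le_trans (ler_normB _ _)).
  have := zs S; have := zs s; lra.
by rewrite /Num.min; case: ifP.
Qed.

Lemma integral_decay_le (g b : R) : 0 < g -> 0 <= b ->
  \int[mu]_(s in `[0, b]) expR (- g * s) <= g^-1.
Proof.
move=> g0 b0.
have dX (t : R) : is_derive t 1 (fun t => - g^-1 * expR (- g * t)) (expR (- g * t)).
  have := is_deriveZ (- g^-1) (is_derive_expRM (- g) t).
  move=> h; apply: (is_derive_ext h) => [//|]; rewrite /GRing.scale /=; field.
  by rewrite gt_eqF.
have p := primitive_derivable b dX (@continuous_expRM (- g)).
rewrite -(primitive_incr p (lexx 0) b0 (lexx b)) mulr0 expR0.
have := expR_ge0 (- g * b); have : 0 <= g^-1 by rewrite invr_ge0 ltW.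
nra.
Qed.

(** The Laplace transform of [cos], truncated linearly at [S]. *)
Lemma integral_decay_cos_le (g om S : R) : 0 < g -> 0 <= S ->
  `|\int[mu]_(s in `[0, S]) (expR (- g * s) * ((S - s) * cos (om * s)))
    - S * (g / (g ^+ 2 + om ^+ 2))| <= 2 / g ^+ 2.
Proof.
move=> g0 S0; pose D := g ^+ 2 + om ^+ 2.
have D0 : 0 < D by rewrite ltr_pwDl ?exprn_gt0 ?sqr_ge0.
(* Two integrations by parts lead to the primitive [X]. *)
pose x s := - (S - s) * (g / D) + (g ^+ 2 - om ^+ 2) / D ^+ 2.
pose y s := (S - s) * (om / D) - 2 * g * om / D ^+ 2.
pose X s := expR (- g * s) * (cos (om * s) * x s + sin (om * s) * y s).
have dlin (c d t : R) : is_derive t 1 (fun s : R => (S - s) * c + d) (- c).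
  have := is_deriveD (is_deriveZ (- c) (is_derive_id t 1)) (is_derive_cst (S * c + d) t 1).
  move=> h; apply: (is_derive_ext h) => [s|]; last by rewrite /GRing.scale /=; ring.
  have -> : (- c \*: id + cst (S * c + d)) s = - c * s + (S * c + d) by [].
  by ring.
have dx (t : R) : is_derive t 1 x (g / D).
  apply: (is_derive_ext (dlin (- (g / D)) ((g ^+ 2 - om ^+ 2) / D ^+ 2) t)) => [s|].
    by rewrite /x; ring.
  by rewrite opprK.
have dy (t : R) : is_derive t 1 y (- (om / D)) by exact: dlin.
have dX (t : R) : is_derive t 1 X (expR (- g * t) * ((S - t) * cos (om * t))).
  have := is_deriveM (is_derive_expRM (- g) t)
    (is_deriveD (is_deriveM (is_derive_cosM om t) (dx t)) (is_deriveM (is_derive_sinM om t) (dy t))).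
  move=> h; apply: (is_derive_ext h) => [//|]; rewrite !fctE /GRing.scale /= /x /y /D; field.
  by rewrite gt_eqF.
have cY : continuous (fun t => expR (- g * t) * ((S - t) * cos (om * t))).
  move=> t; apply: cvgM; first exact: continuous_expRM.
  apply: cvgM; last exact: continuous_cosM.
  by apply: cvgB; [exact: cvg_cst|exact: cvg_id].
have p := primitive_derivable S dX cY.
rewrite -(primitive_incr p (lexx 0) S0 (lexx S)) /X !mulr0 expR0 cos0 sin0 mul0r addr0 !mul1r.
pose a := (g ^+ 2 - om ^+ 2) / D ^+ 2; pose b := 2 * g * om / D ^+ 2.
have -> : expR (- g * S) * (cos (om * S) * x S + sin (om * S) * y S) - x 0 - S * (g / (g ^+ 2 + om ^+ 2))
  = expR (- g * S) * (cos (om * S) * a - sin (om * S) * b) - a.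
  rewrite /x /y /a /b -/D; ring.
have ab : a ^+ 2 + b ^+ 2 = (D^-1) ^+ 2 by rewrite /a /b /D; field; rewrite gt_eqF.
have Di : 0 <= D^-1 by rewrite invr_ge0 ltW.
have sq_le (u v : R) : 0 <= v -> u ^+ 2 <= v ^+ 2 -> `|u| <= v.
  by move=> v0 uv; rewrite -(ger0_norm v0) -ler_sqr ?nnegrE// !real_normK ?num_real.
have ha : `|a| <= D^-1 by apply: sq_le => //; rewrite -ab lerDl sqr_ge0.
have hb : `|cos (om * S) * a - sin (om * S) * b| <= D^-1.
  apply: sq_le => //; rewrite -ab.
  have := cos2Dsin2 (om * S); have := sqr_ge0 (cos (om * S) * b + sin (om * S) * a).
  set c := cos _; set d := sin _ => h cs.
  have -> : a ^+ 2 + b ^+ 2 = (c ^+ 2 + d ^+ 2) * (a ^+ 2 + b ^+ 2) by rewrite cs mul1r.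
  rewrite -subr_ge0; apply: le_trans h _; apply: eq_ler; ring.
have hD : D^-1 <= (g ^+ 2)^-1 by rewrite lef_pV2 ?posrE ?exprn_gt0// lerDl sqr_ge0.
have e1 : expR (- g * S) <= 1 by rewrite -expR0 ler_expR mulNr oppr_le0 mulr_ge0// ltW.
apply: (le_trans (ler_normB _ _)); rewrite normrM (ger0_norm (expR_ge0 _)).
have : expR (- g * S) * `|cos (om * S) * a - sin (om * S) * b| <= 1 * D^-1.
  by apply: ler_pM => //; exact: expR_ge0.
by rewrite mul1r; lra.
Qed.

End trigonometric.

(** * Time averages of a correlation *)

Section averaging.
Context {R : realType} (r : nat) (w : 'rV[R]_r) (ph : 'rV[int]_r -> R[i]) (phi : R -> R).
Variables (M B C0 : R).
Notation mu := (@lebesgue_measure R).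
Notation Re := complex.Re.
Notation Im := complex.Im.
Notation lam := (fun a => freq_dot a w).
Implicit Types (F : {fset 'rV[int]_r}).

Hypotheses (mphi : measurable_fun setT phi) (phiM : forall t, `|phi t| <= M) (C00 : 0 <= C0).

Definition trig_sum F (t : R) : R[i] := \sum_(a <- F) ph a * cis (lam a * t).

Hypothesis phi_trig : forall S d : R, 0 < d -> exists F0, forall F, (F0 `<=` F)%fset ->
  \int[mu]_(t in `[0, S]) nsq (ofR (phi t) - trig_sum F t) <= d.
Hypothesis ph_sum : forall F, \sum_(a <- F) cabs (ph a) ^+ 2 <= B.
Hypothesis lam_inj : forall a b, b != a -> lam b - lam a != 0.
Hypothesis offdiag_le : forall F (S : R), 1 <= S ->
  \sum_(a <- F) \sum_(b <- F | b != a)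
    cabs (ph a) * cabs (ph b) * Num.min S (2 / `|lam b - lam a|) <= C0 * Num.sqrt S.

Let M0 : 0 <= M. Proof. exact: le_trans (phiM 0). Qed.
Let B0 : 0 <= B.
Proof. by apply: le_trans (ph_sum fset0); rewrite sumr_ge0// => a _; exact: sqr_ge0. Qed.

Let mtrig F : measurable_fun setT (fun t => Re (trig_sum F t)) /\
  measurable_fun setT (fun t => Im (trig_sum F t)).
Proof.
split.
  have -> : (fun t => Re (trig_sum F t)) = fun t => \sum_(a <- F) Re (ph a * cis (lam a * t)).
    by apply/funext => t; rewrite Re_sum.
  apply: measurable_sum => a; apply: continuous_measurable_fun; exact: continuous_Re_cis.
have -> : (fun t => Im (trig_sum F t)) = fun t => \sum_(a <- F) Re (- imag * ph a * cis (lam a * t)).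
  apply/funext => t; rewrite Im_sum; apply: eq_bigr => a _.
  by rewrite -mulrA; move: (ph a * _) => z; rewrite !cE; ring.
apply: measurable_sum => a; apply: continuous_measurable_fun; exact: continuous_Re_cis.
Qed.

Let K F : R := \sum_(a <- F) cabs (ph a).
Let trig_le F t : cabs (trig_sum F t) <= K F.
Proof.
apply: (le_trans (cabs_sum _ _ _)); apply: ler_sum => a _.
by rewrite cabsM cabs_cis mulr1.
Qed.

Let Ddist F t := nsq (ofR (phi t) - trig_sum F t).

Let mDdist F : measurable_fun setT (Ddist F).
Proof.
have [m1 m2] := mtrig F.
have -> : Ddist F = fun t => (phi t - Re (trig_sum F t)) ^+ 2 + (- Im (trig_sum F t)) ^+ 2.
  by apply/funext => t; rewrite /Ddist /nsq !cE add0r.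
apply: measurable_funD; apply: measurable_funX; first exact: measurable_funB.
exact: measurable_funN.
Qed.

Let Ddist_le F t : Ddist F t <= 2 * M ^+ 2 + 2 * K F ^+ 2.
Proof.
apply: (le_trans (nsqB_le _ _)); apply: lerD; rewrite ler_wpM2l//.
  by rewrite nsq_ofR -(real_normK (num_real (phi t))) ler_pXn2r ?nnegrE.
by rewrite -cabs_sqr ler_pXn2r ?nnegrE ?cabs_ge0// (le_trans (cabs_ge0 _) (trig_le F t)).
Qed.

Let bDdist F a b : bmeas a b (Ddist F).
Proof.
split; first exact: measurable_funS (mDdist F).
by exists (2 * M ^+ 2 + 2 * K F ^+ 2) => t _; rewrite ger0_norm ?nsq_ge0.
Qed.

Let bDdist_shift F a b s : bmeas a b (fun t => Ddist F (t - s)).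
Proof.
split.
  apply: (@measurable_funS _ _ _ _ setT) => //.
  by apply: (measurableT_comp (mDdist F)); exact: measurable_funB.
by exists (2 * M ^+ 2 + 2 * K F ^+ 2) => t _; rewrite ger0_norm ?nsq_ge0.
Qed.

Let bphi a b : bmeas a b phi.
Proof. by split; [exact: measurable_funS mphi|exists M]. Qed.

Let bphi_shift a b s : bmeas a b (fun t => phi (t - s)).
Proof.
split; last by exists M.
apply: (@measurable_funS _ _ _ _ setT) => //.
by apply: (measurableT_comp mphi); exact: measurable_funB.
Qed.

(** Replacing [phi] by a trigonometric sum in a product costs only the mean
    square distance. *)
Let product_dist (c X Y : R[i]) (x y k : R) : cabs c = 1 -> 0 < k -> `|x| <= M -> `|y| <= M ->
  `|Re c * (x * y) - Re (c * (conjc X * Y))| <=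
  M * k + (M / k + 1) * (nsq (ofR x - X) + nsq (ofR y - Y)).
Proof.
move=> c1 k0 xM yM.
set dx := ofR x - X; set dy := ofR y - Y.
have -> : Re c * (x * y) - Re (c * (conjc X * Y)) =
    Re (c * (ofR x * dy + ofR y * conjc dx - conjc dx * dy)).
  by rewrite /dx /dy !cE; ring.
apply: (le_trans (Re_le_cabs _)); rewrite cabsM c1 mul1r.
apply: (@le_trans _ _ (M * cabs dy + M * cabs dx + cabs dx * cabs dy)).
  apply: (le_trans (cabs_triangle _ _)); rewrite cabsN cabsM cabs_conj lerD2r.
  apply: (le_trans (cabs_triangle _ _)); rewrite !cabsM cabs_conj !cabs_ofR.
  by apply: lerD; rewrite ler_wpM2r ?cabs_ge0.
have h (d : R) : 0 <= d -> d <= k / 2 + d ^+ 2 / k.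
  move=> d0; rewrite -subr_ge0.
  have -> : k / 2 + d ^+ 2 / k - d = ((d - k / 2) ^+ 2 + k ^+ 2 / 4) / k by field; rewrite gt_eqF.
  by rewrite divr_ge0 ?(ltW k0)// addr_ge0 ?sqr_ge0// divr_ge0 ?sqr_ge0.
rewrite -!cabs_sqr; have hx := h _ (cabs_ge0 dx); have hy := h _ (cabs_ge0 dy).
have hx' := ler_wpM2l M0 hx; have hy' := ler_wpM2l M0 hy.
have := sqr_ge0 (cabs dx - cabs dy); have := sqr_ge0 (cabs dx); have := sqr_ge0 (cabs dy).
have -> : (M / k + 1) * (cabs dx ^+ 2 + cabs dy ^+ 2) =
  M * (cabs dx ^+ 2 / k) + M * (cabs dy ^+ 2 / k) + cabs dx ^+ 2 + cabs dy ^+ 2 by ring.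
move: hx' hy'; rewrite !mulrDr sqrrB; set a := M * (k / 2).
have -> : M * k = a + a by rewrite /a; field.
lra.
Qed.

Let corr (nu s : R) t := cos (nu * s) * (phi t * phi (t - s)).

Let bcorr nu s a b : bmeas a b (corr nu s).
Proof. by apply: bmeasZ; apply: bmeasM. Qed.

Let corrF F nu s t := Re (cis (- (nu * s)) * (conjc (trig_sum F t) * trig_sum F (t - s))).

Let corrFE F nu s t : corrF F nu s t =
  \sum_(a <- F) \sum_(b <- F)
    Re (cis (- (nu * s)) * (conjc (ph a) * ph b) * cis (- (lam b * s)) * cis ((lam b - lam a) * t)).
Proof.
rewrite /corrF /trig_sum.
have -> : conjc (\sum_(a <- F) ph a * cis (lam a * t)) = \sum_(a <- F) conjc (ph a) * cis (- (lam a * t)).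
  rewrite (big_morph _ (@rmorphD _ _ (@conjc R)) (@rmorph0 _ _ (@conjc R))).
  by apply: eq_bigr => a _; rewrite rmorphM /= cisN.
rewrite mulr_suml mulr_sumr Re_sum; apply: eq_bigr => a _.
rewrite !mulr_sumr Re_sum; apply: eq_bigr => b _; congr Re.
have -> : lam b * (t - s) = lam b * t + - (lam b * s) by ring.
have -> : (lam b - lam a) * t = lam b * t + - (lam a * t) by ring.
by rewrite !cisD; ring.
Qed.

Let bcorrF F nu s a b : bmeas a b (corrF F nu s).
Proof.
apply: (bmeas_ext (fun t _ => esym (corrFE F nu s t))).
apply: bmeas_sum => c _; apply: bmeas_sum => d _.
by apply: continuous_bmeas; exact: continuous_Re_cis.
Qed.

Let diag_sum F nu s := \sum_(a <- F) cabs (ph a) ^+ 2 * cos ((nu + lam a) * s).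

(** The diagonal terms have constant integrands; the others oscillate, and add up to
    the off-diagonal form. *)
Let corrF_le F nu s S : 0 <= s <= S ->
  `|\int[mu]_(t in `[s, S]) corrF F nu s t - (S - s) * diag_sum F nu s| <= C0 * Num.sqrt (1 + S).
Proof.
move=> /andP[s0 sS].
pose z a b := cis (- (nu * s)) * (conjc (ph a) * ph b) * cis (- (lam b * s)).
have bz a b c d : bmeas c d (fun t => Re (z a b * cis ((lam b - lam a) * t))).
  by apply: continuous_bmeas; exact: continuous_Re_cis.
have -> : \int[mu]_(t in `[s, S]) corrF F nu s t =
    \sum_(a <- F) \sum_(b <- F) \int[mu]_(t in `[s, S]) Re (z a b * cis ((lam b - lam a) * t)).
  rewrite (integral_ext (fun t _ => corrFE F nu s t)) integral_sum//; last first.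
    by move=> a _; apply: bmeas_sum => b _; exact: bz.
  by apply: eq_bigr => a _; rewrite integral_sum// => b _; exact: bz.
have zaa a : Re (z a a) = cabs (ph a) ^+ 2 * cos ((nu + lam a) * s).
  have -> : z a a = ofR (cabs (ph a) ^+ 2) * cis (- ((nu + lam a) * s)).
    have -> : - ((nu + lam a) * s) = - (nu * s) + - (lam a * s) by ring.
    have -> : ofR (cabs (ph a) ^+ 2) = conjc (ph a) * ph a.
      by rewrite cabs_sqr; apply: complexP; rewrite /nsq !cE; ring.
    by rewrite cisD /z; ring.
  by rewrite ReM Re_ofR Im_ofR mul0r subr0 Re_cis cosN.
have -> : \sum_(a <- F) \sum_(b <- F) \int[mu]_(t in `[s, S]) Re (z a b * cis ((lam b - lam a) * t))
   - (S - s) * diag_sum F nu s =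
   \sum_(a <- F) \sum_(b <- F | b != a) \int[mu]_(t in `[s, S]) Re (z a b * cis ((lam b - lam a) * t)).
  rewrite /diag_sum mulr_sumr -sumrB; apply: eq_big_seq => a aF.
  rewrite (bigD1_seq a)//= subrr.
  rewrite (integral_ext (g := fun=> Re (z a a))); last first.
    by move=> t _; rewrite mul0r cis0 mulr1.
  by rewrite integral_cst// zaa; ring.
have S1 : 1 <= 1 + S by rewrite lerDl (le_trans s0).
apply: le_trans (offdiag_le F S1).
apply: (le_trans (ler_norm_sum _ _ _)); apply: ler_sum => a _.
apply: (le_trans (ler_norm_sum _ _ _)); apply: ler_sum => b ba.
have sS' : 0 <= s <= S by rewrite s0.
apply: (le_trans (integral_Re_cis_le _ sS' (lam_inj ba))).
have -> : cabs (z a b) = cabs (ph a) * cabs (ph b).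
  by rewrite /z !cabsM !cabs_cis cabs_conj mul1r mulr1.
rewrite ler_wpM2l ?mulr_ge0 ?cabs_ge0// le_min !ge_min lexx /= orbT.
by rewrite lerDr ler01.
Qed.

(** The set [F] may depend on [S], so that the approximation of [phi] costs nothing. *)
Let correlation_le nu S d : 0 <= S -> 0 < d -> exists F0, forall F, (F0 `<=` F)%fset ->
  forall s, 0 <= s <= S ->
  `|\int[mu]_(t in `[s, S]) corr nu s t - (S - s) * diag_sum F nu s| <= C0 * Num.sqrt (1 + S) + d.
Proof.
move=> S0 d0.
pose k := d / (2 * (M + 1) * (S + 1)).
have k0 : 0 < k by rewrite divr_gt0// !mulr_gt0// ltr_wpDl.
pose d1 := d / (4 * (M / k + 1)).
have Mk : 0 < M / k + 1 by rewrite ltr_wpDl// divr_ge0// ltW.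
have d10 : 0 < d1 by rewrite divr_gt0// mulr_gt0.
have [F0 hF0] := phi_trig S d10; exists F0 => F F0F s sS.
have /andP[s0 sS'] := sS.
have hD : \int[mu]_(t in `[0, S]) Ddist F t <= d1 by exact: hF0.
have hD1 : \int[mu]_(t in `[s, S]) Ddist F t <= d1.
  apply: le_trans hD; rewrite (integral_itvD sS (bDdist F 0 S)) lerDr.
  by apply: Rintegral_ge0 => t _; exact: nsq_ge0.
have hD2 : \int[mu]_(t in `[s, S]) Ddist F (t - s) <= d1.
  rewrite integral_translate// subrr; apply: le_trans hD.
  have SS : 0 <= S - s <= S by rewrite subr_ge0 sS' gerBl.
  rewrite (integral_itvD SS (bDdist F 0 S)) lerDl.
  by apply: Rintegral_ge0 => t _; exact: nsq_ge0.
have hc : `|\int[mu]_(t in `[s, S]) corr nu s t - \int[mu]_(t in `[s, S]) corrF F nu s t| <= d.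
  rewrite -integralB//.
  apply: (le_trans (le_normr_Rintegral _ _)) => //.
    by apply: bmeas_integrable; exact: bmeasB.
  apply: (@le_trans _ _ (\int[mu]_(t in `[s, S])
     (M * k + (M / k + 1) * (Ddist F t + Ddist F (t - s))))).
    apply: integral_le; first by apply: bmeas_norm; exact: bmeasB.
      by apply: bmeasD; [exact: bmeas_cst|apply: bmeasZ; exact: bmeasD].
    move=> t _; have := @product_dist (cis (- (nu * s))) (trig_sum F t) (trig_sum F (t - s)) (phi t) (phi (t - s)) k.
    by rewrite cabs_cis Re_cis cosN; exact.
  rewrite integralD; [|exact: bmeas_cst|by apply: bmeasZ; exact: bmeasD].
  rewrite integral_cst// integralZ; last exact: bmeasD.
  rewrite integralD//.
  have h1 : M * k * (S - s) <= d / 2.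
    apply: (@le_trans _ _ ((M + 1) * k * (S + 1))).
      apply: ler_pM => //; first by rewrite mulr_ge0// ltW.
      - by rewrite subr_ge0.
      - by rewrite ler_wpM2r ?(ltW k0)// lerDl.
      - lra.
    rewrite /k; apply: eq_ler; field.
    by rewrite !gt_eqF// ltr_wpDl.
  have h2 : (M / k + 1) * (\int[mu]_(t in `[s, S]) Ddist F t + \int[mu]_(t in `[s, S]) Ddist F (t - s)) <= d / 2.
    apply: (@le_trans _ _ ((M / k + 1) * (d1 + d1))).
      by rewrite ler_wpM2l ?(ltW Mk)// lerD.
    rewrite /d1; move: Mk; set c := M / k + 1 => Mk.
    by apply: eq_ler; field; rewrite gt_eqF.
  lra.
have := corrF_le F nu sS; move: hc.
set u := \int[mu]_(t in _) corr _ _ _; set v := \int[mu]_(t in _) corrF _ _ _ _; set x := _ * diag_sum _ _ _.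
move=> h1 h2; have -> : u - x = (v - x) + (u - v) by ring.
by apply: (le_trans (ler_normD _ _)); exact: lerD.
Qed.

Variables (g nu E : R).
Hypothesis g0 : 0 < g.
Hypothesis E_lim : forall d : R, 0 < d -> exists F0, forall F, (F0 `<=` F)%fset ->
  `|\sum_(a <- F) cabs (ph a) ^+ 2 * (g / (g ^+ 2 + (nu + lam a) ^+ 2)) - E| <= d.

(** In this order the inner integral is a correlation of [phi] at lag [s]. *)
Let swap S : 0 <= S ->
  \int[mu]_(t in `[0, S]) \int[mu]_(s in `[0, t])
     (expR (- g * s) * cos (nu * s) * phi t * phi (t - s)) =
  \int[mu]_(s in `[0, S]) (expR (- g * s) * \int[mu]_(t in `[s, S]) corr nu s t) /\
  bmeas 0 S (fun s => expR (- g * s) * \int[mu]_(t in `[s, S]) corr nu s t).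
Proof.
move=> S0.
pose h (p : measurableTypeR R * measurableTypeR R) : measurableTypeR R :=
  expR (- g * `|p.2|) * cos (nu * p.2) * phi p.1 * phi (p.1 - p.2).
have m1 : measurable_fun setT (fun p : measurableTypeR R * measurableTypeR R => p.1 : R) by exact: measurable_fst.
have m2 : measurable_fun setT (fun p : measurableTypeR R * measurableTypeR R => p.2 : R) by exact: measurable_snd.
have mh : measurable_fun setT h.
  apply: measurable_funM; first apply: measurable_funM; first apply: measurable_funM.
  - apply: (measurableT_comp (f := expR)) => //; apply: measurable_funM => //.
    exact: measurableT_comp.
  - have mc : measurable_fun setT (fun t : R => cos (nu * t)).
      by apply: continuous_measurable_fun; exact: continuous_cosM.
    exact: (measurableT_comp mc m2).
  - exact: (measurableT_comp mphi m1).
  - by apply: (measurableT_comp mphi); exact: measurable_funB.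
have hM p : `|h p| <= M ^+ 2.
  rewrite /h !normrM expr2 -[leRHS]mul1r mulrA; apply: ler_pM; rewrite ?mulr_ge0//.
  apply: ler_pM; rewrite ?mulr_ge0//.
  rewrite -[leRHS]mulr1; apply: ler_pM => //; last exact: cos_max.
  by rewrite ger0_norm ?expR_ge0// -expR0 ler_expR mulNr oppr_le0 mulr_ge0// ltW.
rewrite -(integral_ext (f := fun t => \int[mu]_(s in `[0, t]) h (t, s))); last first.
  move=> t _; apply: integral_ext => s /andP[s0 _].
  by rewrite /h /= ger0_norm.
have [eq b] := fubini_triangle S mh hM.
have hE s : 0 <= s <= S -> \int[mu]_(t in `[s, S]) h (t, s) =
    expR (- g * s) * \int[mu]_(t in `[s, S]) corr nu s t.
  move=> /andP[s0 sS]; rewrite -integralZ//; apply: integral_ext => t _.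
  by rewrite /h /corr /= ger0_norm// !mulrA.
by split; [rewrite eq; exact: integral_ext|exact: bmeas_ext hE b].
Qed.

(** The Laplace transform in the lag of the two parts of the correlation: the
    off-diagonal part costs [1 / g], the truncation of the diagonal one [1 / g ^ 2]. *)
Theorem averaging_le S : 0 <= S ->
  `|\int[mu]_(t in `[0, S]) \int[mu]_(s in `[0, t])
     (expR (- g * s) * cos (nu * s) * phi t * phi (t - s)) - S * E|
  <= C0 * Num.sqrt (1 + S) / g + 2 * B / g ^+ 2.
Proof.
move=> S0; have [-> bswap] := swap S0; set I0 := \int[mu]_(s in _) _.
apply/ler_addgt0Pr => d d0.
pose d1 := d * g / 2; pose d2 := d / (2 * (S + 1)).
have d10 : 0 < d1 by rewrite divr_gt0// mulr_gt0.
have d20 : 0 < d2 by rewrite divr_gt0// mulr_gt0// ltr_wpDl.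
have [F1 hF1] := correlation_le nu S0 d10.
have [F2 hF2] := E_lim d20.
pose F := (F1 `|` F2)%fset.
have h1 := hF1 F (fsubsetUl _ _); have h2 := hF2 F (fsubsetUr _ _).
pose J := \int[mu]_(s in `[0, S]) (expR (- g * s) * ((S - s) * diag_sum F nu s)).
have cdiag : continuous (fun s => expR (- g * s) * ((S - s) * diag_sum F nu s)).
  move=> s; apply: cvgM; first exact: continuous_expRM.
  apply: cvgM; first by apply: cvgB; [exact: cvg_cst|exact: cvg_id].
  apply: continuous_sum => a t; apply: cvgM; first exact: cvg_cst.
  exact: continuous_cosM.
have bJ : bmeas 0 S (fun s => expR (- g * s) * ((S - s) * diag_sum F nu s)).
  exact: continuous_bmeas.
have e1 : `|I0 - J| <= (C0 * Num.sqrt (1 + S) + d1) / g.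
  rewrite /I0 /J -(integralB bswap bJ).
  apply: (le_trans (le_normr_Rintegral _ _)) => //.
    exact: bmeas_integrable (bmeasB bswap bJ).
  apply: (@le_trans _ _ (\int[mu]_(s in `[0, S]) ((C0 * Num.sqrt (1 + S) + d1) * expR (- g * s)))).
    apply: integral_le.
    - exact: bmeas_norm (bmeasB bswap bJ).
    - by apply: bmeasZ; apply: continuous_bmeas; exact: continuous_expRM.
    - move=> s sS; rewrite -mulrBr normrM (ger0_norm (expR_ge0 _)) mulrC.
      by rewrite ler_wpM2r ?expR_ge0// h1.
  rewrite integralZ; last by apply: continuous_bmeas; exact: continuous_expRM.
  rewrite ler_wpM2l ?integral_decay_le// addr_ge0 ?(ltW d10)//.
  by rewrite mulr_ge0// sqrtr_ge0.
pose Y := \sum_(a <- F) cabs (ph a) ^+ 2 * (g / (g ^+ 2 + (nu + lam a) ^+ 2)).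
have e2 : `|J - S * Y| <= 2 * B / g ^+ 2.
  have b1 a : bmeas 0 S (fun s => expR (- g * s) * ((S - s) * cos ((nu + lam a) * s))).
    apply: continuous_bmeas => s; apply: cvgM; first exact: continuous_expRM.
    apply: cvgM; last exact: continuous_cosM.
    by apply: cvgB; [exact: cvg_cst|exact: cvg_id].
  have -> : J = \sum_(a <- F) cabs (ph a) ^+ 2 *
     \int[mu]_(s in `[0, S]) (expR (- g * s) * ((S - s) * cos ((nu + lam a) * s))).
    under eq_bigr do rewrite -integralZ//.
    rewrite -integral_sum//; last by move=> a _; exact: bmeasZ.
    apply: integral_ext => s _; rewrite /diag_sum !mulr_sumr; apply: eq_bigr => a _; ring.
  rewrite /Y mulr_sumr -sumrB; apply: (le_trans (ler_norm_sum _ _ _)).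
  apply: (@le_trans _ _ (\sum_(a <- F) cabs (ph a) ^+ 2 * (2 / g ^+ 2))).
    apply: ler_sum => a _; rewrite mulrCA -mulrBr normrM ger0_norm ?sqr_ge0//.
    by rewrite ler_wpM2l ?sqr_ge0// integral_decay_cos_le.
  rewrite -mulr_suml; have -> : 2 * B / g ^+ 2 = B * (2 / g ^+ 2) by ring.
  by rewrite ler_wpM2r// divr_ge0// sqr_ge0.
have e3 : `|S * Y - S * E| <= d / 2.
  rewrite -mulrBr normrM ger0_norm//; apply: (@le_trans _ _ ((S + 1) * d2)).
    by apply: ler_pM => //; rewrite lerDl.
  rewrite /d2; apply: eq_ler; field.
  by rewrite gt_eqF// ltr_wpDl.
have -> : I0 - S * E = (I0 - J) + (J - S * Y) + (S * Y - S * E) by ring.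
apply: (le_trans (ler_normD _ _)); apply: (le_trans (lerD (ler_normD _ _) (lexx _))).
have ed : d1 / g = d / 2 by rewrite /d1; field; rewrite gt_eqF.
move: e1; rewrite mulrDl ed; lra.
Qed.

End averaging.

(** * The response to the wave *)

Section scaling.
Context {R : realType}.
Notation mu := (@lebesgue_measure R).
Notation Re := complex.Re.
Notation Im := complex.Im.

(** Extension by zero, as measurability is only known on the interval. *)
Let cutoff (a b : R) (f : R -> R) t := if a <= t <= b then f t else 0.

Let measurable_cutoff a b f : bmeas a b f -> measurable_fun setT (cutoff a b f).
Proof.
move=> [mf _]; have -> : cutoff a b f = f \_ `[a, b].
  apply/funext => t; rewrite /cutoff patchE; case: ifPn => h.
    by rewrite mem_set//= in_itv.
  by rewrite memNset//= in_itv /= (negbTE h).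
exact/(measurable_restrictT f (measurable_itv _)).
Qed.

Lemma integral_scaleb (c x : R) f : 0 < c -> 0 <= x -> bmeas 0 (x / c) f ->
  \int[mu]_(t in `[0, x]) f (t / c) = c * \int[mu]_(t in `[0, x / c]) f t.
Proof.
move=> c0 x0 bf.
have e1 : forall t, 0 <= t <= x / c -> f t = cutoff 0 (x / c) f t by move=> t; rewrite /cutoff => ->.
rewrite (integral_ext e1) -integral_scale//; last 2 first.
- exact: measurable_cutoff.
- exact: bmeas_ext e1 bf.
apply: integral_ext => t /andP[t0 tx]; rewrite -e1//.
by rewrite divr_ge0 ?(ltW c0)//= ler_wpM2r ?invr_ge0 ?(ltW c0).
Qed.

Lemma bmeas_scale (c x : R) f : 0 < c -> bmeas 0 (x / c) f -> bmeas 0 x (fun t => f (t / c)).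
Proof.
move=> c0 bf; have [_ [M fM]] := bf.
have h t : 0 <= t <= x -> 0 <= t / c <= x / c.
  move=> /andP[t0 tx].
  by rewrite divr_ge0 ?(ltW c0)//= ler_wpM2r ?invr_ge0 ?(ltW c0).
have b : bmeas 0 x (fun t => cutoff 0 (x / c) f (t / c)).
  split; last first.
    by exists M => t /h th; rewrite /cutoff th fM.
  apply: (@measurable_funS _ _ _ _ setT) => //.
  apply: (measurableT_comp (measurable_cutoff bf)).
  exact: measurable_funM.
by apply: bmeas_ext b => t /h; rewrite /cutoff => ->.
Qed.

Lemma primitive_scale (c T : R) x y : 0 < c -> primitive (T / c) x y ->
  primitive T (fun t => x (t / c)) (fun t => c^-1 * y (t / c)).
Proof.
move=> c0 [b h]; have bs := bmeas_scale c0 b; split; first exact: bmeasZ.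
move=> t /andP[t0 tT].
have tc : 0 <= t / c <= T / c.
  by rewrite divr_ge0 ?(ltW c0)//= ler_wpM2r ?invr_ge0 ?(ltW c0).
rewrite mul0r h// integralZ; last by apply: bmeasS bs.
rewrite integral_scaleb//; last by apply: bmeasS b => //; case/andP: tc.
by rewrite mulrA mulVf ?mul1r// gt_eqF.
Qed.

Lemma cprimitive_scale (c T : R) u v : 0 < c -> cprimitive (T / c) u v ->
  cprimitive T (fun t => u (t / c)) (fun t => ofR c^-1 * v (t / c)).
Proof.
move=> c0 [h1 h2]; split.
  apply: primitive_ext (primitive_scale c0 h1) => s _.
  by rewrite ?cE mul0r subr0.
apply: primitive_ext (primitive_scale c0 h2) => s _.
by rewrite ?cE mul0r addr0.
Qed.

End scaling.

Section memory.
Context {R : realType} (phi : R -> R) (M : R).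
Notation mu := (@lebesgue_measure R).
Notation Re := complex.Re.
Notation Im := complex.Im.
Hypotheses (mphi : measurable_fun setT phi) (phiM : forall t, `|phi t| <= M).
Variable g : R.
Implicit Types (nu tau : R).

Let bphi a b : bmeas a b phi.
Proof. by split; [exact: measurable_funS mphi|exists M]. Qed.

(** This is [\int_0^tau exp (- (g + i nu) s) phi (tau - s) ds], with the exponential
    of [tau] factored out so that it is a product of primitives. *)
Definition memory nu tau : R[i] :=
  ofR (expR (- g * tau)) * cis (- nu * tau) *
  cintegral `[0, tau] (fun s => ofR (expR (g * s) * phi s) * cis (nu * s)).

Lemma cprimitive_cis (T l : R) :
  cprimitive T (fun t => cis (l * t)) (fun t => imag * ofR l * cis (l * t)).
Proof.
split.
  apply: primitive_ext (primitive_derivable T (is_derive_cosM l) _) => [s _|].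
    by rewrite ?cE ?Re_cis ?Im_cis; ring.
  by move=> t; apply: cvgN; apply: cvgM; [exact: cvg_cst|exact: continuous_sinM].
apply: primitive_ext (primitive_derivable T (is_derive_sinM l) _) => [s _|].
  by rewrite ?cE ?Re_cis ?Im_cis; ring.
by move=> t; apply: cvgM; [exact: cvg_cst|exact: continuous_cosM].
Qed.

Let bexp (a b l : R) : bmeas a b (fun t => expR (l * t)).
Proof. by apply: continuous_bmeas; exact: continuous_expRM. Qed.
Let bcos (a b l : R) : bmeas a b (fun t => cos (l * t)).
Proof. by apply: continuous_bmeas; exact: continuous_cosM. Qed.
Let bsin (a b l : R) : bmeas a b (fun t => sin (l * t)).
Proof. by apply: continuous_bmeas; exact: continuous_sinM. Qed.

Lemma memory_prim (T : R) nu : 0 <= T ->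
  cprimitive T (memory nu) (fun t => (- imag * ofR nu - ofR g) * memory nu t + ofR (phi t)).
Proof.
move=> T0.
have hE : cprimitive T (fun t => ofR (expR (- g * t))) (fun t => ofR (- g * expR (- g * t))).
  apply: cprimitive_ofR; apply: primitive_derivable; first exact: is_derive_expRM.
  by move=> t; apply: cvgM; [exact: cvg_cst|exact: continuous_expRM].
pose y s := ofR (expR (g * s) * phi s) * cis (nu * s).
have hL : cprimitive T (fun t => cintegral `[0, t] y) y.
  split; split => /=.
  - apply: (bmeas_ext (f := fun s => expR (g * s) * phi s * cos (nu * s))).
      by move=> s _; rewrite /y ?cE mul0r subr0.
    by apply: bmeasM => //; apply: bmeasM.
  - by move=> t tT; rewrite integral_point add0r.
  - apply: (bmeas_ext (f := fun s => expR (g * s) * phi s * sin (nu * s))).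
      by move=> s _; rewrite /y ?cE mul0r addr0.
    by apply: bmeasM => //; apply: bmeasM.
  - by move=> t tT; rewrite integral_point add0r.
have h := cprimitiveM T0 (cprimitiveM T0 hE (cprimitive_cis T (- nu))) hL.
apply: cprimitive_ext h => s _; rewrite /memory -/y.
set L := cintegral _ _.
have -> : ofR (expR (- g * s)) * cis (- nu * s) * y s = ofR (phi s).
  have -> : ofR (expR (- g * s)) * cis (- nu * s) * y s =
    ofR (expR (- g * s)) * ofR (expR (g * s) * phi s) * (cis (- nu * s) * cis (nu * s)).
    by rewrite /y; ring.
  rewrite -cisD -ofRM mulrA -expRD.
  have -> : - nu * s + nu * s = 0 by ring.
  have -> : - g * s + g * s = 0 by ring.
  by rewrite cis0 expR0 mul1r mulr1.
by rewrite !ofRM !ofRN; ring.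
Qed.

Lemma memory0 nu : memory nu 0 = 0.
Proof.
rewrite /memory; have -> : cintegral `[0, 0] (fun s => ofR (expR (g * s) * phi s) * cis (nu * s)) = 0.
  by apply: complexP; rewrite /= integral_point.
by rewrite mulr0.
Qed.

Lemma memory_Re nu tau : 0 <= tau ->
  Re (memory nu tau) = \int[mu]_(s in `[0, tau]) (expR (- g * s) * cos (nu * s) * phi (tau - s)).
Proof.
move=> t0.
pose F t := expR (- g * (tau - t)) * cos (nu * (tau - t)) * phi t.
have c1 : continuous (fun t => expR (- g * (tau - t)) * cos (nu * (tau - t))).
  have ct : continuous (fun t : R => tau - t).
    by move=> t; apply: cvgB; [exact: cvg_cst|exact: cvg_id].
  move=> t; apply: cvgM.
    by apply: (continuous_comp (f := fun t => tau - t) (g := fun u => expR (- g * u))); [exact: ct|exact: continuous_expRM].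
  by apply: (continuous_comp (f := fun t => tau - t) (g := fun u => cos (nu * u))); [exact: ct|exact: continuous_cosM].
have mF : measurable_fun setT F by apply: measurable_funM => //; exact: continuous_measurable_fun.
have bF : bmeas 0 tau F by apply: bmeasM => //; exact: continuous_bmeas.
transitivity (\int[mu]_(s in `[0, tau]) F s); last first.
  rewrite -integral_reflect//; apply: integral_ext => s _.
  by rewrite /F; have -> : tau - (tau - s) = s by ring.
pose a := expR (- g * tau).
pose fc s := expR (g * s) * phi s * cos (nu * s).
pose fs s := expR (g * s) * phi s * sin (nu * s).
have bfc : bmeas 0 tau fc by apply: bmeasM => //; apply: bmeasM.
have bfs : bmeas 0 tau fs by apply: bmeasM => //; apply: bmeasM.
rewrite /memory.
have -> : cintegral `[0, tau] (fun s => ofR (expR (g * s) * phi s) * cis (nu * s)) =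
  ((\int[mu]_(s in `[0, tau]) fc s) +i* \int[mu]_(s in `[0, tau]) fs s)%C.
  apply: complexP => /=; apply: integral_ext => s _.
    by rewrite /fc mul0r subr0.
  by rewrite /fs mul0r addr0.
transitivity
  (a * cos (- nu * tau) * (\int[mu]_(s in `[0, tau]) fc s) -
   a * sin (- nu * tau) * \int[mu]_(s in `[0, tau]) fs s).
  by rewrite ?cE ?Re_cis ?Im_cis /= -/a mul0r subr0 mul0r addr0.
rewrite -!integralZ// -integralB; try exact: bmeasZ.
apply: integral_ext => s _; rewrite /F /fc /fs /a.
have -> : - g * (tau - s) = - g * tau + g * s by ring.
have -> : nu * (tau - s) = - (- nu * tau + nu * s) by ring.
by rewrite expRD cosN cosD; ring.
Qed.

Lemma memory_conj nu tau : 0 <= tau -> memory (- nu) tau = conjc (memory nu tau).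
Proof.
have conjM (z w : R[i]) : conjc (z * w) = conjc z * conjc w.
  by apply: complexP; rewrite ?cE; ring.
move=> t0; rewrite /memory !conjM -cisN.
have -> : conjc (ofR (expR (- g * tau))) = ofR (expR (- g * tau)).
  by apply: complexP; rewrite ?cE ?oppr0.
have -> : - (- nu * tau) = - - nu * tau by ring.
congr (_ * _); apply: complexP => /=.
  by apply: integral_ext => s _; rewrite mulNr cosN; ring.
rewrite -[RHS]mulN1r -integralZ; last first.
  apply: (bmeas_ext (f := fun s => expR (g * s) * phi s * sin (nu * s))).
    by move=> s _; rewrite mul0r addr0.
  by apply: bmeasM => //; apply: bmeasM.
by apply: integral_ext => s _; rewrite mulNr sinN; ring.
Qed.

End memory.

(** * Averaged transition rates *)

Section esum_real.
Context {R : realType} {T : choiceType}.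
Implicit Types (S : set T) (f : T -> R) (F : {fset T}).

Lemma fset_sum_le_esum S f F : [set` F] `<=` S ->
  ((\sum_(x <- F) f x)%:E <= \esum_(x in S) (f x)%:E)%E.
Proof.
move=> FS; apply: esum_ge; exists [set` F]; first by split.
by rewrite fsbig_finite// set_fsetK sumEFin.
Qed.

Lemma esum_le_fset_sums S f (B : \bar R) :
  (forall F, [set` F] `<=` S -> ((\sum_(x <- F) f x)%:E <= B)%E) ->
  (\esum_(x in S) (f x)%:E <= B)%E.
Proof.
move=> h; apply: ub_ereal_sup => _ [X [fX XS] <-].
rewrite fsbig_finite// sumEFin; apply: h.
by rewrite fset_setK.
Qed.

Lemma fset_sum_subset F G f : (F `<=` G)%fset -> (forall x, x \in G -> 0 <= f x) ->
  \sum_(x <- F) f x <= \sum_(x <- G) f x.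
Proof.
move=> FG f0; rewrite (big_fsetID _ (mem F) G)/=.
have -> : [fset x in G | x \in F]%fset = F.
  apply/fsetP => x; rewrite !inE /= andbC; case: (boolP (x \in F)) => //= xF.
  exact: (fsubsetP FG).
rewrite lerDl big_seq; apply: sumr_ge0 => x; rewrite !inE => /andP[xG _].
exact: f0.
Qed.

Lemma esum_fset_approx S f : (forall x, S x -> 0 <= f x) ->
  (\esum_(x in S) (f x)%:E < +oo)%E -> forall d : R, 0 < d ->
  exists2 F0 : {fset T}, [set` F0] `<=` S & forall F, (F0 `<=` F)%fset -> [set` F] `<=` S ->
    \sum_(x <- F) f x <= fine (\esum_(x in S) (f x)%:E) <= \sum_(x <- F) f x + d.
Proof.
move=> f0 foo d d0; set E := (\esum_(x in S) _)%E in foo *.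
have E0 : (0 <= E)%E by apply: esum_ge0 => x Sx; rewrite lee_fin f0.
have Efin : E \is a fin_num by rewrite ge0_fin_numE.
have : (E - d%:E < E)%E by rewrite lteBlDr// lteDl// lte_fin.
case/ereal_sup_gt => _ [X [fX XS] <-].
rewrite fsbig_finite// sumEFin => hX.
exists (fset_set X); first by rewrite fset_setK.
move=> F XF FS; rewrite -!lee_fin EFinD fineK// fset_sum_le_esum//=.
rewrite -leeBlDr//; apply: (le_trans (ltW hX)); rewrite lee_fin.
by apply: fset_sum_subset => // x xF; apply: f0; exact: FS.
Qed.

End esum_real.

Section wave_averaging.
Context {R : realType} (D : bloch_data R) (hD : standing_assumptions D).
Variables (eta Ceta : R).
Hypotheses (eta_gt0 : 0 < eta) (Ceta_gt0 : 0 < Ceta)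
  (ha : small_divisors D eta Ceta) (hb : wave_regularity D eta).
Notation mu := (@lebesgue_measure R).
Notation Re := complex.Re.
Notation Im := complex.Im.
Notation r := (nfreq D).
Notation lam a := (freq_dot a (freq D)).
Implicit Types (F : {fset 'rV[int]_r}).

Lemma fset_sum_le_fine (T : choiceType) (f : T -> R) (G : {fset T}) :
  (forall x, 0 <= f x) -> (\esum_(x in [set: T]) (f x)%:E < +oo)%E ->
  \sum_(x <- G) f x <= fine (\esum_(x in [set: T]) (f x)%:E).
Proof.
move=> f0 foo; rewrite -lee_fin fineK ?fset_sum_le_esum//.
by rewrite ge0_fin_numE//; apply: esum_ge0 => x _; rewrite lee_fin.
Qed.

Definition wave_energy : R :=
  fine (\esum_(a in [set: 'rV[int]_r]) (cabs (phi_hat D a) ^+ 2)%:E).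

Lemma wave_energy_le F : \sum_(a <- F) cabs (phi_hat D a) ^+ 2 <= wave_energy.
Proof.
by apply: fset_sum_le_fine => [a|]; [exact: sqr_ge0|exact: sa_phi_hat_l2 hD].
Qed.

Lemma wave_energy_ge0 : 0 <= wave_energy.
Proof. by have := wave_energy_le fset0; rewrite big_seq_fset0. Qed.

(** The regularity of the wave bounds the right-hand side of [offdiagonal_form_le]. *)
Lemma wave_offdiagonal : exists2 C0 : R, 0 <= C0 & forall F (S : R), 1 <= S ->
  \sum_(a <- F) \sum_(b <- F | b != a) cabs (phi_hat D a) * cabs (phi_hat D b) *
    Num.min S (2 / `|lam b - lam a|) <= C0 * Num.sqrt S.
Proof.
have [C C0 h] := offdiagonal_form_le (sa_r_gt0 hD) eta_gt0 Ceta_gt0 ha.2.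
pose f (a : 'rV[int]_r) : R := (1 + mi_norm a) `^ (r%:R - 1 + eta) * cabs (phi_hat D a) ^+ 2.
have f0 a : 0 <= f a by rewrite mulr_ge0 ?powR_ge0 ?sqr_ge0.
exists (C * fine (\esum_(a in [set: 'rV[int]_r]) (f a)%:E)).
  rewrite mulr_ge0//; have := fset_sum_le_fine fset0 f0 hb.
  by rewrite big_seq_fset0.
move=> F S S1; apply: (le_trans (h F (fun a => cabs (phi_hat D a)) S (fset_uniq F) _ S1)).
  by move=> a; exact: cabs_ge0.
rewrite mulrAC ler_wpM2r ?sqrtr_ge0// ler_wpM2l//.
exact: (fset_sum_le_fine F f0 hb).
Qed.

Lemma lam_separated (a b : 'rV[int]_r) : b != a -> lam b - lam a != 0.
Proof.
move=> ba; rewrite -freq_dotB -normr_gt0.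
have d0 : b - a != 0 by rewrite subr_eq0.
apply: lt_le_trans (ha.2 _ d0); rewrite mulr_gt0// powR_gt0//.
by have := mi_norm_ge0 (R := R) (b - a); lra.
Qed.

Lemma wave_trig_approx (S d : R) : 0 < d -> exists F0, forall F, (F0 `<=` F)%fset ->
  \int[mu]_(t in `[0, S]) nsq (ofR (phi D t) - trig_sum (freq D) (phi_hat D) F t) <= d.
Proof.
move=> d0; have [F0 h] := sa_phi_quasiperiodic hD 0 S d0.
exists F0 => F /h {}h; rewrite /Rintegral.
have e1 t : cabs (ofR (phi D t) - phi_partial F t) ^+ 2 =
    nsq (ofR (phi D t) - trig_sum (freq D) (phi_hat D) F t).
  rewrite cabs_sqr; congr (nsq (_ - _)); apply: eq_bigr => a _.
  by rewrite cexp_imag.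
rewrite -lee_fin fineK.
  by under eq_integral do rewrite -e1.
rewrite ge0_fin_numE; last by apply: integral_ge0 => t _; rewrite lee_fin nsq_ge0.
under eq_integral do rewrite -e1.
exact: le_lt_trans h (ltry _).
Qed.

Variables (e : R) (k n : nat).
Hypotheses (e0 : 0 < e) (kL : levels D k) (nL : levels D n) (kn : k != n).

Definition relax_rate : R := e `^ muexp D * gam D k n.

Lemma relax_rate_gt0 : 0 < relax_rate.
Proof.
rewrite mulr_gt0 ?powR_gt0//.
have [g g0 h] := sa_gam_inf hD; exact: lt_le_trans g0 (h _ _ kL nL kn).
Qed.

Lemma Psi_kernelE (tau : R) : Psi D e tau k n = 2 * nsq (Vc D n k) *
  \int[mu]_(s in `[0, tau])
    (expR (- relax_rate * s) * cos (om_eps D e k n * s) * phi D tau * phi D (tau - s)).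
Proof.
rewrite /Psi cabs_sqr; congr (_ * _); apply: integral_ext => s _.
rewrite /cexp /Omega_eps ?cE /=.
set x := expR _; set c := cos _.
have -> : x = expR (- relax_rate * s).
  by congr expR; rewrite /relax_rate; ring.
have -> : c = cos (om_eps D e k n * s).
  by rewrite -cosN; congr cos; rewrite /om_eps; ring.
ring.
Qed.

Definition resonance_sum : R :=
  fine (\esum_(b in [set: 'rV[int]_r])
    (relax_rate / (relax_rate ^+ 2 + (om_eps D e k n + lam b) ^+ 2)
      * cabs (phi_hat D b) ^+ 2)%:E).

Lemma avg_Psi_explicitE : avg_Psi_explicit D e k n = 2 * nsq (Vc D n k) * resonance_sum.
Proof.
rewrite /avg_Psi_explicit cabs_sqr; congr (_ * fine _); apply: eq_esum => b _.
congr ((_ / (_ + _) * _)%:E).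
  rewrite /relax_rate exprMn; congr (_ * _).
  have -> : 2 * muexp D = muexp D + muexp D by ring.
  by rewrite powRD ?expr2// (gt_eqF e0) implybT.
rewrite real_normK ?num_real//; congr (_ ^+ 2); rewrite /om_eps; ring.
Qed.

Let term_le b :
  relax_rate / (relax_rate ^+ 2 + (om_eps D e k n + lam b) ^+ 2) * cabs (phi_hat D b) ^+ 2
  <= relax_rate^-1 * cabs (phi_hat D b) ^+ 2.
Proof.
have g0 := relax_rate_gt0; rewrite ler_wpM2r ?sqr_ge0//.
set u := _ + lam b; have u0 := sqr_ge0 u.
have d0 : 0 < relax_rate ^+ 2 + u ^+ 2 by rewrite ltr_wpDr ?exprn_gt0.
rewrite ler_pdivrMr//; rewrite mulrDr expr2 mulrA mulVf ?gt_eqF// mul1r lerDl.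
by rewrite mulr_ge0 ?invr_ge0 ?(ltW g0).
Qed.

Let term_ge0 b :
  0 <= relax_rate / (relax_rate ^+ 2 + (om_eps D e k n + lam b) ^+ 2) * cabs (phi_hat D b) ^+ 2.
Proof.
have g0 := ltW relax_rate_gt0.
by rewrite mulr_ge0 ?sqr_ge0// divr_ge0// addr_ge0 ?sqr_ge0.
Qed.

Let resonance_le : (\esum_(b in [set: 'rV[int]_r])
    (relax_rate / (relax_rate ^+ 2 + (om_eps D e k n + lam b) ^+ 2)
      * cabs (phi_hat D b) ^+ 2)%:E <= (relax_rate^-1 * wave_energy)%:E)%E.
Proof.
have g0 := relax_rate_gt0.
apply: esum_le_fset_sums => F _; rewrite lee_fin.
apply: (@le_trans _ _ (\sum_(b <- F) relax_rate^-1 * cabs (phi_hat D b) ^+ 2)).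
  by apply: ler_sum => b _; exact: term_le.
by rewrite -mulr_sumr ler_wpM2l ?wave_energy_le// invr_ge0 ltW.
Qed.

Lemma resonance_sum_bounds : 0 <= resonance_sum <= wave_energy / relax_rate.
Proof.
apply/andP; split.
  by apply: fine_ge0; apply: esum_ge0 => b _; rewrite lee_fin.
rewrite mulrC -lee_fin fineK//.
rewrite ge0_fin_numE; last by apply: esum_ge0 => b _; rewrite lee_fin.
exact: le_lt_trans resonance_le (ltry _).
Qed.

Lemma resonance_sum_approx (d : R) : 0 < d -> exists F0, forall F, (F0 `<=` F)%fset ->
  `|\sum_(b <- F) cabs (phi_hat D b) ^+ 2 *
      (relax_rate / (relax_rate ^+ 2 + (om_eps D e k n + lam b) ^+ 2)) - resonance_sum| <= d.
Proof.
move=> d0; have [] := @esum_fset_approx _ _ [set: 'rV[int]_r] (fun b =>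
  relax_rate / (relax_rate ^+ 2 + (om_eps D e k n + lam b) ^+ 2) * cabs (phi_hat D b) ^+ 2)
  (fun b _ => term_ge0 b) _ d d0.
  exact: le_lt_trans resonance_le (ltry _).
move=> F0 _ h; exists F0 => F FF; move: (h F FF (@subsetT _ _)).
under eq_bigr do rewrite mulrC.
rewrite -/resonance_sum => /andP[h1 h2].
by rewrite distrC ger0_norm ?subr_ge0// lerBlDl.
Qed.

Definition averaging_error (C0 S : R) : R :=
  C0 * Num.sqrt (1 + S) / relax_rate + 2 * wave_energy / relax_rate ^+ 2.

Definition response (tau : R) : R[i] := memory (phi D) relax_rate (om_eps D e k n) tau.

Let bphi a b : bmeas a b (phi D).
Proof.
have [M phiM] := sa_phi_bounded hD.
by split; [exact: measurable_funS (sa_phi_measurable hD)|exists M].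
Qed.

Let bphi_rev a b tau : bmeas a b (fun s => phi D (tau - s)).
Proof.
have [M phiM] := sa_phi_bounded hD; split; last by exists M.
apply: (@measurable_funS _ _ _ _ setT) => //.
apply: (measurableT_comp (sa_phi_measurable hD)); exact: measurable_funB.
Qed.

Lemma Psi_response (tau : R) : 0 <= tau ->
  Psi D e tau k n = 2 * nsq (Vc D n k) * (phi D tau * Re (response tau)).
Proof.
have [M phiM] := sa_phi_bounded hD.
move=> t0; rewrite Psi_kernelE (memory_Re (sa_phi_measurable hD) phiM)//.
rewrite -[in RHS]integralZ; last first.
  apply: bmeasM => //; apply: bmeasM; apply: continuous_bmeas.
    exact: continuous_expRM.
  exact: continuous_cosM.
by congr (_ * _); apply: integral_ext => s _; ring.
Qed.

Lemma response_prim (T : R) : 0 <= T ->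
  cprimitive T response
    (fun t => (- imag * ofR (om_eps D e k n) - ofR relax_rate) * response t + ofR (phi D t)).
Proof.
have [M phiM] := sa_phi_bounded hD.
exact: (memory_prim (sa_phi_measurable hD) phiM).
Qed.

Lemma Psi_bmeas (S : R) : 0 <= S -> bmeas 0 S (fun tau => Psi D e tau k n).
Proof.
move=> S0; have [hR _] := response_prim S0.
apply: (bmeas_ext (f := fun tau => 2 * nsq (Vc D n k) * (phi D tau * Re (response tau)))).
  by move=> t /andP[t0 _]; rewrite Psi_response.
apply: bmeasZ; apply: bmeasM => //; exact: primitive_bmeas hR.
Qed.

Lemma Psi_integral_le (C0 S : R) : 0 <= C0 -> 0 <= S ->
  (forall F (S : R), 1 <= S ->
    \sum_(a <- F) \sum_(b <- F | b != a) cabs (phi_hat D a) * cabs (phi_hat D b) *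
    Num.min S (2 / `|lam b - lam a|) <= C0 * Num.sqrt S) ->
  `|\int[mu]_(tau in `[0, S]) (Psi D e tau k n) - S * avg_Psi_explicit D e k n|
  <= 2 * nsq (Vc D n k) * averaging_error C0 S.
Proof.
move=> C00 S0 hC.
have [M phiM] := sa_phi_bounded hD.
have V0 : 0 <= 2 * nsq (Vc D n k) by rewrite mulr_ge0 ?nsq_ge0.
have := averaging_le (sa_phi_measurable hD) phiM C00 wave_trig_approx wave_energy_le
  lam_separated hC relax_rate_gt0 resonance_sum_approx S0.
set I := \int[mu]_(tau in _) _ => h.
rewrite avg_Psi_explicitE (integral_ext (fun tau _ => Psi_kernelE tau)) integralZ -/I.
  have -> : 2 * nsq (Vc D n k) * I - S * (2 * nsq (Vc D n k) * resonance_sum) =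
    2 * nsq (Vc D n k) * (I - S * resonance_sum) by ring.
  by rewrite normrM (ger0_norm V0) ler_wpM2l.
have [hR _] := response_prim S0.
apply: (bmeas_ext (f := fun tau => phi D tau * Re (response tau))); last first.
  by apply: bmeasM => //; exact: primitive_bmeas hR.
move=> t /andP[t0 _]; rewrite (memory_Re (sa_phi_measurable hD) phiM)//.
rewrite -integralZ; last first.
  apply: bmeasM => //; apply: bmeasM; apply: continuous_bmeas.
    exact: continuous_expRM.
  exact: continuous_cosM.
by apply: integral_ext => s _; ring.
Qed.

(** The error of order [sqrt S] is divided by [S]. *)
Lemma Psi_mean_cvg : Psi_mean D e k n s @[s --> +oo] --> avg_Psi_explicit D e k n.
Proof.
have [C0 C00 hC] := wave_offdiagonal.
have g0 := relax_rate_gt0; have B0 := wave_energy_ge0.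
have V0 : 0 <= 2 * nsq (Vc D n k) by rewrite mulr_ge0 ?nsq_ge0.
pose K := 2 * nsq (Vc D n k) * (C0 / relax_rate + 2 * wave_energy / relax_rate ^+ 2).
have g0' := ltW g0.
have K0 : 0 <= K by rewrite /K; nonneg.
have bound S : 1 <= S -> `|Psi_mean D e k n S - avg_Psi_explicit D e k n| <= 2 * K / Num.sqrt S.
  move=> S1; have S0 : 0 < S by exact: lt_le_trans S1.
  have sS0 : 0 < Num.sqrt S by rewrite sqrtr_gt0.
  have -> : Psi_mean D e k n S - avg_Psi_explicit D e k n =
    S^-1 * (\int[mu]_(tau in `[0, S]) (Psi D e tau k n) - S * avg_Psi_explicit D e k n).
    by rewrite /Psi_mean mulrBr mulrA mulVf ?mul1r// gt_eqF.
  rewrite normrM ger0_norm ?invr_ge0 ?(ltW S0)// ler_pdivrMl//.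
  apply: (le_trans (Psi_integral_le C00 (ltW S0) hC)).
  have -> : S * (2 * K / Num.sqrt S) = 2 * K * Num.sqrt S.
    by rewrite -{1}(sqr_sqrtr (ltW S0)); field; rewrite gt_eqF.
  have -> : 2 * K * Num.sqrt S = 2 * nsq (Vc D n k) *
     (C0 * (2 * Num.sqrt S) / relax_rate + 2 * wave_energy / relax_rate ^+ 2 * (2 * Num.sqrt S)).
    by rewrite /K; ring.
  rewrite ler_wpM2l// lerD//.
    rewrite ler_wpM2r ?invr_ge0 ?(ltW g0)// ler_wpM2l//.
    have h1 : Num.sqrt (1 + S) ^+ 2 = 1 + S by rewrite sqr_sqrtr//; lra.
    have h2 : Num.sqrt S ^+ 2 = S by rewrite sqr_sqrtr// ltW.
    have h3 := sqrtr_ge0 S; have h4 := sqrtr_ge0 (1 + S); nra.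
  rewrite ler_peMr//; first by nonneg.
  have : 1 <= Num.sqrt S by rewrite -[leLHS]sqrtr1 ler_wsqrtr.
  lra.
apply/cvgrPdist_le => d d0; near=> S.
have S1 : 1 <= S by near: S; exact: nbhs_pinfty_ge.
rewrite distrC; apply: (le_trans (bound S S1)).
have S0 : 0 < S by exact: lt_le_trans S1.
rewrite ler_pdivrMr ?sqrtr_gt0// -ler_pdivrMl// -[leLHS]ger0_norm; last by nonneg.
rewrite -sqrtr_sqr ler_sqrt ?(ltW S0)//.
Unshelve. all: by end_near. Qed.

Lemma avg_PsiE : avg_Psi D e k n = avg_Psi_explicit D e k n.
Proof. exact: (cvg_lim _ Psi_mean_cvg). Qed.

End wave_averaging.

(** * Absolutely convergent sums over the levels *)

Section bounded_sums.
Context {R : realType} {X : choiceType}.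
Implicit Types (S : set X) (f g : X -> R) (F G : {fset X}) (B d : R).

(** Bounding all finite partial sums keeps estimates within real numbers, where an
    infinite sum would be an extended real. *)
Definition sums_le S f d := forall G, [set` G] `<=` S -> \sum_(x <- G) f x <= d.

Lemma sums_leS S S' f d : S' `<=` S -> sums_le S f d -> sums_le S' f d.
Proof. by move=> SS h G GS; apply: h; exact: subset_trans SS. Qed.

Lemma sums_le_mono S f g d : (forall x, S x -> g x <= f x) -> sums_le S f d -> sums_le S g d.
Proof.
move=> gf h G GS; apply: le_trans (h G GS); rewrite big_seq [leRHS]big_seq.
by apply: ler_sum => x xG; apply: gf; exact: GS.
Qed.

Lemma sums_leD S f g B d : sums_le S f B -> sums_le S g d -> sums_le S (fun x => f x + g x) (B + d).
Proof. by move=> hf hg G GS; rewrite big_split lerD ?hf ?hg. Qed.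

Lemma sums_leZ S f (c : R) d : 0 <= c -> sums_le S f d -> sums_le S (fun x => c * f x) (c * d).
Proof. by move=> c0 h G GS; rewrite -mulr_sumr ler_wpM2l ?h. Qed.

Lemma sums_le_weak S f d B : d <= B -> sums_le S f d -> sums_le S f B.
Proof. by move=> dB h G GS; exact: le_trans (h G GS) dB. Qed.

Lemma sums_le_ge0 S f d : sums_le S f d -> 0 <= d.
Proof. by move=> /(_ fset0); rewrite big_seq_fset0; apply => x; rewrite /= in_fset0. Qed.

Lemma sums_le_term S f d x : sums_le S f d -> S x -> f x <= d.
Proof.
move=> h Sx; have := h [fset x]%fset; rewrite big_seq_fset1; apply => y /=.
by rewrite in_fset1 => /eqP ->.
Qed.

Lemma esum_lt_sums S f : (\esum_(x in S) (f x)%:E < +oo)%E -> (forall x, S x -> 0 <= f x) ->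
  sums_le S f (fine (\esum_(x in S) (f x)%:E)).
Proof.
move=> foo f0 G GS; rewrite -lee_fin fineK ?fset_sum_le_esum//.
by rewrite ge0_fin_numE//; apply: esum_ge0 => x Sx; rewrite lee_fin f0.
Qed.

Lemma esum_le_sums S f d : (forall x, S x -> 0 <= f x) ->
  (\esum_(x in S) (f x)%:E <= d%:E)%E -> sums_le S f d.
Proof.
by move=> f0 h G GS; rewrite -lee_fin; apply: le_trans h; exact: fset_sum_le_esum.
Qed.

Lemma sums_tail S f B : (forall x, S x -> 0 <= f x) -> sums_le S f B -> forall d, 0 < d ->
  exists2 F : {fset X}, [set` F] `<=` S & sums_le (S `\` [set` F]) f d.
Proof.
move=> f0 h d d0.
have foo : (\esum_(x in S) (f x)%:E < +oo)%E.
  apply: (@le_lt_trans _ _ B%:E); last exact: ltry.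
  by apply: esum_le_fset_sums => G GS; rewrite lee_fin h.
have [F FS hF] := esum_fset_approx f0 foo d0.
exists F => // G GS.
have /andP[_ h1] := hF F (fsubset_refl F) FS.
have FGS : [set` (F `|` G)%fset] `<=` S.
  by move=> x /=; rewrite in_fsetU => /orP[/FS//|/GS[]].
have /andP[h2 _] := hF _ (fsubsetUl F G) FGS.
have h3 : \sum_(x <- (F `|` G)%fset) f x = \sum_(x <- F) f x + \sum_(x <- G) f x.
  rewrite -big_cat; apply: perm_big; apply: uniq_perm.
  - exact: fset_uniq.
  - rewrite cat_uniq !fset_uniq andbT /=; apply/hasPn => x xG.
    by apply/negP => xF; have [_] := GS _ xG; exact.
  - by move=> x; rewrite in_fsetU mem_cat.
by move: h2; rewrite h3; lra.
Qed.

(** The filter of large finite subsets of [S]; compactness of the time interval is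
    used along it. *)
Let fset_filter S : set_system {fset X} := [set Q | exists2 F0 : {fset X}, [set` F0] `<=` S &
  forall F, [set` F] `<=` S -> (F0 `<=` F)%fset -> Q F].

Let fset_filterP S : Filter (fset_filter S).
Proof.
split.
- by exists fset0 => // x; rewrite /= in_fset0.
- move=> P Q [F FS hF] [G GS hG]; exists (F `|` G)%fset.
    by move=> x /=; rewrite in_fsetU => /orP[/FS|/GS].
  move=> H HS FGH; split; [apply: hF|apply: hG] => //; apply: fsubset_trans FGH.
    exact: fsubsetUl.
  exact: fsubsetUr.
- move=> P Q PQ [F FS hF]; exists F => // H HS FH; apply: PQ; exact: hF.
Qed.

(** Compactness: near each time, one finite set catches all but little of the sum. *)
Lemma uniform_tails S (T : R) (w : R -> X -> R) :
  (forall t x, 0 <= t <= T -> S x -> 0 <= w t x) ->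
  (forall t, 0 <= t <= T -> exists B, sums_le S (w t) B) ->
  (forall t d, 0 <= t <= T -> 0 < d -> \forall s \near nbhs t, 0 <= s <= T ->
    exists2 D, sums_le S D d & forall x, S x -> w s x <= 2 * w t x + 2 * D x) ->
  forall d, 0 < d -> exists2 F : {fset X}, [set` F] `<=` S &
    forall s, 0 <= s <= T -> sums_le (S `\` [set` F]) (w s) d.
Proof.
move=> w0 ws wc d d0.
have := (@segment_compact R 0 T); rewrite compact_near_coveringP.
move=> /(_ _ (fset_filter S) (fun F s => 0 <= s <= T -> sums_le (S `\` [set` F]) (w s) d) (fset_filterP S)).
case.
  move=> t /=; rewrite in_itv /= => tT.
  have d4 : 0 < d / 4 by rewrite divr_gt0.
  have [B hB] := ws t tT.
  have [F FS hF] := sums_tail (fun x : X => @w0 t x tT) hB d4.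
  have wF := wc t _ tT d4.
  exists ([set s | 0 <= s <= T -> exists2 D, sums_le S D (d / 4) &
            forall x, S x -> w s x <= 2 * w t x + 2 * D x],
          [set G : {fset X} | [set` G] `<=` S /\ (F `<=` G)%fset]) => /=.
    by split => //; exists F.
  move=> [s G] /= [hs [GS FG]] sT; have [D hD hw] := hs sT.
  apply: (@sums_le_mono _ (fun x => 2 * w t x + 2 * D x)) => [x [Sx _]|]; first exact: hw.
  have -> : d = 2 * (d / 4) + 2 * (d / 4) by field.
  apply: sums_leD; apply: sums_leZ => //.
    by apply: sums_leS hF => x [Sx xG]; split => // xF; apply: xG; exact: (fsubsetP FG).
  by apply: sums_leS hD => x [].
move=> F FS /(_ F FS (fsubset_refl F)) hF; by exists F => // s sT; apply: hF.
Qed.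

End bounded_sums.

Section level_sums.
Context {R : realType}.
Implicit Types (S L : set nat) (f g : nat -> R[i]) (B d : R).
Notation Re := complex.Re.
Notation Im := complex.Im.

Lemma cabsB_le (z w : R[i]) : cabs (z - w) <= cabs z + cabs w.
Proof. by apply: (le_trans (cabs_triangle _ _)); rewrite cabsN. Qed.

Let part S M : {fset nat} := seq_fset tt [seq k <- index_iota 0 M | k \in S].

Let part_sub S M : [set` part S M] `<=` S.
Proof. by move=> k /=; rewrite seq_fsetE mem_filter => /andP[/set_mem]. Qed.

Let part_sum (V : nmodType) S M (F : nat -> V) :
  \sum_(0 <= k < M | k \in S) F k = \sum_(k <- part S M) F k.
Proof.
rewrite -big_filter; apply: perm_big; rewrite perm_sym.
apply: perm_trans (seq_fset_perm _ _) _.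
by rewrite undup_id// filter_uniq// iota_uniq.
Qed.

Lemma rsum_cvg S (f : nat -> R) B : sums_le S (fun k => `|f k|) B ->
  (fun M => \sum_(0 <= k < M | k \in S) f k) @ \oo --> rsum S f.
Proof.
move=> h; pose g k := if k \in S then f k else 0.
have e1 : (fun M => \sum_(0 <= k < M | k \in S) f k) = series g.
  by apply/funext => M; rewrite /series /= big_mkcond.
suff : cvgn (series g) by rewrite /rsum e1.
apply: normed_cvg; apply: nondecreasing_is_cvgn.
  by apply/nondecreasing_seqP => M; rewrite /normed_series_of seriesSr lerDl normr_ge0.
exists B => _ [M _ <-]; rewrite /normed_series_of /series /=.
have -> : \sum_(0 <= k < M) `|g k| = \sum_(0 <= k < M | k \in S) `|f k|.
  by rewrite [RHS]big_mkcond; apply: eq_bigr => k _; rewrite /g; case: ifP => // _; rewrite normr0.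
by rewrite part_sum; apply: h; exact: part_sub.
Qed.

Let cvgP_Re S f B : sums_le S (fun k => cabs (f k)) B ->
  (fun M => Re (\sum_(0 <= k < M | k \in S) f k)) @ \oo --> Re (csum S f).
Proof.
move=> h; have -> : (fun M => Re (\sum_(0 <= k < M | k \in S) f k)) =
    (fun M => \sum_(0 <= k < M | k \in S) Re (f k)).
  by apply/funext => M; rewrite Re_sum.
by apply: (@rsum_cvg _ _ B); apply: sums_le_mono h => k _; exact: Re_le_cabs.
Qed.

Let cvgP_Im S f B : sums_le S (fun k => cabs (f k)) B ->
  (fun M => Im (\sum_(0 <= k < M | k \in S) f k)) @ \oo --> Im (csum S f).
Proof.
move=> h; have -> : (fun M => Im (\sum_(0 <= k < M | k \in S) f k)) =
    (fun M => \sum_(0 <= k < M | k \in S) Im (f k)).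
  by apply/funext => M; rewrite Im_sum.
by apply: (@rsum_cvg _ _ B); apply: sums_le_mono h => k _; exact: Im_le_cabs.
Qed.

(** Passage to the limit in a bound that holds for finite sums. *)
Let csum_closed (J : finType) S (f : J -> nat -> R[i]) (Psi : R[i] -> R) d :
  (forall j, exists B, sums_le S (fun k => cabs (f j k)) B) ->
  (forall (z_ : nat -> R[i]) z, (fun M => Re (z_ M)) @ \oo --> Re z ->
     (fun M => Im (z_ M)) @ \oo --> Im z -> (fun M => Psi (z_ M)) @ \oo --> Psi z) ->
  (forall G : {fset nat}, [set` G] `<=` S -> \sum_j Psi (\sum_(k <- G) f j k) <= d) ->
  \sum_j Psi (csum S (f j)) <= d.
Proof.
move=> hf hPsi h.
have c : (fun M => \sum_j Psi (\sum_(0 <= k < M | k \in S) f j k)) @ \oo -->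
    \sum_j Psi (csum S (f j)).
  apply: cvg_big => [|j _]; first exact: add_continuous.  have [B hB] := hf j.
  by apply: hPsi; [exact: cvgP_Re hB|exact: cvgP_Im hB].
apply: (cvgr_to_le c); near=> M; under eq_bigr do rewrite part_sum.
apply: h; exact: part_sub.
Unshelve. all: by end_near. Qed.

Let nsq_closed (z_ : nat -> R[i]) z : (fun M => Re (z_ M)) @ \oo --> Re z ->
  (fun M => Im (z_ M)) @ \oo --> Im z -> (fun M => nsq (z_ M)) @ \oo --> nsq z.
Proof. by move=> h1 h2; apply: cvgD; rewrite expr2; apply: cvgM. Qed.

Let cabs_closed (z_ : nat -> R[i]) z : (fun M => Re (z_ M)) @ \oo --> Re z ->
  (fun M => Im (z_ M)) @ \oo --> Im z -> (fun M => cabs (z_ M)) @ \oo --> cabs z.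
Proof.
move=> h1 h2; under eq_fun do rewrite cabsE; rewrite cabsE.
by apply: continuous_cvg; [exact: sqrt_continuous|exact: nsq_closed].
Qed.

Lemma sum_csum_le (J : finType) S (f : J -> nat -> R[i]) d :
  sums_le S (fun k => \sum_j cabs (f j k)) d -> \sum_j cabs (csum S (f j)) <= d.
Proof.
move=> h; apply: csum_closed => [j||G GS]; [exists d|exact: cabs_closed|].
  apply: sums_le_mono h => k _; apply: (ler_term (F := fun i => cabs (f i k))) => i.
  exact: cabs_ge0.
apply: (@le_trans _ _ (\sum_j \sum_(k <- G) cabs (f j k))).
  by apply: ler_sum => j _; exact: cabs_sum.
by rewrite exchange_big; exact: h GS.
Qed.

Lemma sum_nsq_csum_le (J : finType) S (f : J -> nat -> R[i]) d :
  (forall j, exists B, sums_le S (fun k => cabs (f j k)) B) ->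
  (forall G : {fset nat}, [set` G] `<=` S -> \sum_j nsq (\sum_(k <- G) f j k) <= d) ->
  \sum_j nsq (csum S (f j)) <= d.
Proof. by move=> h1 h2; apply: csum_closed h1 _ h2; exact: nsq_closed. Qed.

Lemma csum_le S f d : sums_le S (fun k => cabs (f k)) d -> cabs (csum S f) <= d.
Proof.
move=> h; have := @sum_csum_le unit S (fun _ => f) d; rewrite big_const card_unit /= addr0.
by apply; apply: sums_le_mono h => k _; rewrite big_const card_unit /= addr0.
Qed.

Let cvg_unique_C (z_ : nat -> R[i]) (z w : R[i]) : (fun M => Re (z_ M)) @ \oo --> Re z ->
  (fun M => Im (z_ M)) @ \oo --> Im z -> (fun M => Re (z_ M)) @ \oo --> Re w ->
  (fun M => Im (z_ M)) @ \oo --> Im w -> z = w.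
Proof.
move=> h1 h2 h3 h4; apply: complexP.
  by apply: (cvg_unique _ h1 h3); exact: norm_hausdorff.
by apply: (cvg_unique _ h2 h4); exact: norm_hausdorff.
Qed.

Lemma csumB S f g B d : sums_le S (fun k => cabs (f k)) B -> sums_le S (fun k => cabs (g k)) d ->
  csum S (fun k => f k - g k) = csum S f - csum S g.
Proof.
move=> hf hg.
have h : sums_le S (fun k => cabs (f k - g k)) (B + d).
  apply: sums_le_mono (sums_leD hf hg) => k _; exact: cabsB_le.
apply: cvg_unique_C; [exact: cvgP_Re h|exact: cvgP_Im h| |].
  have -> : (fun M => Re (\sum_(0 <= k < M | k \in S) (f k - g k))) =
    (fun M => Re (\sum_(0 <= k < M | k \in S) f k) - Re (\sum_(0 <= k < M | k \in S) g k)).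
    by apply/funext => M; rewrite sumrB ReB.
  by rewrite ReB; apply: cvgB; [exact: cvgP_Re hf|exact: cvgP_Re hg].
have -> : (fun M => Im (\sum_(0 <= k < M | k \in S) (f k - g k))) =
    (fun M => Im (\sum_(0 <= k < M | k \in S) f k) - Im (\sum_(0 <= k < M | k \in S) g k)).
  by apply/funext => M; rewrite sumrB ImB.
by rewrite ImB; apply: cvgB; [exact: cvgP_Im hf|exact: cvgP_Im hg].
Qed.

Lemma csumZ S (c : R) f B : sums_le S (fun k => cabs (f k)) B ->
  csum S (fun k => ofR c * f k) = ofR c * csum S f.
Proof.
move=> hf.
have h : sums_le S (fun k => cabs (ofR c * f k)) (`|c| * B).
  by apply: sums_le_mono (sums_leZ (normr_ge0 c) hf) => k _; rewrite cabsM cabs_ofR.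
apply: cvg_unique_C; [exact: cvgP_Re h|exact: cvgP_Im h| |].
  have -> : (fun M => Re (\sum_(0 <= k < M | k \in S) (ofR c * f k))) =
    (fun M => c * Re (\sum_(0 <= k < M | k \in S) f k)).
    by apply/funext => M; rewrite -mulr_sumr ReM Im_ofR mul0r subr0.
  rewrite ReM Im_ofR mul0r subr0; apply: cvgM; [exact: cvg_cst|exact: cvgP_Re hf].
have -> : (fun M => Im (\sum_(0 <= k < M | k \in S) (ofR c * f k))) =
    (fun M => c * Im (\sum_(0 <= k < M | k \in S) f k)).
  by apply/funext => M; rewrite -mulr_sumr ImM Im_ofR mul0r addr0.
rewrite ImM Im_ofR mul0r addr0; apply: cvgM; [exact: cvg_cst|exact: cvgP_Im hf].
Qed.

Lemma csum_ofR S (f : nat -> R) : csum S (fun k => ofR (f k)) = ofR (rsum S f).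
Proof.
apply: complexP => //=; rewrite /rsum.
have -> : (fun M => \sum_(0 <= k < M | k \in S) (0 : R)) = (fun=> 0).
  by apply/funext => M; rewrite big1.
exact: lim_cst.
Qed.

Lemma csum_split L N f B : `I_N `<=` L -> sums_le L (fun k => cabs (f k)) B ->
  csum L f = \sum_(k < N) f k + csum (L `\` `I_N) f.
Proof.
move=> NL h; have h' : sums_le (L `\` `I_N) (fun k => cabs (f k)) B.
  by apply: sums_leS h; exact: subDsetl.
have e1 M : (N <= M)%N -> \sum_(0 <= k < M | k \in L) f k =
    \sum_(k < N) f k + \sum_(0 <= k < M | k \in L `\` `I_N) f k.
  move=> NM; rewrite (@big_cat_nat _ _ _ N)//=; congr (_ + _).
    rewrite big_mkord; apply: eq_bigl => k; apply/mem_set/NL => /=; exact: ltn_ord.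
  have z : \sum_(0 <= k < N | k \in L `\` `I_N) f k = 0.
    rewrite big_nat_cond big1// => k /andP[/andP[_ kN] /set_mem[_]].
    by rewrite /= kN.
  rewrite [RHS](@big_cat_nat _ _ _ N)//= z add0r.
  rewrite [LHS]big_nat_cond [RHS]big_nat_cond; apply: eq_bigl => k.
  case: (boolP (N <= k < M)%N) => //= /andP[Nk _].
  apply/idP/idP => /set_mem => [Lk|[Lk _]]; apply/mem_set => //; split => //=.
  by apply/negP; rewrite -leqNgt.
apply: cvg_unique_C; [exact: cvgP_Re h|exact: cvgP_Im h| |].
  apply: (@cvg_trans _ ((fun M => Re (\sum_(k < N) f k) + Re (\sum_(0 <= k < M | k \in L `\` `I_N) f k)) @ \oo)).
    apply: near_eq_cvg; near=> M; rewrite e1 ?ReD//.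
    by near: M; exact: nbhs_infty_ge.
  by rewrite ReD; apply: cvgD; [exact: cvg_cst|exact: cvgP_Re h'].
apply: (@cvg_trans _ ((fun M => Im (\sum_(k < N) f k) + Im (\sum_(0 <= k < M | k \in L `\` `I_N) f k)) @ \oo)).
  apply: near_eq_cvg; near=> M; rewrite e1 ?ImD//.
  by near: M; exact: nbhs_infty_ge.
by rewrite ImD; apply: cvgD; [exact: cvg_cst|exact: cvgP_Im h'].
Unshelve. all: by end_near. Qed.

End level_sums.

Section bounded_sums_tools.
Context {R : realType}.
Implicit Types (B d : R).

Lemma sums_le_seq (X : choiceType) (S : set X) (f : X -> R) d (s : seq X) :
  sums_le S f d -> uniq s -> (forall x, x \in s -> S x) -> \sum_(x <- s) f x <= d.
Proof.
move=> h us sS; have ps : perm_eq s (seq_fset tt s).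
  by rewrite perm_sym; apply: perm_trans (seq_fset_perm _ _) _; rewrite undup_id.
rewrite (perm_big _ ps) /=.
by apply: (h (seq_fset tt s)) => x xs; apply: sS; rewrite (perm_mem ps).
Qed.

Lemma sums_le_inj (X Y : choiceType) (S : set X) (S' : set Y) (h : X -> Y) (f : Y -> R) d :
  injective h -> (forall x, S x -> S' (h x)) -> sums_le S' f d -> sums_le S (fun x => f (h x)) d.
Proof.
move=> hi hS hf G GS; rewrite -(big_map h xpredT f); apply: (sums_le_seq hf).
  by rewrite map_inj_uniq.
by move=> y /mapP[x xG ->]; apply: hS; exact: GS.
Qed.

Lemma sums_le_pair (X Y : choiceType) (S : set (X * Y)) (f : X * Y -> R) d (G : seq X) (H : seq Y) :
  sums_le S f d -> uniq G -> uniq H -> (forall x y, x \in G -> y \in H -> S (x, y)) ->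
  \sum_(x <- G) \sum_(y <- H) f (x, y) <= d.
Proof.
move=> hf uG uH GH.
rewrite -(big_allpairs_dep (h := pair) (r1 := G) (r2 := fun _ => H) (F := f)) /=.
apply: (sums_le_seq hf); first by rewrite allpairs_uniq => // -[? ?] [? ?].
by move=> p /allpairsP[[x y] /= [xG yH ->]]; exact: GH.
Qed.

Lemma ord_sum N (f : nat -> R) : \sum_(k < N) f k = \sum_(k <- iota 0 N) f k.
Proof. by rewrite -(big_mkord xpredT f) /index_iota subn0. Qed.

Lemma sums_le_ord (S : set nat) (f : nat -> R) d N : `I_N `<=` S -> sums_le S f d ->
  \sum_(k < N) f k <= d.
Proof.
move=> NS hf; rewrite ord_sum; apply: (sums_le_seq hf); first exact: iota_uniq.
by move=> k; rewrite mem_iota add0n => kN; exact: NS.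
Qed.

Lemma sums_rows_tail (S : set nat) (f : nat -> nat -> R) B (F0 : seq nat) d :
  (forall n k, S n -> S k -> 0 <= f n k) -> (forall n, S n -> sums_le S (f n) B) ->
  (forall n, n \in F0 -> S n) -> 0 < d ->
  exists2 F : {fset nat}, [set` F] `<=` S & forall n, n \in F0 -> sums_le (S `\` [set` F]) (f n) d.
Proof.
move=> f0 fB FS d0.
have h : sums_le S (fun k => \sum_(n <- F0) f n k) (\sum_(n <- F0) B).
  move=> G GS; rewrite exchange_big big_seq [leRHS]big_seq; apply: ler_sum => n nF.
  by apply: fB => //; exact: FS.
have [k Sk|F FSub hF] := sums_tail _ h d0.
  by rewrite big_seq; apply: sumr_ge0 => n nF; apply: f0 => //; exact: FS.
exists F => // n nF; apply: sums_le_mono hF => k [Sk _].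
rewrite (big_rem n)//= lerDl big_seq; apply: sumr_ge0 => i /mem_rem iF.
by apply: f0 => //; exact: FS.
Qed.

Lemma uniform_sums (X : choiceType) (S : set X) (T : R) (w : R -> X -> R) :
  (forall t, 0 <= t <= T -> exists B, sums_le S (w t) B) ->
  (forall t d, 0 <= t <= T -> 0 < d -> \forall s \near nbhs t, 0 <= s <= T ->
    exists2 D, sums_le S D d & forall x, S x -> w s x <= 2 * w t x + 2 * D x) ->
  exists B, forall s, 0 <= s <= T -> sums_le S (w s) B.
Proof.
move=> ws wc.
have := (@segment_compact R 0 T); rewrite compact_near_coveringP.
move=> /(_ nat \oo (fun N s => 0 <= s <= T -> sums_le S (w s) N%:R) _).
have h : forall t, `[0, T]%classic t -> \forall s \near t & N \near \oo,
    0 <= s <= T -> sums_le S (w s) N%:R.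
  move=> t /=; rewrite in_itv /= => tT; have [B hB] := ws t tT.
  have wt := wc t 1 tT ltr01.
  exists ([set s | 0 <= s <= T -> exists2 D, sums_le S D 1 &
            forall x, S x -> w s x <= 2 * w t x + 2 * D x],
          [set N : nat | 2 * B + 2 * 1 <= N%:R]) => /=.
    split => //; exact: nbhs_infty_ger.
  move=> [s N] /= [hs hN] sT; have [D hD hw] := hs sT.
  apply: sums_le_weak hN _; apply: (@sums_le_mono _ _ _ (fun x => 2 * w t x + 2 * D x)) => //.
  by apply: sums_leD; apply: sums_leZ.
move=> /(_ h)[N _ /(_ N (leqnn N)) hN]; exists N%:R => s sT; exact: hN.
Qed.

Lemma continuous_of_increments (T : R) (f : R -> R) :
  (forall t d, 0 <= t <= T -> 0 < d -> \forall s \near nbhs t, 0 <= s <= T -> `|f s - f t| <= d) ->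
  {within `[0, T], continuous f}.
Proof.
move=> h; apply/subspace_continuousP => t /=; rewrite in_itv /= => tT.
apply/cvgrPdist_le => d d0; rewrite /within /=.
apply: filterS (h t d tT d0) => s hs; rewrite /= in_itv /= => sT.
by rewrite distrC; exact: hs.
Qed.

Lemma near_norm_small (T t : R) (norm : R -> \bar R) (d : R) :
  norm s @[s --> within [set s : R | 0 <= s] (nbhs t)] --> 0%E -> 0 < d ->
  \forall s \near nbhs t, 0 <= s <= T -> (norm s < d%:E)%E.
Proof.
move=> h d0.
have : nbhs (0%E : \bar R) [set y | (y < d%:E)%E].
  by apply: open_nbhs_nbhs; split; [exact: open_ereal_lt_ereal|rewrite /= lte_fin].
move=> /h h1; have h2 : \forall s \near nbhs t, 0 <= s -> (norm s < d%:E)%E by exact: h1.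
by apply: filterS h2 => s hs /andP[s0 _]; exact: hs.
Qed.

End bounded_sums_tools.

(** * Bounds extracted from the data *)

Section model_constants.
Context {R : realType} (D : bloch_data R) (hD : standing_assumptions D).
Notation mu := (@lebesgue_measure R).
Notation L := (levels D).

Lemma ereal_sup_rows_le (X Y : choiceType) (S : set X) (S' : set Y) (f : X -> Y -> R) :
  (forall x y, S x -> S' y -> 0 <= f x y) ->
  (ereal_sup [set \esum_(y in S') (f x y)%:E | x in S] < +oo)%E ->
  exists2 B : R, 0 <= B & forall x, S x -> sums_le S' (f x) B.
Proof.
move=> f0 h; set s := ereal_sup _ in h.
have es0 x : S x -> (0 <= \esum_(y in S') (f x y)%:E)%E.
  by move=> Sx; apply: esum_ge0 => y Sy; rewrite lee_fin f0.
exists `|fine s| => // x Sx; apply: esum_le_sums => [y Sy|]; first exact: f0.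
have hs : (\esum_(y in S') (f x y)%:E <= s)%E by apply: ereal_sup_ubound; exists x.
have s0 : (0 <= s)%E := le_trans (es0 x Sx) hs.
by rewrite -fine_abse ?gee0_abs// ?fineK// ge0_fin_numE.
Qed.

Lemma V_rows : exists2 Vs : R, 0 <= Vs &
  forall n, L n -> sums_le L (fun k => cabs (Vc D n k)) Vs.
Proof.
have [|Vs Vs0 h] := @ereal_sup_rows_le _ _ L L (fun k n => cabs (Vc D n k)) _ (sa_V_summable hD).
  by move=> k n _ _; exact: cabs_ge0.
exists Vs => // n Ln; apply: sums_le_mono (h n Ln) => k Lk.
by rewrite (sa_V_herm hD Lk Ln) cabs_conj.
Qed.

Lemma W_rows_cols : exists2 Ws : R, 0 <= Ws & forall n, L n ->
  sums_le L (fun k => Wp D n k) Ws /\ sums_le L (fun k => Wp D k n) Ws.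
Proof.
have := sa_W_summable hD; set s1 := ereal_sup _; set s2 := ereal_sup _ => s12.
have W0 n k : L n -> L k -> 0 <= Wp D n k by move=> *; exact: sa_W_ge0.
have [[n0 Ln0]|L0] := pselect (exists n, L n); last first.
  by exists 0 => // n Ln; exfalso; apply: L0; exists n.
have s10 : (0 <= s1)%E.
  apply: (@le_trans _ _ (\esum_(n in L) (Wp D n n0)%:E)%E).
    by apply: esum_ge0 => n Ln; rewrite lee_fin W0.
  by apply: ereal_sup_ubound; exists n0.
have s20 : (0 <= s2)%E.
  apply: (@le_trans _ _ (\esum_(n in L) (Wp D n0 n)%:E)%E).
    by apply: esum_ge0 => n Ln; rewrite lee_fin W0.
  by apply: ereal_sup_ubound; exists n0.
have s1oo : (s1 < +oo)%E by apply: le_lt_trans s12; rewrite leeDl.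
have s2oo : (s2 < +oo)%E by apply: le_lt_trans s12; rewrite leeDr.
have [|B1 B10 h1] := @ereal_sup_rows_le _ _ L L (fun k n => Wp D n k) _ s1oo.
  by move=> *; exact: W0.
have [|B2 B20 h2] := @ereal_sup_rows_le _ _ L L (fun n k => Wp D n k) _ s2oo.
  by move=> *; exact: W0.
exists (B1 + B2); first exact: addr_ge0.
move=> n Ln; split.
  by apply: sums_le_weak (h2 n Ln); rewrite lerDr.
by apply: sums_le_weak (h1 n Ln); rewrite lerDl.
Qed.

Lemma rho0_l2 : exists2 B : R, 0 <= B & sums_le L (fun n => rho0 D n ^+ 2) B.
Proof.
have h := esum_lt_sums (sa_rho0_summable hD) (sa_rho0_ge0 hD).
set B := fine _ in h; have B0 := sums_le_ge0 h.
exists (B * B); first exact: mulr_ge0.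
apply: sums_le_mono (sums_leZ B0 h) => n Ln.
rewrite expr2 ler_wpM2r ?(sa_rho0_ge0 hD)//; exact: (sums_le_term h).
Qed.

Variables (e : R) (rho : R -> nat -> nat -> R[i]) (rho1 : R -> nat -> R).
Hypotheses (hrho : bloch_solution D e rho) (hrho1 : rate_solution D e rho1).

Let LL := L `*` L.

Lemma rho_near (T t d : R) : 0 <= t <= T -> 0 < d -> \forall s \near nbhs t, 0 <= s <= T ->
  sums_le LL (fun a => cabs (rho s a.1 a.2 - rho t a.1 a.2)) d.
Proof.
move=> /andP[t0 _] d0.
apply: filterS (near_norm_small T (bs_continuous hrho t0) d0) => s hs sT.
by apply: esum_le_sums (ltW (hs sT)) => a _; exact: cabs_ge0.
Qed.

Lemma rho_sums (t : R) : 0 <= t -> exists B, sums_le LL (fun a => cabs (rho t a.1 a.2)) B.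
Proof.
move=> t0; exists (fine (l1norm2 L (rho t))); apply: esum_lt_sums; last by move=> a _; exact: cabs_ge0.
exact: bs_l1 hrho _ t0.
Qed.

Lemma rho1_near (T t d : R) : 0 <= t <= T -> 0 < d -> \forall s \near nbhs t, 0 <= s <= T ->
  sums_le L (fun n => (rho1 s n - rho1 t n) ^+ 2) d.
Proof.
move=> /andP[t0 _] d0; have sd0 : 0 < Num.sqrt d by rewrite sqrtr_gt0.
have := sqr_sqrtr (ltW d0); set r := Num.sqrt d in sd0 * => <-.
apply: filterS (near_norm_small T (rs_continuous hrho1 t0) sd0) => s hs sT.
have := ltW (hs sT); rewrite /l2norm => h.
apply: (@esum_le_sums _ _ L) => [n _|]; first exact: sqr_ge0.
rewrite EFin_expe -lee_sqrt; last by rewrite -EFin_expe lee_fin sqr_ge0.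
rewrite sqrte_sqr gee0_abs ?lee_fin ?(ltW sd0)//.
rewrite (eq_esum (b := fun n => (cabs (ofR (rho1 s n - rho1 t n)) ^+ 2)%:E))// => n _.
by rewrite cabs_ofR real_normK// num_real.
Qed.

Lemma rho1_sums (t : R) : 0 <= t -> exists B, sums_le L (fun n => rho1 t n ^+ 2) B.
Proof.
move=> t0; exists (fine (\esum_(n in L) (rho1 t n ^+ 2)%:E)).
apply: esum_lt_sums; last by move=> a _; exact: sqr_ge0.
have := rs_l2 hrho1 t0; rewrite /l2norm.
set E := (\esum_(n in L) _)%E; set E' := (\esum_(n in L) _)%E.
have -> : E = E'.
  by apply: eq_esum => n _; rewrite cabs_ofR real_normK// num_real.
have E0 : (0 <= E')%E by apply: esum_ge0 => n _; rewrite lee_fin sqr_ge0.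
by move=> h; rewrite -ge0_fin_numE// -sqrte_fin_num// ge0_fin_numE// sqrte_ge0.
Qed.

End model_constants.

Section rates.
Context {R : realType} (D : bloch_data R) (hD : standing_assumptions D).
Variables (eta Ceta : R).
Hypotheses (eta_gt0 : 0 < eta) (Ceta_gt0 : 0 < Ceta)
  (ha : small_divisors D eta Ceta) (hb : wave_regularity D eta).
Notation mu := (@lebesgue_measure R).
Notation Re := complex.Re.
Notation Im := complex.Im.
Notation L := (levels D).
Variables (g0 C0 T : R).
Hypotheses (g00 : 0 < g0) (C00 : 0 <= C0) (T0 : 0 <= T).
Hypothesis g0_le : forall n m, L n -> L m -> n != m -> g0 <= gam D n m.
Hypothesis C0_le : forall (F : {fset 'rV[int]_(nfreq D)}) (S : R), 1 <= S ->
  \sum_(a <- F) \sum_(b <- F | b != a) cabs (phi_hat D a) * cabs (phi_hat D b) *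
    Num.min S (2 / `|freq_dot b (freq D) - freq_dot a (freq D)|) <= C0 * Num.sqrt S.

Variable e : R.
Hypotheses (e0 : 0 < e) (e1 : e <= 1).
Notation q := (e `^ muexp D).

Lemma q_gt0 : 0 < q. Proof. exact: powR_gt0. Qed.
Lemma q_le1 : q <= 1.
Proof. by rewrite -(powRr0 e) ger_powR ?e0//; exact: sa_mu_ge0 hD. Qed.
Lemma e_le_q2 : e <= q ^+ 2.
Proof.
have h : q ^+ 2 = e `^ (muexp D + muexp D).
  by rewrite expr2 powRD// (gt_eqF e0) implybT.
rewrite h -[leLHS]powRr1 ?(ltW e0)// ger_powR ?e0//.
have := sa_mu_lt hD; lra.
Qed.

Lemma Psi_sym (tau : R) k n : L k -> L n -> Psi D e tau k n = Psi D e tau n k.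
Proof.
move=> Lk Ln; rewrite !Psi_kernelE; congr (_ * _).
  by rewrite (sa_V_herm hD Ln Lk) nsq_conj.
apply: integral_ext => s _; have -> : relax_rate D e k n = relax_rate D e n k.
  by rewrite /relax_rate (sa_gam_sym hD Lk Ln).
have -> : om_eps D e k n = - om_eps D e n k by rewrite /om_eps /om2 /dl2; ring.
by rewrite [X in cos X]mulNr cosN.
Qed.

(** The kernel is even in the transition frequency. *)
Lemma avg_Psi_sym k n : L k -> L n -> avg_Psi D e k n = avg_Psi D e n k.
Proof.
move=> Lk Ln; have h : (fun s => Psi_mean D e k n s) = (fun s => Psi_mean D e n k s).
  apply/funext => s; rewrite /Psi_mean.
  by rewrite (integral_ext (fun tau _ => Psi_sym tau Lk Ln)).
exact: (congr1 (fun f : R -> R => lim (f @ +oo)) h).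
Qed.

Lemma relax_rate_ge k n : L k -> L n -> k != n -> q * g0 <= relax_rate D e k n.
Proof. by move=> Lk Ln kn; rewrite ler_wpM2l ?powR_ge0 ?g0_le. Qed.

Let B := wave_energy D.
Let B0 : 0 <= B := wave_energy_ge0 hD.

Definition rate_const : R := 2 * B / g0.

Lemma avg_Psi_bounds k n : L k -> L n -> k != n ->
  0 <= avg_Psi D e k n <= rate_const / q * nsq (Vc D k n).
Proof.
move=> Lk Ln kn; rewrite (avg_PsiE hD eta_gt0 Ceta_gt0 ha hb)// avg_Psi_explicitE//.
have /andP[r0 r1] := resonance_sum_bounds hD e0 Lk Ln kn.
have V0 := nsq_ge0 (Vc D n k).
have qg : 0 < q * g0 by rewrite mulr_gt0 ?q_gt0.
have h : B / relax_rate D e k n <= B / (q * g0).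
  rewrite ler_wpM2l// lef_pV2 ?posrE ?relax_rate_ge//.
  exact: lt_le_trans (relax_rate_ge Lk Ln kn).
apply/andP; split; first by rewrite !mulr_ge0.
have -> : rate_const / q * nsq (Vc D k n) = 2 * nsq (Vc D k n) * (B / (q * g0)).
  by rewrite /rate_const invfM; ring.
have -> : nsq (Vc D n k) = nsq (Vc D k n) by rewrite (sa_V_herm hD Ln Lk) nsq_conj.
apply: ler_wpM2l; [by nonneg|exact: le_trans r1 h].
Qed.

Let e20 : 0 < e ^+ 2. Proof. by rewrite exprn_gt0. Qed.

Definition slow_response k n (t : R) : R[i] := response D e k n (t / e ^+ 2).

Let slow_ge0 (t : R) : 0 <= t -> 0 <= t / e ^+ 2.
Proof. by move=> t0; rewrite divr_ge0// ltW. Qed.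

Lemma slow_response_prim k n : cprimitive T (slow_response k n) (fun t =>
  (- imag * ofR (om_eps D e k n) - ofR (q * gam D k n)) * ofR (e ^- 2) *
    slow_response k n t + ofR (e ^- 2 * phi D (t / e ^+ 2))).
Proof.
have := cprimitive_scale e20 (response_prim hD e k n (slow_ge0 T0)).
apply: cprimitive_ext => t _; rewrite /slow_response /relax_rate !ofRM; ring.
Qed.

Lemma slow_response0 k n : slow_response k n 0 = 0.
Proof. by rewrite /slow_response mul0r; exact: memory0. Qed.

Lemma slow_response_herm k n t : L k -> L n -> 0 <= t ->
  slow_response n k t = conjc (slow_response k n t).
Proof.
move=> Lk Ln t0; have [M phiM] := sa_phi_bounded hD.
rewrite -(memory_conj (sa_phi_measurable hD) phiM) ?slow_ge0// /slow_response /response.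
rewrite /relax_rate (sa_gam_sym hD Ln Lk).
by congr memory; rewrite /om_eps /om2 /dl2; ring.
Qed.

(** This stays small because the average has been subtracted; it is the
    coefficient of the corrector that removes the oscillations of the rate. *)
Definition rate_corrector k n (t : R) : R :=
  \int[mu]_(s in `[0, t]) (Psi D e (s / e ^+ 2) k n - avg_Psi D e k n).

Let bPsi k n : bmeas 0 T (fun s => Psi D e (s / e ^+ 2) k n).
Proof. exact: bmeas_scale e20 (Psi_bmeas hD e k n (slow_ge0 T0)). Qed.

Lemma rate_corrector_prim k n : L k -> L n -> primitive T (rate_corrector k n) (fun s =>
  2 * nsq (Vc D k n) * phi D (s / e ^+ 2) * Re (slow_response k n s) - avg_Psi D e k n).
Proof.
move=> Lk Ln; have h : primitive T (rate_corrector k n)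
    (fun s => Psi D e (s / e ^+ 2) k n - avg_Psi D e k n).
  split; first by apply: bmeasB => //; exact: bmeas_cst.
  by move=> t _; rewrite /rate_corrector integral_point add0r.
apply: primitive_ext h => s /andP[s0 _].
by rewrite (Psi_response hD) ?slow_ge0// (sa_V_herm hD Lk Ln) nsq_conj mulrA.
Qed.

Definition corrector_const : R := 2 * (C0 * Num.sqrt (1 + T) / g0 + 2 * B / g0 ^+ 2).

(** In fast time the interval has length at most [T / e ^ 2], so that the error is
    of order [1 / (e q)]; the change of time scale contributes [e ^ 2]. *)
Lemma rate_corrector_le k n t : L k -> L n -> k != n -> 0 <= t <= T ->
  `|rate_corrector k n t| <= corrector_const * (e / q) * nsq (Vc D k n).
Proof.
move=> Lk Ln kn /andP[t0 tT].
have bt : bmeas 0 t (fun s => Psi D e (s / e ^+ 2) k n) by apply: bmeasS (bPsi k n).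
rewrite /rate_corrector integralB//; last exact: bmeas_cst.
have hI : \int[mu]_(s in `[0, t]) Psi D e (s / e ^+ 2) k n =
    e ^+ 2 * \int[mu]_(s in `[0, t / e ^+ 2]) Psi D e s k n.
  exact: (integral_scaleb e20 t0 (Psi_bmeas hD e k n (slow_ge0 t0))).
rewrite integral_cst// subr0 hI.
rewrite (avg_PsiE hD eta_gt0 Ceta_gt0 ha hb)//.
have h := Psi_integral_le hD Ceta_gt0 ha e0 Lk Ln kn C00 (slow_ge0 t0) C0_le.
set I := \int[mu]_(s in _) _ in h *; set E := avg_Psi_explicit D e k n in h *.
have -> : e ^+ 2 * I - E * t = e ^+ 2 * (I - t / e ^+ 2 * E).
  by field; rewrite gt_eqF.
rewrite normrM (ger0_norm (ltW e20)).
apply: (@le_trans _ _ (e ^+ 2 * (2 * nsq (Vc D n k) * averaging_error D e k n C0 (t / e ^+ 2)))).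
  by rewrite ler_wpM2l ?(ltW e20).
rewrite (sa_V_herm hD Lk Ln) nsq_conj.
have V0 := nsq_ge0 (Vc D k n); set v := nsq _ in V0 *.
have -> : e ^+ 2 * (2 * v * averaging_error D e k n C0 (t / e ^+ 2)) =
  2 * (e ^+ 2 * averaging_error D e k n C0 (t / e ^+ 2)) * v by ring.
rewrite ler_wpM2r// /corrector_const -mulrA ler_wpM2l//.
rewrite /averaging_error; set g := relax_rate D e k n.
have qg0 : 0 < q * g0 by rewrite mulr_gt0 ?q_gt0.
have gle : q * g0 <= g by exact: relax_rate_ge.
have gpos : 0 < g by exact: lt_le_trans gle.
have ig : g^-1 <= (q * g0)^-1 by rewrite lef_pV2 ?posrE.
have q0 := q_gt0; have q1 := q_le1; have eq2 := e_le_q2.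
have sq : e * Num.sqrt (1 + t / e ^+ 2) <= Num.sqrt (1 + T).
  rewrite -{1}(ger0_norm (ltW e0)) -sqrtr_sqr -sqrtrM ?sqr_ge0// ler_wsqrtr//.
  rewrite mulrDr mulr1 mulrCA divff ?gt_eqF// mulr1 lerD//.
  by rewrite expr_le1 // ltW.
have s0 := sqrtr_ge0 (1 + t / e ^+ 2).
have ig0 : 0 <= g^-1 by rewrite invr_ge0 ltW.
rewrite [leLHS]mulrDr [leRHS]mulrDl lerD//.
  apply: (@le_trans _ _ (e * (C0 * Num.sqrt (1 + T) * (q * g0)^-1))).
    have -> : e ^+ 2 * (C0 * Num.sqrt (1 + t / e ^+ 2) / g) =
      e * (C0 * (e * Num.sqrt (1 + t / e ^+ 2)) * g^-1) by ring.
    rewrite ler_wpM2l ?(ltW e0)//; apply: ler_pM => //; last by rewrite ler_wpM2l.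
    by rewrite !mulr_ge0// ltW.
  by rewrite invfM; apply: eq_ler; ring.
apply: (@le_trans _ _ (e ^+ 2 * (2 * B * ((q * g0)^-1) ^+ 2))).
  rewrite ler_wpM2l ?(ltW e20)// -exprVn ler_wpM2l ?mulr_ge0//.
  by rewrite ler_sqr ?nnegrE// invr_ge0 ltW.
have -> : e ^+ 2 * (2 * B * ((q * g0)^-1) ^+ 2) = 2 * B / g0 ^+ 2 * ((e / q) * (e / q)).
  by rewrite invfM -exprVn; ring.
rewrite ler_wpM2l ?mulr_ge0 ?invr_ge0 ?sqr_ge0//.
have eq0 : 0 <= e / q by rewrite divr_ge0 ?ltW.
rewrite ler_piMr// ler_pdivrMr// mul1r; apply: (le_trans eq2).
by rewrite expr2 ler_piMr// ltW.
Qed.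

End rates.

(** * The equations as integral equations *)

Section complex_bounded.
Context {R : realType} (a b : R).
Notation Re := complex.Re.
Notation Im := complex.Im.
Implicit Types (z w : R -> R[i]).

Definition cbmeas z := bmeas a b (fun t => Re (z t)) /\ bmeas a b (fun t => Im (z t)).

Lemma cbmeasD z w : cbmeas z -> cbmeas w -> cbmeas (fun t => z t + w t).
Proof.
move=> [z1 z2] [w1 w2]; split.
  by apply: (bmeas_ext (f := fun t => Re (z t) + Re (w t))) => [t _|]; [rewrite ReD|exact: bmeasD].
by apply: (bmeas_ext (f := fun t => Im (z t) + Im (w t))) => [t _|]; [rewrite ImD|exact: bmeasD].
Qed.

Lemma cbmeasM z w : cbmeas z -> cbmeas w -> cbmeas (fun t => z t * w t).
Proof.
move=> [z1 z2] [w1 w2]; split.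
  apply: (bmeas_ext (f := fun t => Re (z t) * Re (w t) - Im (z t) * Im (w t))) => [t _|].
    by rewrite ReM.
  by apply: bmeasB; exact: bmeasM.
apply: (bmeas_ext (f := fun t => Re (z t) * Im (w t) + Im (z t) * Re (w t))) => [t _|].
  by rewrite ImM.
by apply: bmeasD; exact: bmeasM.
Qed.

Lemma cbmeas_cst (c : R[i]) : cbmeas (fun=> c).
Proof. by split; exact: bmeas_cst. Qed.

Lemma cbmeas_ofR (f : R -> R) : bmeas a b f -> cbmeas (fun t => ofR (f t)).
Proof. by move=> h; split => //; exact: bmeas_cst. Qed.

Lemma cbmeas_ext z w : (forall t, a <= t <= b -> z t = w t) -> cbmeas z -> cbmeas w.
Proof. by move=> zw [z1 z2]; split; [apply: bmeas_ext z1|apply: bmeas_ext z2] => t tab; rewrite zw. Qed.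

End complex_bounded.

Lemma csum_ext (R : realType) (S : set nat) (f g : nat -> R[i]) :
  (forall k, S k -> f k = g k) -> csum S f = csum S g.
Proof.
move=> fg; apply: complexP => /=; apply: (congr1 (fun u : nat -> R => limn u));
  by apply/funext => N; apply: eq_bigr => k /set_mem Sk; rewrite fg.
Qed.

Lemma ofRB (R : realType) (x y : R) : ofR (x - y) = ofR x - ofR y.
Proof. by rewrite ofRD ofRN. Qed.

Section equations.
Context {R : realType} (D : bloch_data R) (hD : standing_assumptions D).
Notation mu := (@lebesgue_measure R).
Notation Re := complex.Re.
Notation Im := complex.Im.
Notation L := (levels D).
Notation LL := (levels D `*` levels D).
Variables (e T : R) (rho : R -> nat -> nat -> R[i]) (rho1 : R -> nat -> R).
Hypotheses (e0 : 0 < e) (T0 : 0 <= T).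
Hypotheses (hrho : bloch_solution D e rho) (hrho1 : rate_solution D e rho1).

(** Continuity with values in [l^1]. *)
Definition l1_continuous (f : R -> nat -> R[i]) :=
  (forall t, 0 <= t <= T -> exists B, sums_le L (fun k => cabs (f t k)) B) /\
  (forall t d, 0 <= t <= T -> 0 < d -> \forall s \near nbhs t, 0 <= s <= T ->
    sums_le L (fun k => cabs (f s k - f t k)) d).

Lemma l1_continuousB f g : l1_continuous f -> l1_continuous g ->
  l1_continuous (fun t k => f t k - g t k).
Proof.
move=> [f1 f2] [g1 g2]; split => [t tT|t d tT d0].
  have [B hB] := f1 t tT; have [B' hB'] := g1 t tT; exists (B + B').
  by apply: sums_le_mono (sums_leD hB hB') => k _; exact: cabsB_le.
have d2 : 0 < d / 2 by rewrite divr_gt0.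
apply: filterS2 (f2 t _ tT d2) (g2 t _ tT d2) => s hf hg sT.
have -> : d = d / 2 + d / 2 by field.
apply: sums_le_mono (sums_leD (hf sT) (hg sT)) => k _.
have -> : f s k - g s k - (f t k - g t k) = (f s k - f t k) - (g s k - g t k) by ring.
exact: cabsB_le.
Qed.

(** The sum is a continuous functional on [l^1]. *)
Lemma csum_continuous f : l1_continuous f ->
  {within `[0, T], continuous (fun s => Re (csum L (f s)))} /\
  {within `[0, T], continuous (fun s => Im (csum L (f s)))}.
Proof.
move=> [f1 f2].
have h t d : 0 <= t <= T -> 0 < d -> \forall s \near nbhs t, 0 <= s <= T ->
    cabs (csum L (f s) - csum L (f t)) <= d.
  move=> tT d0; apply: filterS (f2 t d tT d0) => s hs sT.
  have [B hB] := f1 t tT; have [B' hB'] := f1 s sT.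
  by rewrite -(csumB hB' hB); apply: csum_le; exact: hs.
split; apply: continuous_of_increments => t d tT d0.
  apply: filterS (h t d tT d0) => s hs sT; rewrite -ReB.
  exact: le_trans (Re_le_cabs _) (hs sT).
apply: filterS (h t d tT d0) => s hs sT; rewrite -ImB.
exact: le_trans (Im_le_cabs _) (hs sT).
Qed.

Lemma csum_cbmeas f : l1_continuous f -> cbmeas 0 T (fun s => csum L (f s)).
Proof. by move=> /csum_continuous[c1 c2]; split; exact: bmeas_continuous. Qed.

Lemma rho_entry_near t d n m : L n -> L m -> 0 <= t <= T -> 0 < d ->
  \forall s \near nbhs t, 0 <= s <= T -> cabs (rho s n m - rho t n m) <= d.
Proof.
move=> Ln Lm tT d0; apply: filterS (rho_near hrho tT d0) => s hs sT.
exact: (sums_le_term (hs sT) (x := (n, m))).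
Qed.

Lemma rho_cbmeas n m : L n -> L m -> cbmeas 0 T (fun s => rho s n m).
Proof.
move=> Ln Lm; split; apply: bmeas_continuous; apply: continuous_of_increments => t d tT d0.
  apply: filterS (rho_entry_near Ln Lm tT d0) => s hs sT; rewrite -ReB.
  exact: le_trans (Re_le_cabs _) (hs sT).
apply: filterS (rho_entry_near Ln Lm tT d0) => s hs sT; rewrite -ImB.
exact: le_trans (Im_le_cabs _) (hs sT).
Qed.

(** [h] is the injection onto a row, a column or the diagonal. *)
Lemma l1_continuous_entries (c : nat -> R[i]) (K : R) (h : nat -> nat * nat) :
  injective h -> (forall k, L k -> LL (h k)) -> 0 <= K -> (forall k, L k -> cabs (c k) <= K) ->
  l1_continuous (fun t k => c k * rho t (h k).1 (h k).2).
Proof.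
move=> hi hL K0 cK; split => [t tT|t d tT d0].
  have [B hB] := rho_sums hrho (proj1 (andP tT)); exists (K * B).
  apply: sums_le_mono (sums_leZ K0 (sums_le_inj hi hL hB)) => k Lk.
  by rewrite cabsM ler_wpM2r ?cabs_ge0// cK.
have dK : 0 < d / (K + 1) by rewrite divr_gt0//; lra.
apply: filterS (rho_near hrho tT dK) => s hs sT.
have := sums_leZ K0 (sums_le_inj hi hL (hs sT)).
move=> /(sums_le_weak (B := d)) h1; apply: sums_le_mono (h1 _) => [k Lk|].
  by rewrite -mulrBr cabsM ler_wpM2r ?cabs_ge0// cK.
have K1 : 0 < K + 1 by lra.
rewrite mulrA ler_pdivrMr// mulrC ler_wpM2l ?(ltW d0)//; lra.
Qed.

Lemma l1_continuous_entry (c : nat -> R[i]) (K : R) n m : L n -> L m ->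
  sums_le L (fun k => cabs (c k)) K -> l1_continuous (fun t k => c k * rho t n m).
Proof.
move=> Ln Lm cK; have K0 := sums_le_ge0 cK; split => [t tT|t d tT d0].
  exists (cabs (rho t n m) * K); apply: sums_le_mono (sums_leZ (cabs_ge0 _) cK) => k _.
  by rewrite cabsM mulrC.
have dK : 0 < d / (K + 1) by rewrite divr_gt0//; lra.
apply: filterS (rho_entry_near Ln Lm tT dK) => s hs sT.
have K1 : 0 < K + 1 by lra.
apply: sums_le_weak (_ : d / (K + 1) * K <= d) _.
  rewrite mulrAC ler_pdivrMr// ler_wpM2l ?(ltW d0)//; lra.
have dK0 : 0 <= d / (K + 1) by rewrite ltW.
apply: sums_le_mono (sums_leZ dK0 cK) => k _.
by rewrite -mulrBr cabsM mulrC ler_wpM2r ?cabs_ge0// hs.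
Qed.

Lemma l1_continuous_W n : L n ->
  l1_continuous (fun s k => ofR (Wp D k n) * rho s k k - ofR (Wp D n k) * rho s n n).
Proof.
move=> Ln; have [Ws Ws0 hW] := W_rows_cols hD.
have [W1 W2] := hW n Ln.
apply: l1_continuousB.
  apply: (l1_continuous_entries (h := fun k => (k, k)) _ _ Ws0) => [k k' []|k Lk|k Lk] //.
  by rewrite cabs_ofR ger0_norm ?(sa_W_ge0 hD)//; exact: (sums_le_term W2).
apply: (@l1_continuous_entry _ Ws) => //.
apply: sums_le_mono W1 => k Lk; by rewrite cabs_ofR ger0_norm ?(sa_W_ge0 hD).
Qed.

Lemma l1_continuous_V n m : L n -> L m ->
  l1_continuous (fun s k => Vc D n k * rho s k m - Vc D k m * rho s n k).
Proof.
move=> Ln Lm; have [Vs Vs0 hV] := V_rows hD.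
apply: l1_continuousB.
  apply: (l1_continuous_entries (h := fun k => (k, m)) _ _ Vs0) => [k k' []|k Lk|k Lk] //.
  exact: (sums_le_term (hV n Ln)).
apply: (l1_continuous_entries (h := fun k => (n, k)) _ _ Vs0) => [k k' []|k Lk|k Lk] //.
by rewrite (sa_V_herm hD Lm Lk) cabs_conj; exact: (sums_le_term (hV m Lm)).
Qed.

Definition slow_wave (s : R) : R := phi D (s / e ^+ 2).

Lemma slow_wave_bmeas : bmeas 0 T slow_wave.
Proof.
have [M phiM] := sa_phi_bounded hD; apply: bmeas_scale; first by rewrite exprn_gt0.
by split; [exact: measurable_funS (sa_phi_measurable hD)|exists M].
Qed.

Lemma wave_csum n m s : L n -> L m -> 0 <= s <= T ->
  csum L (fun k => wave_potential D (s / e ^+ 2) n k * rho s k m -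
                   wave_potential D (s / e ^+ 2) k m * rho s n k) =
  ofR (slow_wave s) * csum L (fun k => Vc D n k * rho s k m - Vc D k m * rho s n k).
Proof.
move=> Ln Lm sT; have [/(_ s sT)[B hB] _] := l1_continuous_V Ln Lm.
rewrite -(csumZ _ hB); congr csum; apply/funext => k.
by rewrite /wave_potential /slow_wave; ring.
Qed.

Lemma bloch_rhs_cbmeas n m : L n -> L m -> cbmeas 0 T (fun s => bloch_rhs D e s (rho s) n m).
Proof.
move=> Ln Lm; apply: cbmeasD; first apply: cbmeasD.
- by apply: cbmeasM; [exact: cbmeas_cst|exact: rho_cbmeas].
- rewrite /relaxation; case: eqVneq => [_|_].
    by apply: cbmeasM; [exact: cbmeas_cst|exact: csum_cbmeas (l1_continuous_W Ln)].
  by apply: cbmeasM; [exact: cbmeas_cst|exact: rho_cbmeas].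
- apply: cbmeasM; first exact: cbmeas_cst.
  apply: (cbmeas_ext (z := fun s => ofR (slow_wave s) *
     csum L (fun k => Vc D n k * rho s k m - Vc D k m * rho s n k))) => [s sT|].
    by rewrite wave_csum.
  apply: cbmeasM; first exact: cbmeas_ofR slow_wave_bmeas.
  exact: csum_cbmeas (l1_continuous_V Ln Lm).
Qed.

Lemma rho_prim n m : L n -> L m ->
  cprimitive T (fun s => rho s n m) (fun s => ofR (e ^- 2) * bloch_rhs D e s (rho s) n m).
Proof.
move=> Ln Lm; have [b1 b2] := bloch_rhs_cbmeas Ln Lm.
have e20 : 0 < e ^+ 2 by rewrite exprn_gt0.
have eq t : 0 <= t <= T -> rho t n m = rho 0 n m +
    ofR (e ^- 2) * cintegral `[0, t] (fun s => bloch_rhs D e s (rho s) n m).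
  move=> /andP[t0 tT]; rewrite -(bs_equation hrho t0 Ln Lm) mulrA -ofRM mulVf ?gt_eqF//.
  by rewrite ofR1 mul1r addrC subrK.
have bS t f : 0 <= t <= T -> bmeas 0 T f -> bmeas 0 t f.
  by move=> /andP[t0 tT]; exact: bmeasS.
split; split.
- by apply: (bmeas_ext _ (bmeasZ (e ^- 2) b1)) => s _; rewrite ReM Re_ofR Im_ofR mul0r subr0.
- move=> t tT; rewrite {1}eq// ReD ReM Re_ofR Im_ofR mul0r subr0 /=; congr (_ + _).
  rewrite -integralZ; last exact: bS b1.
  by apply: integral_ext => s _; rewrite ReM Re_ofR Im_ofR mul0r subr0.
- by apply: (bmeas_ext _ (bmeasZ (e ^- 2) b2)) => s _; rewrite ImM Re_ofR Im_ofR mul0r addr0.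
- move=> t tT; rewrite {1}eq// ImD ImM Re_ofR Im_ofR mul0r addr0 /=; congr (_ + _).
  rewrite -integralZ; last exact: bS b2.
  by apply: integral_ext => s _; rewrite ImM Re_ofR Im_ofR mul0r addr0.
Qed.

Lemma rsum_setD1 (S : set nat) n (f : nat -> R) :
  rsum (S `\ n) f = rsum S (fun k => if k == n then 0 else f k).
Proof.
rewrite /rsum; apply: (congr1 (fun u : nat -> R => limn u)); apply/funext => N.
rewrite big_mkcond [RHS]big_mkcond; apply: eq_bigr => k _.
case: eqVneq => [->|kn].
  have -> : (n \in S `\ n) = false by apply/negbTE/negP => /set_mem[_]; apply.
  by case: ifP.
suff -> : (k \in S `\ n) = (k \in S) by [].
apply/idP/idP => /set_mem; first by case=> Sk _; exact: mem_set.
by move=> Sk; apply: mem_set; split => //; exact/eqP.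
Qed.

Variables (r : nat -> nat -> R) (Bs : R).
Hypotheses (Bs0 : 0 <= Bs) (r_ge0 : forall k n, L k -> L n -> 0 <= r k n)
  (r_row : forall n, L n -> sums_le L (r n) Bs)
  (r_col : forall n, L n -> sums_le L (r ^~ n) Bs).

Definition exchange_term s n k : R[i] :=
  ofR (r k n) * ofR (rho1 s k) - ofR (r n k) * ofR (rho1 s n).

Lemma rho1_sup_near t d : 0 <= t <= T -> 0 < d -> \forall s \near nbhs t, 0 <= s <= T ->
  forall k, L k -> `|rho1 s k - rho1 t k| <= d.
Proof.
move=> tT d0; have dd : 0 < d ^+ 2 by rewrite exprn_gt0.
apply: filterS (rho1_near hrho1 tT dd) => s hs sT k Lk.
rewrite -(ler_pXn2r (n := 2)) ?nnegrE ?(ltW d0)// real_normK ?num_real//.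
exact: (sums_le_term (hs sT)).
Qed.

Lemma rho1_sup t : 0 <= t <= T -> exists2 B, 0 <= B & forall k, L k -> `|rho1 t k| <= B.
Proof.
move=> /andP[t0 _]; have [B hB] := rho1_sums hrho1 t0; exists (B + 1).
  by rewrite addr_ge0 ?(sums_le_ge0 hB).
move=> k Lk; have h : rho1 t k ^+ 2 <= B := sums_le_term hB Lk.
rewrite -real_normK ?num_real// in h.
have B0 := sums_le_ge0 hB; have := sqr_ge0 (`|rho1 t k| - 1); nra.
Qed.

Let l1_continuous_weights (c : nat -> R) (y : R -> nat -> R) :
  (forall k, L k -> 0 <= c k) -> sums_le L c Bs ->
  (forall t, 0 <= t <= T -> exists2 B, 0 <= B & forall k, L k -> `|y t k| <= B) ->
  (forall t d, 0 <= t <= T -> 0 < d -> \forall s \near nbhs t, 0 <= s <= T ->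
    forall k, L k -> `|y s k - y t k| <= d) ->
  l1_continuous (fun t k => ofR (c k) * ofR (y t k)).
Proof.
move=> c0 cB yB yc; split=> [t tT|t d tT d0].
  have [B B0 hB] := yB t tT; exists (B * Bs).
  apply: sums_le_mono (sums_leZ B0 cB) => k Lk.
  by rewrite cabsM !cabs_ofR (ger0_norm (c0 k Lk)) mulrC ler_wpM2r ?c0 ?hB.
have K1 : 0 < Bs + 1 by rewrite ltr_wpDl.
have dK : 0 < d / (Bs + 1) by rewrite divr_gt0.
apply: filterS (yc t _ tT dK) => s hs sT.
apply: sums_le_weak (_ : d / (Bs + 1) * Bs <= d) _.
  by rewrite mulrAC ler_pdivrMr// ler_wpM2l ?(ltW d0)// lerDl.
apply: sums_le_mono (sums_leZ (ltW dK) cB) => k Lk.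
by rewrite -mulrBr -ofRB cabsM !cabs_ofR (ger0_norm (c0 k Lk)) mulrC ler_wpM2r ?c0 ?hs.
Qed.

Lemma l1_continuous_exchange n : L n -> l1_continuous (fun s k => exchange_term s n k).
Proof.
move=> Ln; apply: l1_continuousB.
  apply: (l1_continuous_weights _ (r_col Ln)) => [k Lk|t tT|t d tT d0].
  - exact: r_ge0.
  - exact: rho1_sup.
  - exact: rho1_sup_near.
apply: (l1_continuous_weights (y := fun s _ => rho1 s n) _ (r_row Ln)) => [k Lk|t tT|t d tT d0].
- exact: r_ge0.
- by have [B B0 hB] := rho1_sup tT; exists B => // k _; exact: hB.
- by apply: filterS (rho1_sup_near tT d0) => s hs sT k _; exact: hs.
Qed.

Hypothesis r_rate : forall k n, L k -> L n -> k != n -> r k n = avg_Psi D e k n + Wp D k n.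
Hypothesis r_diag : forall n, r n n = 0.

Lemma sharp_exchange s n : L n ->
  ofR (sharp L (fun k m => avg_Psi D e k m + Wp D k m) (rho1 s) n) = csum L (exchange_term s n).
Proof.
move=> Ln; rewrite /sharp rsum_setD1 -csum_ofR; apply: csum_ext => k Lk.
rewrite /exchange_term -!ofRM -ofRB; case: eqVneq => [->|kn].
  by rewrite r_diag !mul0r subrr.
by rewrite !r_rate// eq_sym.
Qed.

Lemma rho1_prim n : L n ->
  primitive T (fun s => rho1 s n) (fun s => Re (csum L (exchange_term s n))).
Proof.
move=> Ln; apply: primitive_derive.
- apply: continuous_of_increments => t d tT d0.
  by apply: filterS (rho1_sup_near tT d0) => s hs sT; exact: hs.
- exact: (csum_continuous (l1_continuous_exchange Ln)).1.
- move=> t /andP[t0 _]; rewrite -sharp_exchange// Re_ofR.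
  exact: rs_equation hrho1 t n t0 Ln.
Qed.

End equations.

(** * Exchange with high levels *)

Section level_tails.
Context {R : realType} (L : set nat) (T : R).
Notation LN N := (L `\` `I_N).

Let LN_sub (F : {fset nat}) N : [set` F] `<=` `I_N -> LN N `<=` L `\` [set` F].
Proof. by move=> FN k [Lk kN]; split => // kF; apply: kN; exact: FN. Qed.

(** The tails of [x] are uniform in time, so that only finitely many levels [n]
    matter, and for each of these the coefficients have small tails. *)
Lemma exchange_tail (w : nat -> nat -> R) (x : R -> nat -> R) (Ws Bx : R) :
  0 <= Ws -> (forall n k, L n -> L k -> 0 <= w n k) ->
  (forall n, L n -> sums_le L (w n) Ws) -> (forall n, L n -> sums_le L (w ^~ n) Ws) ->
  (forall s n, 0 <= s <= T -> L n -> 0 <= x s n) ->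
  (forall s, 0 <= s <= T -> sums_le L (x s) Bx) ->
  (forall d, 0 < d -> exists2 F : {fset nat}, [set` F] `<=` L &
     forall s, 0 <= s <= T -> sums_le (L `\` [set` F]) (x s) d) ->
  forall d, 0 < d -> exists2 F : {fset nat}, [set` F] `<=` L &
    forall N s, `I_N `<=` L -> [set` F] `<=` `I_N -> 0 <= s <= T ->
      sums_le (LN N) (fun k => \sum_(n < N) (w k n * x s k + w n k * x s n)) d.
Proof.
move=> Ws0 w0 wr wc x0 xB xt d d0.
have d1 : 0 < d / (4 * (Ws + 1)) by rewrite divr_gt0// mulr_gt0// ltr_wpDl.
have [F1 F1L hF1] := xt _ d1; set d' := d / _ in d1 hF1.
have [Bx1 hB1 hB2] : exists2 B1, 0 < B1 & Bx <= B1.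
  by exists (`|Bx| + 1); [rewrite ltr_wpDl|rewrite (le_trans (ler_norm _))// lerDl].
have d2 : 0 < d / (2 * Bx1) by rewrite divr_gt0// mulr_gt0.
have [F2 F2L hF2] := sums_rows_tail (F0 := F1) w0 wr (fun n nF => F1L n nF) d2.
set d'' := d / (2 * Bx1) in d2 hF2.
exists (F1 `|` F2)%fset.
  by move=> k /=; rewrite in_fsetU => /orP[/F1L|/F2L].
move=> N s NL FN sT G GN.
have F1N : [set` F1] `<=` `I_N by move=> k kF; apply: FN; rewrite /= in_fsetU; apply/orP; left.
have F2N : [set` F2] `<=` `I_N by move=> k kF; apply: FN; rewrite /= in_fsetU; apply/orP; right.
have GL k : k \in G -> L k by move=> /GN[].
under eq_bigr do rewrite big_split /=.
rewrite big_split /=.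
have h1 : \sum_(k <- G) \sum_(n < N) w k n * x s k <= Ws * d'.
  apply: (@le_trans _ _ (\sum_(k <- G) Ws * x s k)).
    rewrite big_seq [leRHS]big_seq; apply: ler_sum => k kG; rewrite -mulr_suml.
    apply: ler_wpM2r; first exact: x0 sT (GL k kG).
    exact: (sums_le_ord NL (wr k (GL k kG))).
  rewrite -mulr_sumr ler_wpM2l//; apply: (hF1 s sT) => k kG; apply: (LN_sub F1N).
  exact: GN.
have h2 : \sum_(k <- G) \sum_(n < N) w n k * x s n <=
    \sum_(n < N) (d'' * x s n + Ws * (if (n : nat) \in F1 then 0 else x s n)).
  rewrite exchange_big; apply: ler_sum => n _; rewrite -mulr_suml.
  have Ln : L n by apply: NL => /=; exact: ltn_ord.
  have xn := x0 s n sT Ln; case: ifPn => nF.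
    rewrite mulr0 addr0 ler_wpM2r//; apply: (hF2 n nF) => k kG.
    by apply: (LN_sub F2N); exact: GN.
  rewrite -mulrDl ler_wpM2r// (@le_trans _ _ Ws) ?lerDr ?(ltW d2)//.
  by apply: (wr n Ln) => k kG; exact: GL.
have h3 : \sum_(n < N) x s n <= Bx1 by apply: le_trans hB2; exact: (sums_le_ord NL (xB s sT)).
have h4 : \sum_(n < N) (if (n : nat) \in F1 then 0 else x s n) <= d'.
  rewrite (ord_sum N (fun n => if n \in F1 then 0 else x s n)).
  under eq_bigr => n _ do rewrite -if_neg.
  rewrite -big_mkcond -big_filter; apply: (sums_le_seq (hF1 s sT)).
    by rewrite filter_uniq// iota_uniq.
  move=> n; rewrite mem_filter mem_iota add0n => /andP[nF nN].
  by split; [exact: NL|move=> /= nF1; rewrite nF1 in nF].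
rewrite big_split -!mulr_sumr /= in h2.
have h5 : d'' * (\sum_(n < N) x s n) <= d'' * Bx1 by rewrite ler_wpM2l// ltW.
have h6 := ler_wpM2l Ws0 h4.
have W1 : 0 < Ws + 1 by rewrite ltr_wpDl.
have e1 : d'' * Bx1 = d / 2 by rewrite /d''; field; rewrite gt_eqF.
have e2 : (Ws + 1) * d' = d / 4 by rewrite /d'; field; rewrite gt_eqF.
have d'0 := ltW d1.
by move: h1 h2 h5 h6 e1 e2 d'0; nra.
Qed.

(** In each product one index of [X] is a discarded level, and the mass of [X]
    outside a finite box is small uniformly in time. *)
Lemma commutator_tail (V : nat -> nat -> R[i]) (X : R -> nat -> nat -> R[i]) (Vs : R) :
  0 <= Vs -> (forall n, L n -> sums_le L (fun k => cabs (V n k)) Vs) ->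
  (forall n, L n -> sums_le L (fun k => cabs (V k n)) Vs) ->
  (forall d, 0 < d -> exists2 F : {fset nat * nat}, [set` F] `<=` L `*` L &
     forall s, 0 <= s <= T -> sums_le ((L `*` L) `\` [set` F]) (fun a => cabs (X s a.1 a.2)) d) ->
  forall d, 0 < d -> exists2 F : {fset nat}, [set` F] `<=` L &
    forall N s, `I_N `<=` L -> [set` F] `<=` `I_N -> 0 <= s <= T ->
      sums_le (LN N) (fun k => \sum_(p : 'I_N * 'I_N)
        cabs (V p.1 k * X s k p.2 - V k p.2 * X s p.1 k)) d.
Proof.
move=> Vs0 Vr Vc Xt d d0.
have d1 : 0 < d / (2 * (Vs + 1)) by rewrite divr_gt0// mulr_gt0// ltr_wpDl.
have [F1 F1L hF1] := Xt _ d1; set d' := d / _ in d1 hF1.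
exists ([fset p.1 | p in F1] `|` [fset p.2 | p in F1])%fset.
  by move=> k /=; rewrite in_fsetU => /orP[] /imfsetP[p /= /F1L[L1 L2] ->].
move=> N s NL FN sT G GN.
have GL k : k \in G -> L k by move=> /GN[].
have F1N p : p \in F1 -> (p.1 < N)%N /\ (p.2 < N)%N.
  move=> pF; split; apply: FN; rewrite /= in_fsetU; apply/orP; [left|right].
    by apply/imfsetP; exists p.
  by apply/imfsetP; exists p.
have Lord (n : 'I_N) : L n by apply: NL => /=; exact: ltn_ord.
have uI := iota_uniq 0 N.
have mI n : n \in iota 0 N -> L n by rewrite mem_iota add0n => nN; exact: NL.
have h1 : \sum_(k <- G) \sum_(n < N) \sum_(m < N) cabs (V n k) * cabs (X s k m) <= Vs * d'.
  apply: (@le_trans _ _ (\sum_(k <- G) \sum_(m < N) Vs * cabs (X s k m))).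
    rewrite big_seq [leRHS]big_seq; apply: ler_sum => k kG; rewrite exchange_big.
    apply: ler_sum => m _; rewrite -mulr_suml ler_wpM2r ?cabs_ge0//.
    exact: (sums_le_ord NL (Vc k (GL k kG))).
  under eq_bigr do rewrite -mulr_sumr.
  rewrite -mulr_sumr ler_wpM2l//.
  under eq_bigr => k _ do rewrite (ord_sum N (fun m => cabs (X s k m))).
  apply: (sums_le_pair (f := fun p => cabs (X s p.1 p.2)) (hF1 s sT)) => //.
  move=> k m kG mN; split; first by split; [exact: GL|exact: mI].
  by move=> /F1N[kN _]; have [_] := GN k kG; apply.
have h2 : \sum_(k <- G) \sum_(n < N) \sum_(m < N) cabs (V k m) * cabs (X s n k) <= Vs * d'.
  apply: (@le_trans _ _ (\sum_(k <- G) \sum_(n < N) Vs * cabs (X s n k))).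
    rewrite big_seq [leRHS]big_seq; apply: ler_sum => k kG.
    apply: ler_sum => n _; rewrite -mulr_suml ler_wpM2r ?cabs_ge0//.
    exact: (sums_le_ord NL (Vr k (GL k kG))).
  under eq_bigr do rewrite -mulr_sumr.
  rewrite -mulr_sumr ler_wpM2l//.
  under eq_bigr => k _ do rewrite (ord_sum N (fun n => cabs (X s n k))).
  rewrite exchange_big /=.
  apply: (sums_le_pair (f := fun p => cabs (X s p.1 p.2)) (hF1 s sT)) => //.
  move=> n k nN kG; split; first by split; [exact: mI|exact: GL].
  by move=> /F1N[_ kN]; have [_] := GN k kG; apply.
apply: (@le_trans _ _ (\sum_(k <- G) \sum_(n < N) \sum_(m < N)
    (cabs (V n k) * cabs (X s k m) + cabs (V k m) * cabs (X s n k)))).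
  apply: ler_sum => k _; rewrite -(pair_bigA _ (fun n m : 'I_N => cabs (V n k * X s k m - V k m * X s n k))) /=.
  apply: ler_sum => n _; apply: ler_sum => m _; rewrite -!cabsM; exact: cabsB_le.
under eq_bigr => k _ do under eq_bigr => n _ do rewrite big_split /=.
under eq_bigr => k _ do rewrite big_split /=.
rewrite big_split /=.
have W1 : 0 < Vs + 1 by rewrite ltr_wpDl.
have e2 : (Vs + 1) * d' = d / 2 by rewrite /d'; field; rewrite gt_eqF.
have d'0 := ltW d1.
by move: h1 h2 e2 d'0; nra.
Qed.

End level_tails.

(** * Truncation to finitely many levels *)

Section truncation.
Context {R : realType} (D : bloch_data R) (hD : standing_assumptions D).
Variables (eta Ceta : R).
Hypotheses (eta_gt0 : 0 < eta) (Ceta_gt0 : 0 < Ceta)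
  (ha : small_divisors D eta Ceta) (hb : wave_regularity D eta).
Notation mu := (@lebesgue_measure R).
Notation Re := complex.Re.
Notation Im := complex.Im.
Notation L := (levels D).
Notation LN N := (levels D `\` `I_N).
Variables (T M Vs Ws g0 C0 B0 : R).
Hypotheses (T0 : 0 <= T) (Vs0 : 0 <= Vs) (Ws0 : 0 <= Ws) (g00 : 0 < g0) (C00 : 0 <= C0)
  (B00 : 0 <= B0).
Hypothesis phiM : forall t, `|phi D t| <= M.
Hypothesis V_row : forall n, L n -> sums_le L (fun k => cabs (Vc D n k)) Vs.
Hypothesis W_row_col : forall n, L n ->
  sums_le L (fun k => Wp D n k) Ws /\ sums_le L (fun k => Wp D k n) Ws.
Hypothesis g0_le : forall n m, L n -> L m -> n != m -> g0 <= gam D n m.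
Hypothesis C0_le : forall (F : {fset 'rV[int]_(nfreq D)}) (S : R), 1 <= S ->
  \sum_(a <- F) \sum_(b <- F | b != a) cabs (phi_hat D a) * cabs (phi_hat D b) *
    Num.min S (2 / `|freq_dot b (freq D) - freq_dot a (freq D)|) <= C0 * Num.sqrt S.
Hypothesis levels_cofinal : forall F : {fset nat}, [set` F] `<=` L ->
  exists2 N, `I_N `<=` L & [set` F] `<=` `I_N.
Hypothesis rho0_le : sums_le L (fun n => rho0 D n ^+ 2) B0.

Variables (e : R) (rho : R -> nat -> nat -> R[i]) (rho1 : R -> nat -> R).
Hypotheses (e0 : 0 < e) (e1 : e <= 1).
Hypotheses (hrho : bloch_solution D e rho) (hrho1 : rate_solution D e rho1).
Notation q := (e `^ muexp D).
Notation CA := (rate_const D g0).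
Notation CP := (corrector_const D g0 C0 T).

Let M0 : 0 <= M. Proof. exact: le_trans (phiM 0). Qed.
Let V_col n : L n -> sums_le L (fun k => cabs (Vc D k n)) Vs.
Proof.
move=> Ln; apply: sums_le_mono (V_row Ln) => k Lk.
by rewrite (sa_V_herm hD Ln Lk) cabs_conj.
Qed.

Lemma rate_const_ge0 : 0 <= CA.
Proof. by rewrite /rate_const divr_ge0 ?(ltW g00)// mulr_ge0 ?(wave_energy_ge0 hD). Qed.

Lemma corrector_const_ge0 : 0 <= CP.
Proof.
have h := wave_energy_ge0 hD; have g := ltW g00; rewrite /corrector_const.
by apply: mulr_ge0 => //; apply: addr_ge0; nonneg.
Qed.

Definition rate k n : R := if k == n then 0 else avg_Psi D e k n + Wp D k n.

Let Bs := CA / q * Vs * Vs + Ws.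

Let q0 : 0 < q := q_gt0 D e0.

Let Bs0 : 0 <= Bs.
Proof. by have := rate_const_ge0; have := ltW q0; rewrite /Bs => *; nonneg. Qed.

Let rate_ge0 k n : L k -> L n -> 0 <= rate k n.
Proof.
move=> Lk Ln; rewrite /rate; case: eqVneq => // kn.
have /andP[h _] := avg_Psi_bounds hD eta_gt0 Ceta_gt0 ha hb g00 g0_le e0 Lk Ln kn.
by rewrite addr_ge0// (sa_W_ge0 hD).
Qed.

Let rate_le k n : L k -> L n -> rate k n <= CA / q * Vs * cabs (Vc D k n) + Wp D k n.
Proof.
move=> Lk Ln; have W0 := sa_W_ge0 hD Lk Ln; have c0 := cabs_ge0 (Vc D k n).
have K0 : 0 <= CA / q by rewrite divr_ge0 ?(ltW q0)// rate_const_ge0.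
rewrite /rate; case: eqVneq => kn; first by nonneg.
have /andP[_ h] := avg_Psi_bounds hD eta_gt0 Ceta_gt0 ha hb g00 g0_le e0 Lk Ln kn.
rewrite lerD2r; apply: (le_trans h); rewrite -[leRHS]mulrA; apply: ler_wpM2l => //.
rewrite -cabs_sqr expr2; apply: ler_wpM2r => //.
exact: (sums_le_term (V_row Lk)).
Qed.

Let rate_row n : L n -> sums_le L (rate n) Bs.
Proof.
move=> Ln; have K0 : 0 <= CA / q * Vs.
  by rewrite mulr_ge0// divr_ge0 ?(ltW q0)// rate_const_ge0.
apply: sums_le_mono (sums_leD (sums_leZ K0 (V_row Ln)) (W_row_col Ln).1) => k Lk.
exact: rate_le.
Qed.

Let rate_col n : L n -> sums_le L (rate ^~ n) Bs.
Proof.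
move=> Ln; have K0 : 0 <= CA / q * Vs.
  by rewrite mulr_ge0// divr_ge0 ?(ltW q0)// rate_const_ge0.
apply: sums_le_mono (sums_leD (sums_leZ K0 (V_col Ln)) (W_row_col Ln).2) => k Lk.
exact: rate_le.
Qed.

Let r_rate k n : L k -> L n -> k != n -> rate k n = avg_Psi D e k n + Wp D k n.
Proof. by move=> _ _ /negbTE kn; rewrite /rate kn. Qed.

Let r_diag n : rate n n = 0. Proof. by rewrite /rate eqxx. Qed.

Let rho_w_near t d : 0 <= t <= T -> 0 < d -> \forall s \near nbhs t, 0 <= s <= T ->
  exists2 E, sums_le (L `*` L) E d & forall x, (L `*` L) x ->
    cabs (rho s x.1 x.2) <= 2 * cabs (rho t x.1 x.2) + 2 * E x.
Proof.
move=> tT d0; apply: filterS (rho_near hrho tT d0) => s hs sT.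
exists (fun a => cabs (rho s a.1 a.2 - rho t a.1 a.2)); first exact: hs.
move=> x _; set z := rho s _ _; set w := rho t _ _.
have h1 := cabs_triangle (z - w) w; rewrite subrK in h1.
have := cabs_ge0 w; have := cabs_ge0 (z - w); lra.
Qed.

Let rho_tails d : 0 < d -> exists2 F : {fset nat * nat}, [set` F] `<=` L `*` L &
  forall s, 0 <= s <= T -> sums_le ((L `*` L) `\` [set` F]) (fun a => cabs (rho s a.1 a.2)) d.
Proof.
apply: (@uniform_tails _ _ (L `*` L) T (fun s a => cabs (rho s a.1 a.2)));
  [by move=> *; exact: cabs_ge0| |exact: rho_w_near].
by move=> t /andP[t0 _]; exact: rho_sums hrho t t0.
Qed.

Let rho_bound : exists B, forall s, 0 <= s <= T ->
  sums_le (L `*` L) (fun a => cabs (rho s a.1 a.2)) B.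
Proof.
apply: (@uniform_sums _ _ (L `*` L) T (fun s a => cabs (rho s a.1 a.2)));
  last exact: rho_w_near.
by move=> t /andP[t0 _]; exact: rho_sums hrho t t0.
Qed.

Let rho1_w_near t d : 0 <= t <= T -> 0 < d -> \forall s \near nbhs t, 0 <= s <= T ->
  exists2 E, sums_le L E d & forall n, L n -> rho1 s n ^+ 2 <= 2 * rho1 t n ^+ 2 + 2 * E n.
Proof.
move=> tT d0; apply: filterS (rho1_near hrho1 tT d0) => s hs sT.
exists (fun n => (rho1 s n - rho1 t n) ^+ 2); first exact: hs.
by move=> n _; have := sqr_ge0 (rho1 s n - 2 * rho1 t n); nra.
Qed.

Let rho1_tails d : 0 < d -> exists2 F : {fset nat}, [set` F] `<=` L &
  forall s, 0 <= s <= T -> sums_le (L `\` [set` F]) (fun n => rho1 s n ^+ 2) d.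
Proof.
apply: (@uniform_tails _ _ L T (fun s n => rho1 s n ^+ 2));
  [by move=> *; exact: sqr_ge0| |exact: rho1_w_near].
by move=> t /andP[t0 _]; exact: rho1_sums hrho1 t t0.
Qed.

Let rho1_bound : exists B, forall s, 0 <= s <= T -> sums_le L (fun n => rho1 s n ^+ 2) B.
Proof.
apply: (@uniform_sums _ _ L T (fun s n => rho1 s n ^+ 2)); last exact: rho1_w_near.
by move=> t /andP[t0 _]; exact: rho1_sums hrho1 t t0.
Qed.

Let diag_inj : injective (fun n : nat => (n, n)). Proof. by move=> n m []. Qed.

Let diag_tails d : 0 < d -> exists2 F : {fset nat}, [set` F] `<=` L &
  forall s, 0 <= s <= T -> sums_le (L `\` [set` F]) (fun n => cabs (rho s n n)) d.
Proof.
move=> /rho_tails[F FL hF]; exists [fset p.1 | p in F]%fset.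
  by move=> k /imfsetP[p /= /FL[L1 _] ->].
move=> s sT.
apply: (sums_le_inj (f := fun a => cabs (rho s a.1 a.2)) diag_inj _ (hF s sT)) => n [Ln nF].
by split => // nnF; apply: nF; apply/imfsetP; exists (n, n).
Qed.

Let diag_bound : exists B, forall s, 0 <= s <= T -> sums_le L (fun n => cabs (rho s n n)) B.
Proof.
have [B hB] := rho_bound; exists B => s sT.
by apply: (sums_le_inj (f := fun a => cabs (rho s a.1 a.2)) diag_inj _ (hB s sT)).
Qed.

Definition leak_W N n s : R[i] :=
  csum (LN N) (fun k => ofR (Wp D k n) * rho s k k - ofR (Wp D n k) * rho s n n).
Definition leak_V N n m s : R[i] :=
  csum (LN N) (fun k => Vc D n k * rho s k m - Vc D k m * rho s n k).
Definition leak_rate N n s : R := Re (csum (LN N) (exchange_term rho1 rate s n)).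

Let Lord N : `I_N `<=` L -> forall n : 'I_N, L n.
Proof. by move=> NL n; apply: NL => /=; exact: ltn_ord. Qed.

Lemma leak_W_small d : 0 < d -> exists2 F : {fset nat}, [set` F] `<=` L &
  forall N s, `I_N `<=` L -> [set` F] `<=` `I_N -> 0 <= s <= T ->
    \sum_(n < N) cabs (leak_W N n s) <= d.
Proof.
move=> d0; have [Bx hBx] := diag_bound.
have W0 n k : L n -> L k -> 0 <= Wp D n k by move=> *; exact: sa_W_ge0.
have [F FL hF] := exchange_tail (x := fun s n => cabs (rho s n n)) Ws0 W0
  (fun n Ln => (W_row_col Ln).1) (fun n Ln => (W_row_col Ln).2)
  (fun s n _ _ => cabs_ge0 _) hBx diag_tails d0.
exists F => // N s NL FN sT; apply: sum_csum_le.
apply: sums_le_mono (hF N s NL FN sT) => k [Lk _]; apply: ler_sum => n _.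
apply: (le_trans (cabsB_le _ _)); rewrite !cabsM !cabs_ofR.
by rewrite !ger0_norm ?W0//; exact: Lord.
Qed.

Lemma leak_V_small d : 0 < d -> exists2 F : {fset nat}, [set` F] `<=` L &
  forall N s, `I_N `<=` L -> [set` F] `<=` `I_N -> 0 <= s <= T ->
    \sum_(p : 'I_N * 'I_N) cabs (leak_V N p.1 p.2 s) <= d.
Proof.
move=> d0; have [F FL hF] := commutator_tail (X := rho) Vs0 V_row V_col rho_tails d0.
by exists F => // N s NL FN sT; apply: sum_csum_le; exact: hF.
Qed.

Lemma leak_rate_small d : 0 < d -> exists2 F : {fset nat}, [set` F] `<=` L &
  forall N s, `I_N `<=` L -> [set` F] `<=` `I_N -> 0 <= s <= T ->
    \sum_(n < N) leak_rate N n s ^+ 2 <= d.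
Proof.
move=> d0; have [Bx hBx] := rho1_bound.
have B1 : 0 < Bs + 1 by rewrite ltr_wpDl.
have d1 : 0 < d / (2 * (Bs + 1)) by rewrite divr_gt0// mulr_gt0.
have [F FL hF] := exchange_tail (x := fun s n => rho1 s n ^+ 2) Bs0 rate_ge0 rate_row rate_col
  (fun s n _ _ => sqr_ge0 _) hBx rho1_tails d1.
exists F => // N s NL FN sT.
apply: (@le_trans _ _ (\sum_(n < N) nsq (csum (LN N) (exchange_term rho1 rate s n)))).
  by apply: ler_sum => n _; rewrite /leak_rate /nsq lerDl sqr_ge0.
apply: sum_nsq_csum_le => [n|G GN].
  have [/(_ s sT)[B hB] _] := l1_continuous_exchange T hrho1 Bs0 rate_ge0 rate_row rate_col (Lord NL n).
  by exists B; apply: sums_leS hB; exact: subDsetl.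
have GL k : k \in G -> L k by move=> /GN[].
have h := hF N s NL FN sT G GN.
set Q := \sum_(k <- G) _ in h.
have Q0 : 0 <= Q.
  rewrite /Q big_seq; apply: sumr_ge0 => k kG; apply: sumr_ge0 => n _.
  have r1 := rate_ge0 (GL k kG) (Lord NL n); have r2 := rate_ge0 (Lord NL n) (GL k kG).
  by apply: addr_ge0; apply: mulr_ge0 => //; exact: sqr_ge0.
apply: (@le_trans _ _ (2 * Bs * Q)); last first.
  have e2 : (Bs + 1) * (d / (2 * (Bs + 1))) = d / 2 by field; rewrite gt_eqF.
  have := ler_wpM2l Bs0 h; have := ltW d1; lra.
rewrite /Q exchange_big /= mulr_sumr; apply: ler_sum => n _.
have cauchy (a : nat -> R) (u : nat -> R) : (forall k, k \in G -> 0 <= a k) ->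
    \sum_(k <- G) a k <= Bs ->
    nsq (\sum_(k <- G) ofR (a k) * ofR (u k)) <= Bs * \sum_(k <- G) a k * u k ^+ 2.
  move=> a0 aB; apply: (le_trans (nsq_sum_le _ _ _ _)).
  have -> : \sum_(k <- G) cabs (ofR (a k)) = \sum_(k <- G) a k.
    by apply: eq_big_seq => k kG; rewrite cabs_ofR ger0_norm ?a0.
  have -> : \sum_(k <- G) cabs (ofR (a k)) * nsq (ofR (u k)) = \sum_(k <- G) a k * u k ^+ 2.
    by apply: eq_big_seq => k kG; rewrite cabs_ofR ger0_norm ?a0// nsq_ofR.
  apply: ler_wpM2r => //; rewrite big_seq; apply: sumr_ge0 => k kG.
  by apply: mulr_ge0; [exact: a0|exact: sqr_ge0].
have Ln := Lord NL n.
rewrite /exchange_term sumrB; apply: (le_trans (nsqB_le _ _)).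
have h1 := cauchy (fun k => rate k n) (rho1 s) (fun k kG => rate_ge0 (GL k kG) Ln)
  (rate_col Ln GL).
have h2 := cauchy (rate n) (fun=> rho1 s n) (fun k kG => rate_ge0 Ln (GL k kG))
  (rate_row Ln GL).
rewrite big_split /=; lra.
Qed.

Let slow s := slow_wave D e s.

Definition leak N (n m : 'I_N) s : R[i] :=
  (if n == m then leak_W N n s else 0) + imag * ofR (e^-1 * slow s) * leak_V N n m s.

Let truncated_equation N (n m : 'I_N) s : `I_N `<=` L -> 0 <= s <= T ->
  ofR (e ^- 2) * bloch_rhs D e s (rho s) n m =
  drho (fun n m : 'I_N => Vc D n m) (fun n m => Wp D n m) (fun n m => gam D n m)
    (fun n m => om_eps D e n m) e q slow (fun n m t => rho t n m) (@leak N) n m s.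
Proof.
move=> NL sT; have Ln := Lord NL n; have Lm := Lord NL m.
pose ei : R[i] := ofR e^-1.
have eei : ofR e * ei = 1 by rewrite -ofRM mulfV ?ofR1// gt_eqF.
have e2 : ofR (e ^+ 2) = ofR e * ofR e by rewrite expr2 ofRM.
have ei2 : ofR (e ^- 2) = ei * ei by rewrite -exprVn expr2 ofRM.
rewrite /bloch_rhs (wave_csum hD hrho Ln Lm sT).
have [/(_ s sT)[B hB] _] := l1_continuous_V hD T hrho Ln Lm.
rewrite (csum_split NL hB) -/(leak_V N n m s) -/(comm (fun n m : 'I_N => Vc D n m) (fun n m => rho s n m) n m).
set c := comm _ _ _ _; set v := leak_V _ _ _ _.
rewrite /drho /leak -/slow -/c !ofRM -/ei /slow_wave -/(slow_wave D e s) -/(slow s).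
rewrite /relaxation -val_eqE /=; case: eqVneq => [nm|nm].
  have {}nm : n = m by exact: val_inj.
  rewrite -nm in v c *.
  have [/(_ s sT)[B' hB'] _] := l1_continuous_W hD T hrho Ln.
  rewrite (csum_split NL hB') -/(leak_W N n s) /rate_W.
  set a := \sum_(k < N) _; set b := leak_W _ _ _.
  have -> : om_eps D e n n = 0 by rewrite /om_eps /om2 /dl2; ring.
  rewrite ofR0 mulr0 mul0r add0r e2 ei2.
  have -> : ei * ei * (ofR e * ofR e * (a + b) + imag * ofR e * (ofR (slow s) * (c + v))) =
    (ofR e * ei) * (ofR e * ei) * (a + b) + (ofR e * ei) * (imag * ei * ofR (slow s) * (c + v)).
    by ring.
  rewrite eei /v; ring.
rewrite -/v /Lam ei2 !ofRM.
set w := ofR (slow s); set z := rho s n m; set g := ofR (gam D n m).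
have -> : ei * ei * (- imag * ofR (om_eps D e n m) * z + - (ofR q * g) * z +
    imag * ofR e * (w * (c + v))) =
  ei * ei * (- imag * ofR (om_eps D e n m) * z + - (ofR q * g) * z) +
    (ofR e * ei) * (imag * ei * w * (c + v)) by ring.
by rewrite eei; ring.
Qed.

Let truncated_rate N (n : 'I_N) s : `I_N `<=` L -> 0 <= s <= T ->
  Re (csum L (exchange_term rho1 rate s n)) =
  drho1 (fun n m : 'I_N => Wp D n m) (fun n m => avg_Psi D e n m) (fun (n : 'I_N) t => rho1 t n)
    (fun n t => leak_rate N n t) n s.
Proof.
move=> NL sT; have Ln := Lord NL n.
have [/(_ s sT)[B hB] _] := l1_continuous_exchange T hrho1 Bs0 rate_ge0 rate_row rate_col Ln.
rewrite (csum_split NL hB) ReD /drho1 -/(leak_rate N n s); congr (_ + _).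
rewrite Re_sum [RHS]big_mkcond; apply: eq_bigr => k _.
rewrite /exchange_term -!ofRM -ofRB Re_ofR.
case: (eqVneq k n) => [->|kn] /=; first by rewrite r_diag !mul0r subrr.
have kn' : (k : nat) != n by [].
by rewrite /rate (eq_sym (n : nat)) (negbTE kn').
Qed.

Let sum_nsq_le (J : finType) (z : J -> R[i]) d : \sum_j cabs (z j) <= d ->
  \sum_j nsq (z j) <= d ^+ 2.
Proof.
move=> zd; have d0 : 0 <= d by apply: le_trans zd; apply: sumr_ge0 => j _; exact: cabs_ge0.
apply: (@le_trans _ _ (\sum_j d * cabs (z j))); last by rewrite -mulr_sumr expr2 ler_wpM2l.
apply: ler_sum => j _; rewrite -cabs_sqr expr2; apply: ler_wpM2r; first exact: cabs_ge0.
apply: le_trans zd; apply: (ler_term (F := fun j => cabs (z j))) => i; exact: cabs_ge0.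
Qed.

Let leak_le N s : 0 <= s <= T -> \sum_(n < N) cabs (leak_W N n s) <= e / 2 ->
  \sum_(p : 'I_N * 'I_N) cabs (leak_V N p.1 p.2 s) <= e ^+ 2 / (2 * (M + 1)) ->
  hs2 (fun n m => @leak N n m s) <= e ^+ 2.
Proof.
move=> sT h1 h2; have M1 : 0 < M + 1 by rewrite ltr_wpDl.
apply: (le_trans (hs2D_le (fun n m : 'I_N => if n == m then leak_W N n s else 0)
  (fun n m : 'I_N => imag * ofR (e^-1 * slow s) * leak_V N n m s))).
have a1 : hs2 (fun n m : 'I_N => if n == m then leak_W N n s else 0) <= (e / 2) ^+ 2.
  rewrite hs2E; apply: le_trans (sum_nsq_le h1); apply: ler_sum => n _.
  rewrite (bigD1 n)//= eqxx big1 ?addr0// => m mn.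
  by rewrite eq_sym (negbTE mn) nsq0.
have a2 : hs2 (fun n m : 'I_N => imag * ofR (e^-1 * slow s) * leak_V N n m s) <= (e / 2) ^+ 2.
  apply: (@le_trans _ _ ((e^-1 * M) ^+ 2 * (e ^+ 2 / (2 * (M + 1))) ^+ 2)).
    apply: (@le_trans _ _ ((e^-1 * slow s) ^+ 2 * \sum_(p : 'I_N * 'I_N) nsq (leak_V N p.1 p.2 s))).
      rewrite mulr_sumr; apply: ler_sum => p _.
      by rewrite !nsqM nsq_imag mul1r nsq_ofR.
    apply: ler_pM; [exact: sqr_ge0|by apply: sumr_ge0 => p _; exact: nsq_ge0| |exact: sum_nsq_le].
    rewrite !exprMn; apply: ler_wpM2l; first exact: sqr_ge0.
    by rewrite -[leLHS]real_normK ?num_real// ler_pXn2r ?nnegrE// /slow /slow_wave phiM.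
  have -> : (e^-1 * M) ^+ 2 * (e ^+ 2 / (2 * (M + 1))) ^+ 2 = (e / 2) ^+ 2 * (M / (M + 1)) ^+ 2.
    by field; rewrite !gt_eqF.
  apply: ler_piMr; first exact: sqr_ge0.
  rewrite expr_le1//; last by rewrite divr_ge0// ltW.
  by rewrite ler_pdivrMr// mul1r lerDl.
have e20 := sqr_ge0 e; rewrite expr_div_n in a1 a2; lra.
Qed.

Let fset_sum_le_ord N (G : {fset nat}) (f : nat -> R) : (forall n, 0 <= f n) ->
  [set` G] `<=` `I_N -> \sum_(n <- G) f n <= \sum_(n < N) f n.
Proof.
move=> f0 GN; rewrite ord_sum; have ps : perm_eq (iota 0 N) (seq_fset tt (iota 0 N)).
  rewrite perm_sym; apply: perm_trans (seq_fset_perm _ _) _.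
  by rewrite undup_id// iota_uniq.
rewrite (perm_big _ ps) /=; apply: (@fset_sum_subset R _ G (seq_fset tt (iota 0 N)) f) => //.
by apply/fsubsetP => k kG; rewrite seq_fsetE mem_iota add0n; exact: GN.
Qed.

(** [N] may depend on [e] and on the solutions, since the constant does not depend on
    [N]: it is chosen so large that the leaks are bounded by [e]. *)
Theorem truncated_populations_le (G : {fset nat}) t : [set` G] `<=` L -> 0 <= t <= T ->
  \sum_(n <- G) nsq (rho t n n - ofR (rho1 t n)) <=
  K8 T M Vs Ws g0 B0 CA CP * (e / q ^+ 2) ^+ 2.
Proof.
move=> GL tT.
have dW : 0 < e / 2 by rewrite divr_gt0.
have M1 : 0 < M + 1 by rewrite ltr_wpDl.
have dV : 0 < e ^+ 2 / (2 * (M + 1)) by rewrite divr_gt0 ?exprn_gt0// mulr_gt0.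
have d1 : 0 < e ^+ 2 by rewrite exprn_gt0.
have [F1 F1L h1] := leak_W_small dW.
have [F2 F2L h2] := leak_V_small dV.
have [F3 F3L h3] := leak_rate_small d1.
have [N NL GN] : exists2 N, `I_N `<=` L & [set` (G `|` F1 `|` F2 `|` F3)%fset] `<=` `I_N.
  apply: levels_cofinal => k /=; rewrite !in_fsetU => /orP[/orP[/orP[]|]|].
  - exact: GL.
  - exact: F1L.
  - exact: F2L.
  - exact: F3L.
have GN' : [set` G] `<=` `I_N by move=> k kG; apply: GN; rewrite /= !in_fsetU kG.
have F1N : [set` F1] `<=` `I_N by move=> k kG; apply: GN; rewrite /= !in_fsetU kG !orbT.
have F2N : [set` F2] `<=` `I_N by move=> k kG; apply: GN; rewrite /= !in_fsetU kG !orbT.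
have F3N : [set` F3] `<=` `I_N by move=> k kG; apply: GN; rewrite /= !in_fsetU kG !orbT.
apply: (@le_trans _ _ (\sum_(n < N) nsq (rho t n n - ofR (rho1 t n)))).
  exact: (@fset_sum_le_ord N G (fun n => nsq (rho t n n - ofR (rho1 t n)))
    (fun n => nsq_ge0 _) GN').
have rb := avg_Psi_bounds hD eta_gt0 Ceta_gt0 ha hb g00 g0_le e0.
apply: (@finite_levels_estimate R 'I_N T M Vs Ws g0 B0 CA CP T0 M0 Vs0 Ws0 g00 B00
  rate_const_ge0 corrector_const_ge0 (fun n m => Vc D n m) (fun n m => Wp D n m)
  (fun n m => gam D n m) (fun n m => om_eps D e n m) _ _ _ _ _ _ e q e0 e1 q0 (q_le1 hD e0 e1)
  (e_le_q2 hD e0 e1) slow _ (fun n m t => rho t n m) (@leak N) _ _ _ _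
  (fun n m => slow_response D e n m) _ _ _ (fun n m => avg_Psi D e n m)
  (fun n m => rate_corrector D e n m) (fun n t => rho1 t n) (fun n t => leak_rate N n t)
  _ _ _ _ _ _ _ _ _ t tT).
- by move=> n m; exact: (sa_V_herm hD (Lord NL n) (Lord NL m)).
- by move=> n; exact: (sums_le_ord NL (V_row (Lord NL n))).
- by move=> n m; exact: (sa_W_ge0 hD (Lord NL n) (Lord NL m)).
- by move=> n; exact: (sums_le_ord NL (W_row_col (Lord NL n)).1).
- by move=> n; exact: (sums_le_ord NL (W_row_col (Lord NL n)).2).
- by move=> n m nm; exact: (g0_le (Lord NL n) (Lord NL m) nm).
- by move=> s _; exact: phiM.
- move=> n m; apply: cprimitive_ext (rho_prim hD T e0 hrho (Lord NL n) (Lord NL m)) => s sT.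
  exact: truncated_equation.
- move=> n m nm; rewrite (bs_initial hrho) ?val_eqE ?(negbTE nm)//; exact: Lord.
- rewrite /l2n; under eq_bigr => n _ do rewrite (bs_initial hrho (Lord NL n) (Lord NL n)) eqxx nsq_ofR.
  exact: (sums_le_ord NL rho0_le).
- by move=> s sT; apply: leak_le => //; [exact: h1|exact: h2].
- move=> n m nm; exact: slow_response_prim.
- move=> n m; exact: slow_response0.
- by move=> n m s nm /andP[s0 _]; exact: (slow_response_herm hD e0 (Lord NL n) (Lord NL m) s0).
- by move=> n k; exact: (avg_Psi_sym hD e (Lord NL n) (Lord NL k)).
- by move=> n k; rewrite eq_sym => kn; have /andP[] := rb _ _ (Lord NL n) (Lord NL k) kn.
- by move=> n k; rewrite eq_sym => kn; have /andP[] := rb _ _ (Lord NL n) (Lord NL k) kn.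
- by move=> n k kn; exact: (rate_corrector_prim hD T0 e0 (Lord NL n) (Lord NL k)).
- by move=> n k kn; rewrite /rate_corrector integral_point.
- by move=> n k s; rewrite eq_sym => kn sT; exact: (rate_corrector_le hD eta_gt0 Ceta_gt0 ha hb g00 C00 T0 g0_le C0_le e0 e1 (Lord NL n) (Lord NL k) kn sT).
- move=> n; apply: primitive_ext (rho1_prim T hrho1 Bs0 rate_ge0 rate_row rate_col r_rate r_diag (Lord NL n)) => s sT.
  exact: truncated_rate.
- by move=> n; rewrite (bs_initial hrho (Lord NL n) (Lord NL n)) eqxx (rs_initial hrho1 (Lord NL n)).
- by move=> s sT; exact: h3.
Qed.

End truncation.

(** * The error on the populations *)

Lemma levels_cofinal (R : realType) (D : bloch_data R) (hD : standing_assumptions D)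
    (F : {fset nat}) : [set` F] `<=` levels D ->
  exists2 N, `I_N `<=` levels D & [set` F] `<=` `I_N.
Proof.
have [->|[N ->]] := sa_levels hD; last by exists N.
move=> _; exists (\max_(k <- F) k).+1 => // k kF.
by rewrite /= ltnS; exact: leq_bigmax_seq.
Qed.

Lemma Linfl2norm_le (R : realType) (L : set nat) (T c : R) (u : R -> nat -> R[i]) :
  0 <= c -> (forall t, 0 <= t <= T -> sums_le L (fun n => nsq (u t n)) (c ^+ 2)) ->
  (Linfl2norm L T u <= c%:E)%E.
Proof.
move=> c0 h; apply: ub_ereal_sup => _ [t /= tT <-].
rewrite /l2norm -[leRHS]gee0_abs ?lee_fin// -sqrte_sqr lee_sqrt; last first.
  by rewrite -EFin_expe lee_fin sqr_ge0.
rewrite -EFin_expe; apply: esum_le_fset_sums => G GL; rewrite lee_fin.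
by under eq_bigr do rewrite cabs_sqr; exact: h.
Qed.

Theorem proposition4 (R : realType) (D : bloch_data R)
    (hD : standing_assumptions D)
    (eta Ceta : R) (eta_gt0 : 0 < eta) (Ceta_gt0 : 0 < Ceta)
    (ha : small_divisors D eta Ceta)
    (hb : wave_regularity D eta) :
  (forall (e : R) (k n : nat), 0 < e <= 1 -> levels D k -> levels D n ->
     k != n ->
     Psi_mean D e k n s @[s --> +oo] --> avg_Psi_explicit D e k n) /\
  (forall T : R, 0 < T ->
     exists2 C : R, 0 < C &
     forall (e : R) (rho : R -> nat -> nat -> R[i]) (rho1 : R -> nat -> R),
       0 < e <= 1 -> bloch_solution D e rho -> rate_solution D e rho1 ->
       (Linfl2norm (levels D) T (fun t n => (rho t n n - ofR (rho1 t n))%R)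
        <= (C * e `^ (1 - 2 * muexp D))%:E)%E).
Proof.
split=> [e k n /andP[e0 _] kL nL kn|T T0].
  exact: (Psi_mean_cvg hD eta_gt0 Ceta_gt0 ha hb e0 kL nL kn).
have [M phiM] := sa_phi_bounded hD.
have [Vs Vs0 hV] := V_rows hD; have [Ws Ws0 hW] := W_rows_cols hD.
have [g0 g00 hg] := sa_gam_inf hD; have [B0 B00 hB] := rho0_l2 hD.
have [C0 C00 hC] := wave_offdiagonal hD eta_gt0 Ceta_gt0 ha hb.
pose K := K8 T M Vs Ws g0 B0 (rate_const D g0) (corrector_const D g0 C0 T).
exists (Num.sqrt K + 1); first by rewrite ltr_wpDl ?sqrtr_ge0.
move=> e rho rho1 /andP[e0 e1] hrho hrho1.
have C1 : 0 <= Num.sqrt K + 1 by rewrite addr_ge0 ?sqrtr_ge0.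
apply: Linfl2norm_le => [|t tT G GL]; first by rewrite mulr_ge0 ?powR_ge0.
have := truncated_populations_le hD eta_gt0 Ceta_gt0 ha hb (ltW T0) Vs0 Ws0 g00 C00 B00 phiM
  hV hW hg hC (levels_cofinal hD) hB e0 e1 hrho hrho1 GL tT.
move=> /le_trans; apply; rewrite -/K.
have -> : e / (e `^ muexp D) ^+ 2 = e `^ (1 - 2 * muexp D).
  have ne : e != 0 by rewrite gt_eqF.
  rewrite powRD ?ne ?implybT// powRr1 ?(ltW e0)//; congr (_ * _).
  rewrite powRN; congr (_^-1).
  have -> : 2 * muexp D = muexp D + muexp D by ring.
  by rewrite powRD ?ne ?implybT// expr2.
rewrite exprMn ler_wpM2r ?sqr_ge0//.
have [K0|K0] := leP 0 K; last by rewrite (le_trans (ltW K0)) ?sqr_ge0.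
have := sqr_sqrtr K0; have := sqrtr_ge0 K; nra.
Qed.
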